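(* Let $N\ge 1$ be an integer, let $\rho:\mathbb{R}^3\to\mathbb{R}$ be measurable with $\rho\ge 0$ and $\int_{\mathbb{R}^3}\rho\,d\mathbf{r}=N$, and let $\boldsymbol{\kappa}=(\kappa_1,\kappa_2,\kappa_3):\mathbb{R}^3\to\mathbb{R}^3$ be measurable. Assume that $\sqrt{\rho}\in H^1(\mathbb{R}^3)$, that $\rho\,\kappa_\alpha^2\in L^1(\mathbb{R}^3)$, and that $(1+r^2)\,\rho\,(\partial\kappa_\beta/\partial r_\alpha)^2\in L^1(\mathbb{R}^3)$ for all $\alpha,\beta\in\{1,2,3\}$, where $r=|\mathbf{r}|$. Then there exist real constants $\lambda\ge 0$, $\mu>0$ and $D\in\mathcal{D}_{N,1}$ with density $\rho_D=\rho$ and paramagnetic current density $\mathbf{j}_{\mathrm{p};D}=\frac12\rho\boldsymbol{\kappa}$ (both a.e.) such that the canonical kinetic energy of $D$ satisfies $$\frac12\operatorname{Tr}(\nabla_1\cdot\nabla_2 D)\;\le\; T_W[\rho]+4\,T_{\mathrm p}\!\left[\rho,\tfrac12\rho\boldsymbol{\kappa}\right]+\frac12(\lambda+\mu)N+\int_{\mathbb{R}^3}\rho(\mathbf{r})\left(\tfrac34 r^2+\tfrac{1}{32\mu}\right)\sum_{\alpha,\beta=1}^3\left(\frac{\partial\kappa_\beta(\mathbf{r})}{\partial r_\alpha}\right)^2 d\mathbf{r}.$$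
   Context: All derivatives are weak (distributional) derivatives; in particular the hypothesis on $\partial\kappa_\beta/\partial r_\alpha$ presupposes that $\kappa_\beta\in L^1_{\mathrm{loc}}(\mathbb{R}^3)$ has weak partial derivatives in $L^1_{\mathrm{loc}}(\mathbb{R}^3)$. Functionals: $T_W[\rho]=\frac18\int\rho^{-1}|\nabla\rho|^2\,d\mathbf{r}=\frac12\int|\nabla\sqrt\rho|^2\,d\mathbf{r}$ and $T_{\mathrm p}[\rho,\mathbf{j}]=\frac12\int\rho^{-1}|\mathbf{j}|^2\,d\mathbf{r}$, so $T_{\mathrm p}[\rho,\frac12\rho\boldsymbol\kappa]=\frac18\int\rho|\boldsymbol\kappa|^2\,d\mathbf{r}$. $\mathcal{D}_{N,1}$ (the set of one-particle reduced density matrices, 1-rdms, of mixed $N$-electron states) consists of those $D\in L^2(\mathbb{R}^3\times\mathbb{R}^3)$ that are kernels of trace-class operators on $L^2(\mathbb{R}^3)$, are Hermitian ($D(\mathbf{r},\mathbf{s})=D(\mathbf{s},\mathbf{r})^*$ a.e.), satisfy $0\le\iint\phi^*(\mathbf{r})D(\mathbf{r},\mathbf{s})\phi(\mathbf{s})\,d\mathbf{r}\,d\mathbf{s}\le 2\|\phi\|_2^2$ for all $\phi\in L^2(\mathbb{R}^3)$, and have $\operatorname{Tr}D=N$. Kernel product: $(B*C)(x,y)=\int B(x,z)C(z,y)\,dz$, and $G^\dagger(\mathbf{r},\mathbf{u})=G(\mathbf{u},\mathbf{r})^*$, so $(G^\dagger*G)(\mathbf{r},\mathbf{s})=\int G(\mathbf{u},\mathbf{r})^*G(\mathbf{u},\mathbf{s})\,d\mathbf{u}$.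 $\nabla_i$ is the weak gradient with respect to the $i$th argument. $L^2(\mathbb{R}^3\times\mathbb{R}^3_{\mathrm{loc}})$ is the set of functions lying in $L^2(\mathbb{R}^3\times K)$ for every compact $K\subset\mathbb{R}^3$. $D\in\mathcal{D}_{N,1}$ has locally finite kinetic energy if the weak derivative $\nabla_1\cdot\nabla_2D$ is the kernel of a trace-class operator over $L^2(K)$ for every compact $K\subset\mathbb{R}^3$; equivalently, there is a factorization $D=G^\dagger*G$ a.e. with $G\in L^2(\mathbb{R}^3\times\mathbb{R}^3)$ and $\nabla_2G\in L^2(\mathbb{R}^3\times\mathbb{R}^3_{\mathrm{loc}})$. The density of $D$ is $\rho_D(\mathbf{r})=(G^\dagger*G)(\mathbf{r},\mathbf{r})$ for any factorization $D=G^\dagger*G$ with $G\in L^2(\mathbb{R}^3\times\mathbb{R}^3)$. The current density of $D$ is defined when $D$ has locally finite kinetic energy (so ''$D$ has current $\mathbf{j}$'' includes this property): $\mathbf{j}_{\mathrm{p};D}=\operatorname{Re}\mathbf{c}_D$, with $\mathbf{c}_D(\mathbf{r})=\int[-\mathrm{i}\nabla_2G^*(\mathbf{u},\mathbf{r})]\,G(\mathbf{u},\mathbf{r})\,d\mathbf{u}$ for any factorization $D=G^\dagger*G$ a.e. with $G\in L^2(\mathbb{R}^3\times\mathbb{R}^3)$ and $\nabla_2G\in L^2(\mathbb{R}^3\times\mathbb{R}^3_{\mathrm{loc}})$. These are independent of the factorization (a.e.). The canonical kinetic energy is $\frac12\operatorname{Tr}(\nabla_1\cdot\nabla_2D)=\int_{\mathbb{R}^3}\tau_D\,d\mathbf{r}$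 with $\tau_D(\mathbf{r})=\frac12\int|\nabla_2G(\mathbf{u},\mathbf{r})|^2\,d\mathbf{u}$. *)

(* Defs.v *)
From HB Require Import structures.
From mathcomp Require Import all_boot all_order all_algebra.
From mathcomp Require Import all_classical all_reals all_analysis.
From mathcomp Require Import complex.

Set Implicit Arguments.
Unset Strict Implicit.
Unset Printing Implicit Defensive.

Import Order.TTheory GRing.Theory Num.Theory.
Import numFieldNormedType.Exports.

Local Open Scope classical_set_scope.
Local Open Scope ring_scope.
Local Open Scope complex_scope.

(* The library infers the sigma-finite structure of a product measure only when
   both factors are subprobabilities. *)
Lemma sigma_finite_product d1 d2 (T1 : measurableType d1)
    (T2 : measurableType d2) (R : realType)
    (m1 : {sigma_finite_measure set T1 -> \bar R})
    (m2 : {sigma_finite_measure set T2 -> \bar R}) :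
  sigma_finite setT (m1 \x m2)%E.
Proof.
have /sigma_finiteP[F [TF ndF Foo]] := sigma_finiteT m1.
have /sigma_finiteP[G [TG ndG Goo]] := sigma_finiteT m2.
exists (fun n => F n `*` G n).
  rewrite -setXTT TF TG predeqE => -[x y]; split.
    move=> [/= [n _ Fnx] [k _ Gky]]; exists (maxn n k) => //; split.
    - by move: x Fnx; exact/subsetPset/ndF/leq_maxl.
    - by move: y Gky; exact/subsetPset/ndG/leq_maxr.
  by move=> [n _ []/= ? ?]; split; exists n.
move=> k; have [? ?] := Foo k; have [? ?] := Goo k.
split; first exact: measurableX.
by rewrite product_measure1E// lte_mul_pinfty// ge0_fin_numE.
Qed.

(* The carrier of Lebesgue measure is [measurableTypeR R], a copy of [R]; with
   it the measurable structure of R^3 is the Borel sigma-algebra on which the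
   product measures below live, while its topology and norm are those of the
   product R * R * R. *)
Definition R3 (R : realType) : Type :=
  (measurableTypeR R * measurableTypeR R * measurableTypeR R)%type.
Definition R6 (R : realType) : Type := (R3 R * R3 R)%type.

Definition mu2 (R : realType) :=
  (@lebesgue_measure R \x @lebesgue_measure R)%E.
Arguments mu2 : clear implicits.
HB.instance Definition _ (R : realType) := Measure.on (mu2 R).
HB.instance Definition _ (R : realType) :=
  Measure_isSigmaFinite.Build _ _ _ (mu2 R)
    (sigma_finite_product (@lebesgue_measure R) (@lebesgue_measure R)).

Definition mu3 (R : realType) := (mu2 R \x @lebesgue_measure R)%E.
Arguments mu3 : clear implicits.
HB.instance Definition _ (R : realType) := Measure.on (mu3 R).
HB.instance Definition _ (R : realType) :=
  Measure_isSigmaFinite.Build _ _ _ (mu3 R)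
    (sigma_finite_product (mu2 R) (@lebesgue_measure R)).

Definition mu6 (R : realType) := (mu3 R \x mu3 R)%E.
Arguments mu6 : clear implicits.
HB.instance Definition _ (R : realType) := Measure.on (mu6 R).
HB.instance Definition _ (R : realType) :=
  Measure_isSigmaFinite.Build _ _ _ (mu6 R)
    (sigma_finite_product (mu3 R) (mu3 R)).

Section Euclidean.
Variable R : realType.

Definition coord3 (r : R3 R) (a : 'I_3) : R := nth 0 [:: r.1.1; r.1.2; r.2] a.

Definition unit_vec (a : 'I_3) : R3 R :=
  ((a == 0%N :> nat)%:R, (a == 1%N :> nat)%:R, (a == 2%N :> nat)%:R).

Definition sqr_radius (r : R3 R) : R := \sum_(a < 3) coord3 r a ^+ 2.

(* [Ck k f]: all iterated directional derivatives of [f] of order at most [k]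
   exist everywhere and are continuous. *)
Fixpoint Ck (V : normedModType R) (k : nat) (f : V -> R) : Prop :=
  match k with
  | 0 => continuous f
  | k'.+1 => continuous f /\
      forall v : V, (forall x, derivable f x v) /\ Ck k' ('D_v f)
  end.

Definition test_function (V : normedModType R) (f : V -> R) : Prop :=
  (forall k, Ck k f) /\
  exists2 K : set V, compact K & forall x, ~ K x -> f x = 0.

End Euclidean.

Section ComplexIntegral.
Context d (T : measurableType d) (R : realType).
Variable mu : {measure set T -> \bar R}.

Definition sqr_modulus (z : R[i]) : R := complex.Re z ^+ 2 + complex.Im z ^+ 2.

Definition cint (A : set T) (f : T -> R[i]) : R[i] :=
  (\int[mu]_(x in A) complex.Re (f x)) +i*
  (\int[mu]_(x in A) complex.Im (f x)).

Definition cintegrable (A : set T) (f : T -> R[i]) : Prop :=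
  mu.-integrable A (fun x => (complex.Re (f x))%:E) /\
  mu.-integrable A (fun x => (complex.Im (f x))%:E).

Definition memL2 (A : set T) (f : T -> R[i]) : Prop :=
  [/\ measurable_fun A (fun x => complex.Re (f x)),
      measurable_fun A (fun x => complex.Im (f x)) &
      (\int[mu]_(x in A) (sqr_modulus (f x))%:E < +oo)%E].

End ComplexIntegral.

Section WeakDerivatives.
Variable R : realType.
Local Notation R3 := (R3 R).
Local Notation R6 := (R6 R).
Local Notation mu3 := (mu3 R).
Local Notation mu6 := (mu6 R).

Definition L1loc3 (f : R3 -> R) : Prop :=
  forall K : set R3, compact K -> mu3.-integrable K (EFin \o f).

Definition L1loc6 (F : R6 -> R[i]) : Prop :=
  forall K : set R6, compact K -> cintegrable mu6 K F.

Definition is_wpartial (a : 'I_3) (f g : R3 -> R) : Prop :=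
  [/\ L1loc3 f, L1loc3 g &
      forall phi : R3 -> R, test_function phi ->
        \int[mu3]_r (f r * 'D_(unit_vec R a) phi r) =
        - \int[mu3]_r (g r * phi r)].

Definition has_wpartial (a : 'I_3) (f : R3 -> R) : Prop :=
  exists g, is_wpartial a f g.

(* A representative of the weak derivative of [f], determined up to a null set
   when [has_wpartial a f] and meaningless otherwise. *)
Definition wpartial (a : 'I_3) (f : R3 -> R) : R3 -> R :=
  get [set g | is_wpartial a f g].

Definition memL2real (f : R3 -> R) : Prop :=
  measurable_fun [set: R3] f /\
  mu3.-integrable [set: R3] (fun r : R3 => (f r ^+ 2)%:E).

Definition memH1 (f : R3 -> R) : Prop :=
  memL2real f /\
  forall a : 'I_3, exists2 g, is_wpartial a f g & memL2real g.

(* [g] is the [a]-th component of the weak gradient of [G(u, r)] in its second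
   argument, as a distribution on R^3 x R^3. Real test functions suffice by
   linearity. *)
Definition is_wpartial2 (a : 'I_3) (G g : R6 -> R[i]) : Prop :=
  [/\ L1loc6 G, L1loc6 g &
      forall phi : R6 -> R, test_function phi ->
        cint mu6 [set: R6] (fun p : R6 =>
          G p * ('D_((0 : R3), unit_vec R a) phi p)%:C) =
        - cint mu6 [set: R6] (fun p : R6 => g p * (phi p)%:C)].

(* [M] is the weak derivative nabla_1 . nabla_2 D; the two integrations by
   parts leave no sign. *)
Definition is_wgrad1_dot_grad2 (D M : R6 -> R[i]) : Prop :=
  [/\ L1loc6 D, L1loc6 M &
      forall phi : R6 -> R, test_function phi ->
        cint mu6 [set: R6] (fun p : R6 => D p *
          (\sum_(a < 3) 'D_(unit_vec R a, (0 : R3))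
                          ('D_((0 : R3), unit_vec R a) phi) p)%:C) =
        cint mu6 [set: R6] (fun p : R6 => M p * (phi p)%:C)].

End WeakDerivatives.

Section KernelOperators.
Variable R : realType.
Local Notation R3 := (R3 R).
Local Notation R6 := (R6 R).
Local Notation mu3 := (mu3 R).
Local Notation mu6 := (mu6 R).

(* Operators on L^2(K) given by square-integrable kernels on K x K. *)
Variable K : set R3.

Definition inner (f g : R3 -> R[i]) : R[i] :=
  cint mu3 K (fun r : R3 => (f r)^*%C * g r).

Definition kapply (B : R6 -> R[i]) (f : R3 -> R[i]) : R3 -> R[i] :=
  fun r => cint mu3 K (fun s : R3 => B (r, s) * f s).

Definition kprod (B C : R6 -> R[i]) : R6 -> R[i] :=
  fun p => cint mu3 K (fun z : R3 => B (p.1, z) * C (z, p.2)).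

Definition kadj (B : R6 -> R[i]) : R6 -> R[i] := fun p => (B (p.2, p.1))^*%C.

Definition kform (B : R6 -> R[i]) (f : R3 -> R[i]) : R[i] :=
  cint mu6 (K `*` K) (fun p : R6 => (f p.1)^*%C * B p * f p.2).

(* The order of R[i] makes [0 <= z] say that [z] is real and nonnegative. *)
Definition kpositive (B : R6 -> R[i]) : Prop :=
  forall f : R3 -> R[i], memL2 mu3 K f -> 0 <= kform B f.

(* [A] is the kernel of |B|, the positive square root of B^dagger B. *)
Definition is_kabs (B A : R6 -> R[i]) : Prop :=
  [/\ memL2 mu6 (K `*` K) A, kpositive A &
      {ae mu6, forall p : R6, (K `*` K) p -> kprod A A p = kprod (kadj B) B p}].

Definition orthonormal_basis (e : nat -> R3 -> R[i]) : Prop :=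
  [/\ forall k, memL2 mu3 K (e k),
      forall k l, inner (e k) (e l) = (k == l)%:R &
      forall f : R3 -> R[i], memL2 mu3 K f ->
        (fun n => \int[mu3]_(r in K)
           sqr_modulus (f r - \sum_(k < n) inner (e k) f * e k r))
        @ \oo --> (0 : R)].

(* Tr |B| < oo. The trace of a positive operator does not depend on the basis,
   and L^2(K) is separable and infinite-dimensional, hence has a basis indexed
   by nat, unless K is a null set; then L^2(K) = 0 and every operator on it is
   trace class. *)
Definition trace_class (B : R6 -> R[i]) : Prop :=
  memL2 mu6 (K `*` K) B /\
  exists2 A, is_kabs B A &
    forall e, orthonormal_basis e ->
      (\sum_(0 <= k <oo)
         (complex.Re (inner (e k) (kapply A (e k))))%:E < +oo)%E.

Definition has_trace (B : R6 -> R[i]) (t : R[i]) : Prop :=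
  forall e, orthonormal_basis e ->
    (fun n => \sum_(k < n) complex.Re (inner (e k) (kapply B (e k))))
      @ \oo --> complex.Re t /\
    (fun n => \sum_(k < n) complex.Im (inner (e k) (kapply B (e k))))
      @ \oo --> complex.Im t.

End KernelOperators.

Section DensityMatrices.
Variable R : realType.
Local Notation R3 := (R3 R).
Local Notation R6 := (R6 R).
Local Notation mu3 := (mu3 R).
Local Notation mu6 := (mu6 R).

(* The set D_(N,1) of one-particle reduced density matrices. *)
Definition one_rdm (N : nat) (D : R6 -> R[i]) : Prop :=
  [/\ memL2 mu6 [set: R6] D,
      trace_class [set: R3] D,
      {ae mu6, forall p : R6, D (p.1, p.2) = (D (p.2, p.1))^*%C},
      forall f : R3 -> R[i], memL2 mu3 [set: R3] f ->
        0 <= kform [set: R3] D f <= 2 * (\int[mu3]_r sqr_modulus (f r))%:C &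
      has_trace [set: R3] D N%:R].

Definition factorization (D G : R6 -> R[i]) : Prop :=
  memL2 mu6 [set: R6] G /\
  {ae mu6, forall p : R6, D p = kprod [set: R3] (kadj G) G p}.

(* The diagonal of [G^dagger * G] agrees a.e. for all factorizations of [D], so
   the density may be read off any one of them; likewise for the current
   below. *)
Definition has_density (D : R6 -> R[i]) (rho : R3 -> R) : Prop :=
  exists2 G, factorization D G &
    {ae mu3, forall r : R3, (rho r)%:C = kprod [set: R3] (kadj G) G (r, r)}.

Definition locally_finite_kinetic_energy (D : R6 -> R[i]) : Prop :=
  exists2 M, is_wgrad1_dot_grad2 D M &
    forall K : set R3, compact K -> trace_class K M.

Definition has_current (D : R6 -> R[i]) (j : 'I_3 -> R3 -> R) : Prop :=
  locally_finite_kinetic_energy D /\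
  exists G, exists g : 'I_3 -> R6 -> R[i],
    [/\ factorization D G,
        forall a, is_wpartial2 a G (g a),
        forall a (K : set R3), compact K -> memL2 mu6 ([set: R3] `*` K) (g a) &
        forall a, {ae mu3, forall r : R3, j a r =
          complex.Re (cint mu3 [set: R3] (fun u : R3 =>
            - 'i%C * (g a (u, r))^*%C * G (u, r)))}].

(* [T] = (1/2) Tr (nabla_1 . nabla_2 D), the trace being finite. *)
Definition canonical_kinetic_energy (D : R6 -> R[i]) (T : R) : Prop :=
  exists M, exists t : R,
    [/\ is_wgrad1_dot_grad2 D M, trace_class [set: R3] M,
        has_trace [set: R3] M t%:C & T = t / 2].

Definition T_W (rho : R3 -> R) : R :=
  1 / 2 * \int[mu3]_r
    (\sum_(a < 3) wpartial a (fun s => Num.sqrt (rho s)) r ^+ 2).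

(* The convention 0^-1 = 0 makes the integrand vanish where rho does. *)
Definition T_p (rho : R3 -> R) (j : 'I_3 -> R3 -> R) : R :=
  1 / 2 * \int[mu3]_r ((rho r)^-1 * \sum_(a < 3) j a r ^+ 2).

End DensityMatrices.

(* Main.v *)
Require Import Defs.
From HB Require Import structures.
From mathcomp Require Import all_boot all_order all_algebra.
From mathcomp Require Import all_classical all_reals all_analysis.
From mathcomp Require Import measurable_realfun complex ring lra.

Set Implicit Arguments.
Unset Strict Implicit.
Unset Printing Implicit Defensive.

Import Order.TTheory GRing.Theory Num.Theory.
Import numFieldNormedType.Exports.

Local Open Scope classical_set_scope.
Local Open Scope ring_scope.

(* The constant lambda may depend on rho and kappa, so that it is enough to find D
   with finite kinetic energy. Take D = G^dagger * G with
     G(u, r) = sqrt(rho(r)) exp(-i L u1 r_b) h(u1 - 3 kappa_b(r) / (2 L)),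
   where h(t) is a multiple of 1 / (1 + t^2), the integral of h^2 is 1 / 3, and the
   variable u2 selects the direction b. Integrating over u gives the density rho.
   The phase contributes to the current in direction b the mean of L u1, which the
   translation of h makes equal to 3 kappa_b / 2 with weight rho / 3. As L grows,
   D(r, s) is an oscillatory integral bounded by sqrt(rho(r) rho(s)) and tending to
   0 wherever r_b <> s_b for all b; hence its Hilbert-Schmidt norm tends to 0, and
   D <= 2 for L large. The weak derivatives of G in r are found slice by slice, by
   the product and chain rules for functions absolutely continuous on lines. *)

(** * Measure-preserving maps and real integrals *)

(** For fixed u the function G(u, .) is an orbital, and D averages such orbitals. A phase in r_b
    carries current along the b-th axis only, and kappa need not be a gradient; so each axis gets
    its own family of plane waves, and the local mean momentum is steered by displacing the weights
    of the waves. The displacement is unbounded in r and changes with L, so the amplitude of the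
    oscillatory integrals moves with L as well. The Lorentzian profile is chosen for this:
    translating it by d costs at most the factor 1 + |d| + d^2 wherever it is centred, so that these
    integrals obey a bound in terms of the half period alone. It still decays fast enough for the
    phase gradient L u1 to be square integrable against it. The derivatives of kappa are only weak,
    so product and chain rules are proved on segments by comparing increments, and Fubini with
    translations leads from distributions to segments and back. The factor and its gradient are
    explicit and square integrable on every slice, so that the Gram kernels are defined, hermitian
    and subject to Cauchy-Schwarz at every point. *)

Section MeasurePreserving.
Context d1 d2 (T1 : measurableType d1) (T2 : measurableType d2) (R : realType).
Variables (m1 : {measure set T1 -> \bar R}) (m2 : {measure set T2 -> \bar R}).

Definition preserves (f : T1 -> T2) : Prop :=
  measurable_fun [set: T1] f /\
  forall A, measurable A -> m1 (f @^-1` A) = m2 A.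

Lemma ge0_integral_preserves f (F : T2 -> \bar R) : preserves f ->
  measurable_fun [set: T2] F -> (forall x, (0 <= F x)%E) ->
  (\int[m1]_x F (f x) = \int[m2]_x F x)%E.
Proof.
move=> [mf pf] mF F0.
have := @ge0_integral_pushforward _ _ _ _ _ _ mf m1 _ _ measurableT mF.
rewrite preimage_setT => <- //.
by apply: eq_measure_integral => A mA _; rewrite -pf.
Qed.

Lemma integral_preserves f (F : T2 -> \bar R) : preserves f ->
  measurable_fun [set: T2] F -> (\int[m1]_x F (f x) = \int[m2]_x F x)%E.
Proof.
move=> pf mF; rewrite integralE [RHS]integralE.
rewrite -(ge0_integral_preserves (F := F^\+%E) pf)//; last exact: measurable_funepos.
rewrite -(ge0_integral_preserves (F := F^\-%E) pf)//; last exact: measurable_funeneg.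
by congr (_ - _)%E; apply: eq_integral => x _; rewrite ?(funepos_comp F f) ?(funeneg_comp F f).
Qed.

Lemma Rintegral_preserves f (F : T2 -> R) : preserves f ->
  measurable_fun [set: T2] F -> \int[m1]_x F (f x) = \int[m2]_x F x.
Proof.
move=> pf mF; congr fine.
by apply: (integral_preserves (F := EFin \o F) pf); exact/measurable_EFinP.
Qed.

Lemma integrable_preserves f (F : T2 -> \bar R) : preserves f ->
  m2.-integrable [set: T2] F -> m1.-integrable [set: T1] (F \o f).
Proof.
move=> pf /integrableP[mF Foo]; apply/integrableP; split.
  by apply: measurableT_comp => //; case: pf.
rewrite (ge0_integral_preserves (F := abse \o F) pf)//.
  exact: measurableT_comp.
by move=> x /=.
Qed.

End MeasurePreserving.

(** The image of the product measure under the product map agrees with the product measure on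
    rectangles, and these determine it because both factors are sigma-finite. *)
Lemma preserves_prod d1 d2 (T1 : measurableType d1) (T2 : measurableType d2)
    (R : realType) (m1 : {sigma_finite_measure set T1 -> \bar R})
    (m2 : {sigma_finite_measure set T2 -> \bar R}) (f : T1 -> T1) (g : T2 -> T2) :
  preserves m1 m1 f -> preserves m2 m2 g ->
  preserves (m1 \x m2)%E (m1 \x m2)%E (fun p => (f p.1, g p.2)).
Proof.
move=> [mf pf] [mg pg].
have mfg : measurable_fun [set: T1 * T2] (fun p => (f p.1, g p.2)).
  by apply/measurable_fun_pairP; split;
    [exact: (measurableT_comp mf)|exact: (measurableT_comp mg)].
split=> // A mA.
apply/esym; pose mm := pushforward (m1 \x m2)%E (fun p => (f p.1, g p.2)).
have mmE : forall B C, measurable B -> measurable C ->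
    mm (B `*` C) = (m1 B * m2 C)%E; last first.
  exact: (@product_measure_unique _ _ _ _ _ m1 m2
    (measure_function_pushforward__canonical__measure_function_Measure (m1 \x m2)%E mfg) mmE).
move=> B C mB mC; rewrite /mm.
rewrite /= /pushforward.
rewrite (_ : _ @^-1` _ = (f @^-1` B) `*` (g @^-1` C)); last first.
  by apply/seteqP; split=> -[x y].
rewrite product_measure1E ?pf ?pg//.
  by rewrite -[X in measurable X]setTI; exact: mf.
by rewrite -[X in measurable X]setTI; exact: mg.
Qed.

Section Shift.
Variable R : realType.
Local Notation leb := (@lebesgue_measure R).

(** Lebesgue measure is determined by its values on half-open intervals, so only lengths have to be
    compared. *)
Lemma preserves_lebesgue_add (c : R) :
  preserves leb leb (fun x : measurableTypeR R => x + c : measurableTypeR R).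
Proof.
have mf : measurable_fun [set: measurableTypeR R] (fun x : measurableTypeR R => x + c : measurableTypeR R).
  by apply: (@measurable_funD _ (measurableTypeR R) R setT).
split=> // A mA.
apply/esym; pose mm := @pushforward _ _ _ (measurableTypeR R) _ leb (fun x : measurableTypeR R => x + c : measurableTypeR R).
have mmE : forall X, ocitv X -> leb X = mm X; last first.
  exact: (@lebesgue_measure_unique R (measure_function_pushforward__canonical__measure_function_Measure leb mf) mmE A mA).
move=> X [[a b] /= ab <-]; rewrite /mm /pushforward.
rewrite (_ : _ @^-1` _ = `]a - c, b - c]%classic); last first.
  by apply/seteqP; split => x /=; rewrite !in_itv /= ltrBlDr lerBrDr.
by rewrite !lebesgue_measure_itv /= !lte_fin ltrD2r -!EFinB opprD addrACA opprK addNr addr0.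
Qed.

Lemma preserves_lebesgue_opp :
  preserves leb leb (fun x : measurableTypeR R => - x : measurableTypeR R).
Proof.
have mf : measurable_fun [set: measurableTypeR R] (fun x : measurableTypeR R => - x : measurableTypeR R).
  exact: oppr_measurable.
split=> // A mA.
apply/esym; pose mm := @pushforward _ _ _ (measurableTypeR R) _ leb (fun x : measurableTypeR R => - x : measurableTypeR R).
have mmE : forall X, ocitv X -> leb X = mm X; last first.
  exact: (@lebesgue_measure_unique R (measure_function_pushforward__canonical__measure_function_Measure leb mf) mmE A mA).
move=> X [[a b] /= ab <-]; rewrite /mm /pushforward.
(* Reflection exchanges the open and the closed end; the length stays the same. *)
rewrite (_ : _ @^-1` _ = `[- b, - a[%classic); last first.
  by apply/seteqP; split => x /=; rewrite !in_itv /= ltrNr lerNl andbC.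
by rewrite !lebesgue_measure_itv /= !lte_fin ltrN2 -!EFinB opprK addrC.
Qed.

Lemma preserves_mu3_add (v : R3 R) : preserves (mu3 R) (mu3 R) (fun x => x + v).
Proof.
have h2 : preserves (mu2 R) (mu2 R)
    (fun p : measurableTypeR R * measurableTypeR R =>
       (p.1 + v.1.1 : measurableTypeR R, p.2 + v.1.2 : measurableTypeR R)).
  exact: (preserves_prod (preserves_lebesgue_add v.1.1) (preserves_lebesgue_add v.1.2)).
have := preserves_prod h2 (preserves_lebesgue_add v.2).
exact.
Qed.

End Shift.

Section RealIntegrable.
Context d (T : measurableType d) (R : realType) (mu : {measure set T -> \bar R}).
Variables (B : set T) (mB : measurable B).
Implicit Types f g : T -> R.
Local Notation int := (fun f => mu.-integrable B (EFin \o f)).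

Lemma rintD f g : int f -> int g -> int (fun x => f x + g x).
Proof. by move=> If Ig; have := integrableD mB If Ig. Qed.

Lemma rintN f : int f -> int (fun x => - f x).
Proof. by move=> If; have := integrableN If. Qed.

Lemma rintB f g : int f -> int g -> int (fun x => f x - g x).
Proof. by move=> If Ig; apply: rintD => //; exact: rintN. Qed.

Lemma rintZl (c : R) f : int f -> int (fun x => c * f x).
Proof. by move=> If; have := integrableZl mB c If. Qed.

Lemma rintZr (c : R) f : int f -> int (fun x => f x * c).
Proof. by move=> /(rintZl c); rewrite (_ : (fun x => c * f x) = (fun x => f x * c)) //; apply/funext => x; rewrite mulrC. Qed.

Lemma rint0 : int (fun=> 0).
Proof. exact: integrable0. Qed.

Lemma rint_measurable f : int f -> measurable_fun B f.
Proof. by case/integrableP => /measurable_EFinP. Qed.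

Lemma rint_sum (I : Type) (s : seq I) (P : pred I) (f : I -> T -> R) :
  (forall i, P i -> int (f i)) -> int (fun x => \sum_(i <- s | P i) f i x).
Proof.
move=> If; elim: s => [|i s IH].
  by rewrite (_ : (fun x => _) = (fun=> 0)); [exact: rint0|apply/funext => x; rewrite big_nil].
rewrite (_ : (fun x => _) = (fun x => (if P i then f i x else 0) + \sum_(j <- s | P j) f j x)); last first.
  by apply/funext => x; rewrite big_cons; case: ifP => // _; rewrite add0r.
have Ii : mu.-integrable B (EFin \o (fun x => if P i then f i x else 0)).
  by case: (boolP (P i)) => Pi; [exact: If|exact: rint0].
exact: rintD.
Qed.

Lemma Rintegral_sum (I : Type) (s : seq I) (P : pred I) (f : I -> T -> R) :
  (forall i, P i -> int (f i)) ->
  \int[mu]_(x in B) (\sum_(i <- s | P i) f i x) =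
  \sum_(i <- s | P i) \int[mu]_(x in B) f i x.
Proof.
move=> If; elim: s => [|i s IH].
  by rewrite big_nil; under eq_Rintegral do rewrite big_nil; rewrite Rintegral_cst// mul0r.
rewrite big_cons; under eq_Rintegral do rewrite big_cons.
by case: ifPn => // Pi; rewrite RintegralD ?IH//; [exact: If|exact: rint_sum].
Qed.

Lemma rint_le f g : measurable_fun B f -> (forall x, B x -> `|f x| <= `|g x|) ->
  int g -> int f.
Proof.
move=> mf fg Ig; apply: (le_integrable mB _ _ Ig).
  exact/measurable_EFinP.
by move=> x Bx; rewrite /= lee_fin fg.
Qed.

Lemma le_Rintegral_norm f h : int f -> int h -> (forall x, B x -> `|f x| <= h x) ->
  `|\int[mu]_(x in B) f x| <= \int[mu]_(x in B) h x.
Proof.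
move=> If Ih fh; apply: le_trans (le_normr_Rintegral _ If) _ => //.
by apply: le_Rintegral => //; exact: integrable_norm.
Qed.

Lemma integrable_bounded_mul g (h : T -> R) (K : R) : int g -> measurable_fun B h ->
  (forall x, B x -> `|h x| <= K) -> int (fun x => h x * g x).
Proof.
move=> Ig mh hK; apply: rint_le (rintZl K Ig).
  by apply: measurable_funM => //; exact: rint_measurable.
move=> x Bx; rewrite /= !normrM ler_wpM2r//.
by rewrite (le_trans (hK x Bx))// ler_norm.
Qed.

Lemma le_Rintegral_subset (A : set T) f : measurable A -> A `<=` B -> int f ->
  (forall x, B x -> 0 <= f x) ->
  \int[mu]_(x in A) f x <= \int[mu]_(x in B) f x.
Proof.
move=> mA AB If f0; have IA : mu.-integrable A (EFin \o f) by exact: integrableS If.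
apply: fine_le; [exact: integrable_fin_num..|].
by apply: ge0_subset_integral => //; case/integrableP: If.
Qed.

Lemma rint_indic f : int f <->
  mu.-integrable setT (EFin \o (fun x => \1_B x * f x)).
Proof.
rewrite (_ : EFin \o (fun x => _) = (EFin \o f) \_ B); first exact: integrable_mkcond.
by apply/funext => x; rewrite /= patchE indicE; case: ifP => _; rewrite ?mul1r ?mul0r.
Qed.

Lemma Rintegral_indic f : \int[mu]_(x in B) f x = \int[mu]_x (\1_B x * f x).
Proof.
rewrite Rintegral_mkcond; apply: eq_Rintegral => x _.
by rewrite patchE indicE; case: ifP => _; rewrite ?mul1r ?mul0r.
Qed.

(** [Rintegral] is the finite part of an extended integral. Without integrability the positive or
    the negative part has infinite integral, so the difference is infinite and [fine] returns 0. *)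
Lemma Rintegral_not_integrable f : measurable_fun B f -> ~ int f ->
  \int[mu]_(x in B) f x = 0.
Proof.
move=> mf nI; have mfE : measurable_fun B (EFin \o f) by exact/measurable_EFinP.
have [fin|/negP] := boolP ((\int[mu]_(x in B) (f x)%:E)%E \is a fin_num); last first.
  by rewrite /Rintegral; case: integral.
exfalso; apply: nI; apply/integrableP; split => //.
move: fin; rewrite integralE fin_numB => /andP[fp fn].
rewrite (_ : (fun x => _) = abse \o (EFin \o f))// fune_abse ge0_integralD//.
- by rewrite lte_add_pinfty// ltey_eq ?fp ?fn.
- exact: measurable_funepos.
- exact: measurable_funeneg.
Qed.

(** Both sides are 0 when [f] is not integrable, so constants can be pulled out on exceptional
    slices too. *)
Lemma RintegralZ_measurable (c : R) f : measurable_fun B f ->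
  \int[mu]_(x in B) (c * f x) = c * \int[mu]_(x in B) f x.
Proof.
move=> mf; have [If|nI] := pselect (int f); first exact: RintegralZl.
rewrite (Rintegral_not_integrable mf nI) mulr0.
have [->|c0] := eqVneq c 0.
  by under eq_Rintegral do rewrite mul0r; rewrite Rintegral_cst// mul0r.
apply: Rintegral_not_integrable; first exact: measurable_funM.
move=> /(rintZl c^-1); rewrite (_ : (fun x => _) = f)//.
by apply/funext => x; rewrite mulKf.
Qed.

End RealIntegrable.

(** * Absolutely continuous functions of one variable *)

Section OneDim.
Variable R : realType.
Local Notation leb := (@lebesgue_measure R).

(* Bisection along the values of [V] halves the quadratic bound at each step. *)
Lemma const_of_quadratic_increments (W V : R -> R) (M a b : R) :
  {within `[a, b], continuous V} -> 0 <= M ->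
  (forall s t, a <= s -> s <= t -> t <= b -> V s <= V t) ->
  (forall s t, a <= s -> s <= t -> t <= b ->
     `|W t - W s| <= M * (V t - V s) ^+ 2) ->
  forall t, a <= t <= b -> W t = W a.
Proof.
move=> cV M0 Vnd WV.
have H n : forall s t, a <= s -> s <= t -> t <= b ->
     `|W t - W s| <= M * (V t - V s) ^+ 2 / 2 ^+ n.
  elim: n => [|n IH] s t as_ st tb; first by rewrite expr0 divr1 WV.
  have cV' : {within `[s, t], continuous V}.
    by apply: continuous_subspaceW cV => x /=; rewrite !in_itv /= => /andP[? ?]; lra.
  have Vst := Vnd _ _ as_ st tb.
  have Vm : Num.min (V s) (V t) <= (V s + V t) / 2 <= Num.max (V s) (V t).
    by rewrite (min_idPl Vst) (max_idPr Vst); lra.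
  have [m] := IVT st cV' Vm.
  rewrite in_itv /= => /andP[sm mt] {}Vm.
  have := IH m t ltac:(lra) mt tb; have := IH s m as_ sm ltac:(lra).
  rewrite Vm => h1 h2.
  have -> : W t - W s = (W t - W m) + (W m - W s) by ring.
  apply: le_trans (ler_normD _ _) _; apply: le_trans (lerD h2 h1) _.
  have n0 : (2 : R) ^+ n != 0 by rewrite expf_neq0.
  rewrite [2 ^+ n.+1]exprS; move: (2 ^+ n) n0 {h1 h2} => q q0.
  by rewrite le_eqVlt; apply/orP; left; apply/eqP; field.
move=> t /andP[at_ tb]; apply/eqP; rewrite -subr_eq0 -normr_le0.
apply/ler_addgt0Pl => e e0; rewrite addr0.
have K0 : 0 <= M * (V t - V a) ^+ 2 by rewrite mulr_ge0// sqr_ge0.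
have [n nK] : exists n : nat, M * (V t - V a) ^+ 2 / e < n%:R.
  by exists (Num.bound (M * (V t - V a) ^+ 2 / e)); apply: archi_boundP; rewrite divr_ge0 ?(ltW e0).
apply: le_trans (H n _ _ (lexx a) at_ tb) _.
rewrite ler_pdivrMr ?exprn_gt0// [leRHS]mulrC -ler_pdivrMr// (le_trans (ltW nK))//.
by rewrite -natrX ler_nat ltnW// ltn_expl.
Qed.

(** The form in which absolutely continuous functions on [0, 1] with initial value [c] enter; [g] is
    the derivative almost everywhere, but pointwise differentiability is never invoked. *)
Definition primitive (c : R) (g : R -> R) (t : R) : R :=
  c + \int[leb]_(s in `[0, t]) g s.

Local Notation I01 := (`[0, 1]%classic : set R).

Lemma itvoc01 (s t : R) : 0 <= s -> t <= 1 ->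
  (`]s, t]%classic : set R) `<=` I01.
Proof.
by move=> s0 t1 x /=; rewrite !in_itv /= => /andP[? ?]; apply/andP; split; lra.
Qed.

Lemma integrable_itvoc01 (g : R -> R) (s t : R) : leb.-integrable I01 (EFin \o g) ->
  0 <= s -> t <= 1 -> leb.-integrable `]s, t] (EFin \o g).
Proof. by move=> ig s0 t1; apply: integrableS ig => //; exact: itvoc01. Qed.

Section Primitive.
Variable g : R -> R.
Hypothesis ig : leb.-integrable I01 (EFin \o g).
Variable c : R.
Local Notation A := (primitive c g).

Lemma primitive_increment (s t : R) : 0 <= s -> s <= t -> t <= 1 ->
  A t - A s = \int[leb]_(x in `]s, t]) g x.
Proof.
move=> s0 st t1; rewrite /primitive opprD addrACA subrr add0r.
apply: Rintegral_itvB; rewrite ?bnd_simp//.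
by apply: integrableS ig => //; apply: subset_itvl; rewrite bnd_simp.
Qed.

Lemma primitive0 : A 0 = c.
Proof. by rewrite /primitive set_itv1 Rintegral_set1 addr0. Qed.

Lemma primitive_continuous : {within I01, continuous A}.
Proof.
move=> x; apply: cvgD; first exact: cvg_cst.
exact: (parameterized_integral_continuous ler01 ig).
Qed.

Lemma primitive_measurable : measurable_fun I01 A.
Proof.
by apply: subspace_continuous_measurable_fun => //; exact: primitive_continuous.
Qed.

Lemma primitive_dist (s t x y : R) : 0 <= s -> s <= x -> x <= t -> s <= y -> y <= t ->
  t <= 1 -> `|A x - A y| <= \int[leb]_(z in `]s, t]) `|g z|.
Proof.
have key u v : 0 <= s -> s <= u -> u <= v -> v <= t -> t <= 1 ->
    `|A v - A u| <= \int[leb]_(z in `]s, t]) `|g z|.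
  move=> s0 su uv vt t1; rewrite primitive_increment//; [|lra..].
  apply: le_trans (le_normr_Rintegral _ _) _ => //.
    by apply: integrable_itvoc01 => //; lra.
  apply: le_Rintegral_subset => //.
    by move=> z /=; rewrite !in_itv /= => /andP[? ?]; apply/andP; split; lra.
  by apply: integrable_norm; apply: integrable_itvoc01.
move=> s0 sx xt sy yt t1; case: (leP x y) => xy; last by apply: key => //; lra.
by rewrite distrC; apply: key.
Qed.

Lemma primitive_bounded : exists2 K : R, 0 <= K &
  forall x : R, 0 <= x <= 1 -> `|A x| <= K.
Proof.
exists (`|c| + \int[leb]_(x in `]0, 1]) `|g x|).
  by rewrite addr_ge0// Rintegral_ge0.
move=> x /andP[x0 x1]; rewrite -[A x](subrK (A 0)) addrC {1}primitive0.
apply: le_trans (ler_normD _ _) _; rewrite lerD2l.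
by apply: primitive_dist.
Qed.

End Primitive.

(** The increments of [F] minus the primitive of [h] are at most quadratic in those of the
    continuous nondecreasing primitive of [v], so the difference is constant. Product and chain
    rules follow by exhibiting such a quadratic error. *)
Lemma primitive_of_increments (F h v : R -> R) (M : R) : 0 <= M ->
  leb.-integrable I01 (EFin \o h) -> leb.-integrable I01 (EFin \o v) ->
  (forall x, 0 <= v x) ->
  (forall s t, 0 <= s -> s <= t -> t <= 1 ->
     `|F t - F s - \int[leb]_(x in `]s, t]) h x|
       <= M * (\int[leb]_(x in `]s, t]) v x) ^+ 2) ->
  forall t, 0 <= t <= 1 -> F t = primitive (F 0) h t.
Proof.
move=> M0 ih iv v0 FM t t01.
suff : F t - primitive (F 0) h t = F 0 - primitive (F 0) h 0.
  by rewrite primitive0 subrr => /eqP; rewrite subr_eq0 => /eqP.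
apply: (@const_of_quadratic_increments (fun x => F x - primitive (F 0) h x)
  (primitive 0 v) M 0 1) => //.
- exact: primitive_continuous.
- move=> s u s0 su u1; rewrite -subr_ge0 (primitive_increment iv)//.
  exact: Rintegral_ge0.
move=> s u s0 su u1; rewrite (primitive_increment iv)//.
have -> : F u - primitive (F 0) h u - (F s - primitive (F 0) h s) =
    F u - F s - (primitive (F 0) h u - primitive (F 0) h s) by ring.
by rewrite (primitive_increment ih)//; exact: FM.
Qed.

Lemma primitive_mul (g1 g2 : R -> R) (c1 c2 : R) :
  leb.-integrable I01 (EFin \o g1) -> leb.-integrable I01 (EFin \o g2) ->
  let g x := g1 x * primitive c2 g2 x + primitive c1 g1 x * g2 x in
  leb.-integrable I01 (EFin \o g) /\
  forall t, 0 <= t <= 1 ->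
    primitive c1 g1 t * primitive c2 g2 t = primitive (c1 * c2) g t.
Proof.
move=> i1 i2 g; set A1 := primitive c1 g1; set A2 := primitive c2 g2.
have [K1 K10 A1K] := primitive_bounded i1 c1.
have [K2 K20 A2K] := primitive_bounded i2 c2.
have i1A : leb.-integrable I01 (EFin \o (fun x => g1 x * A2 x)).
  under [fun x => g1 x * _]eq_fun do rewrite mulrC.
  apply: (@integrable_bounded_mul _ _ _ leb I01 _ g1 A2 K2) => //; exact: primitive_measurable.
have i2A : leb.-integrable I01 (EFin \o (fun x => A1 x * g2 x)).
  apply: (@integrable_bounded_mul _ _ _ leb I01 _ g2 A1 K1) => //; exact: primitive_measurable.
have ig : leb.-integrable I01 (EFin \o g).
  exact: rintD.
split => // t t01.
pose v x := `|g1 x| + `|g2 x|.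
have iv : leb.-integrable I01 (EFin \o v).
  by apply: rintD => //; exact: integrable_norm.
have -> : c1 * c2 = A1 0 * A2 0 by rewrite /A1 /A2 !primitive0.
apply: (@primitive_of_increments (fun x => A1 x * A2 x) g v 1) => // [x|s u s0 su u1].
  by rewrite addr_ge0.
have io f : leb.-integrable I01 (EFin \o f) -> leb.-integrable `]s, u] (EFin \o f).
  by move=> If; exact: integrable_itvoc01.
have msu : measurable (`]s, u]%classic : set R) by [].
have -> : A1 u * A2 u - A1 s * A2 s = (A1 u - A1 s) * A2 s + A1 u * (A2 u - A2 s) by ring.
rewrite !(primitive_increment _ _ s0 su u1)//.
rewrite -RintegralZr ?io// -RintegralZl ?io// -RintegralD//; [|exact: rintZr (io _ i1)|exact: rintZl (io _ i2)].
pose V := \int[leb]_(x in `]s, u]) v x.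
have V1 (f : R -> R) : leb.-integrable I01 (EFin \o f) -> (forall x, `|f x| <= v x) ->
   \int[leb]_(x in `]s, u]) `|f x| <= V.
  move=> If fv; apply: le_Rintegral => //.
  - by apply: integrable_norm; exact: io.
  - exact: io.
have V0 : 0 <= V by apply: Rintegral_ge0 => *; rewrite /v addr_ge0.
have isum : leb.-integrable `]s, u] (EFin \o (fun x => g1 x * A2 s + A1 u * g2 x)).
  by apply: rintD => //; [exact: rintZr (io _ i1)|exact: rintZl (io _ i2)].
rewrite -RintegralB//; last exact: io.
rewrite mul1r expr2 -/V -RintegralZl//; last exact: io.
apply: le_Rintegral_norm => //.
- by apply: rintB => //; exact: io.
- by apply: rintZl => //; exact: io.
move=> x /=; rewrite in_itv /= => /andP[sx xu].
(* The discrepancy between the increment of the product and the candidate derivative: each term is a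
   density times an oscillation over [s, u] of size at most [V], which gives the square of [V] after
   integration. *)
rewrite (_ : _ - _ = g1 x * (A2 s - A2 x) + (A1 u - A1 x) * g2 x); last first.
  by rewrite /g /A1 /A2; ring.
apply: le_trans (ler_normD _ _) _; rewrite !normrM /v mulrDr lerD//.
  rewrite mulrC ler_wpM2r//.
  apply: le_trans (primitive_dist (s := s) (t := u) i2 c2 _ _ _ _ _ _) _ => //; [lra..|].
  by apply: V1 => // y; rewrite /v lerDr.
rewrite ler_wpM2r//.
apply: le_trans (primitive_dist (s := s) (t := u) i1 c1 _ _ _ _ _ _) _ => //; [lra..|].
by apply: V1 => // y; rewrite /v lerDl.
Qed.

Lemma norm_between (a b y z V : R) : a <= z <= b -> `|a - y| <= V -> `|b - y| <= V ->
  `|z - y| <= V.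
Proof. by rewrite !ler_norml => /andP[? ?] /andP[? ?] /andP[? ?]; lra. Qed.

Lemma primitive_chain (g Phi dPhi : R -> R) (c M : R) :
  leb.-integrable I01 (EFin \o g) ->
  (forall x : R, is_derive x 1 Phi (dPhi x)) ->
  0 <= M -> (forall x y, `|dPhi x - dPhi y| <= M * `|x - y|) ->
  let h x := dPhi (primitive c g x) * g x in
  leb.-integrable I01 (EFin \o h) /\
  forall t, 0 <= t <= 1 -> Phi (primitive c g t) = primitive (Phi c) h t.
Proof.
move=> ig dP M0 lip h; set A := primitive c g.
have [K K0 AK] := primitive_bounded ig c.
have cd : continuous dPhi.
  move=> x; apply/cvgrPdist_le => e e0.
  near=> y; apply: le_trans (lip _ _) _.
  apply: (@le_trans _ _ ((M + 1) * `|x - y|)); first by rewrite ler_wpM2r// lerDl.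
  rewrite mulrC -ler_pdivlMr; last by lra.
  by near: y; apply: cvgr_dist_le => //; rewrite divr_gt0//; lra.
have ih : leb.-integrable I01 (EFin \o h).
  apply: (@integrable_bounded_mul _ _ _ leb I01 _ g (dPhi \o A) (`|dPhi 0| + M * K)) => //.
    apply: measurableT_comp; last exact: primitive_measurable.
    exact: continuous_measurable_fun.
  move=> x /=; rewrite in_itv => x01; rewrite -[dPhi _](subrK (dPhi 0)) addrC.
  apply: le_trans (ler_normD _ _) _; rewrite lerD2l.
  by apply: le_trans (lip _ _) _; rewrite subr0 ler_wpM2l// AK.
split => // t t01.
have -> : Phi c = Phi (A 0) by rewrite /A primitive0.
apply: (@primitive_of_increments (fun x => Phi (A x)) h (fun x => `|g x|) M) => //.
  exact: integrable_norm.
move=> s u s0 su u1.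
have io f : leb.-integrable I01 (EFin \o f) -> leb.-integrable `]s, u] (EFin \o f).
  by move=> If; exact: integrable_itvoc01.
set V := \int[leb]_(x in `]s, u]) `|g x|.
have V0 : 0 <= V by exact: Rintegral_ge0.
have AV x y : s <= x -> x <= u -> s <= y -> y <= u -> `|A x - A y| <= V.
  by move=> *; apply: primitive_dist.
(* From the mean value theorem: [xi] lies between the end values, so it is within [V] of every value
   of [A] on [s, u]. As [dPhi] is Lipschitz, the derivative is off by at most M V and the increment
   by at most M V^2. *)
have [xi [xi1 xi2]] : exists xi, Phi (A u) - Phi (A s) = dPhi xi * (A u - A s) /\
    forall x, s <= x <= u -> `|xi - A x| <= V.
  have Pc a b : {within `[a, b], continuous Phi}.
    apply: continuous_subspaceT => x; apply: differentiable_continuous.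
    by apply/derivable1_diffP; have [] := dP x.
  case: (leP (A s) (A u)) => Asu.
    have [xi xi1 ->] := MVT_segment Asu (fun x _ => dP x) (Pc _ _).
    exists xi; split => // x /andP[sx xu].
    have := AV s x (lexx s) su sx xu; have := AV u x su (lexx u) sx xu.
    by rewrite in_itv /= in xi1 => ux sx'; exact: norm_between xi1 sx' ux.
  have [xi xi1 E] := MVT_segment (ltW Asu) (fun x _ => dP x) (Pc _ _).
  exists xi; split; first by rewrite -opprB E; ring.
  move=> x /andP[sx xu].
  have := AV s x (lexx s) su sx xu; have := AV u x su (lexx u) sx xu.
  by rewrite in_itv /= in xi1 => ux sx'; exact: norm_between xi1 ux sx'.
rewrite xi1 (primitive_increment ig)// -RintegralZl//; last exact: io.
rewrite -RintegralB//; [|exact: rintZl (io _ ig)|exact: io].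
rewrite expr2 mulrA -RintegralZl//; last by apply: integrable_norm; exact: io.
apply: le_Rintegral_norm => //; [by apply: rintB; [|exact: rintZl (io _ ig)|exact: io]|by apply: rintZl => //; apply: integrable_norm; exact: io|].
move=> x /=; rewrite in_itv /= => /andP[sx xu].
rewrite /h -mulrBl normrM ler_wpM2r//; apply: le_trans (lip _ _) _.
by rewrite ler_wpM2l// xi2// (ltW sx).
Unshelve. all: by end_near.
Qed.

End OneDim.

(** * Test functions and the fundamental lemma of the calculus of variations *)

Section PiLambda.
Context d1 d2 (X : measurableType d1) (T : measurableType d2) (R : realType).
Variables (mu : {measure set X -> \bar R}) (f : X -> \bar R) (p : X -> T).
Hypothesis If : mu.-integrable [set: X] f.
Hypothesis mp : measurable_fun [set: X] p.

(** The sets whose preimage carries integral 0 form a lambda-system, [f] being integrable, so a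
    generating pi-system suffices. Working with preimages under [p] lets one coordinate be treated
    at a time. *)
Lemma integral_preimage0_sigma_algebra (G : set (set T)) :
  @measurable _ T = <<s G >> -> setI_closed G ->
  (\int[mu]_x f x = 0)%E ->
  (forall C, G C -> (\int[mu]_(x in p @^-1` C) f x = 0)%E) ->
  forall C, measurable C -> (\int[mu]_(x in p @^-1` C) f x = 0)%E.
Proof.
move=> TG GI f0 fG.
have mpre C : measurable C -> measurable (p @^-1` C).
  by move=> mC; rewrite -[X in measurable X]setTI; exact: mp.
have IfS A : measurable A -> mu.-integrable A f.
  by move=> mA; exact: integrableS If.
pose H := [set C : set T | measurable C /\ (\int[mu]_(x in p @^-1` C) f x = 0)%E].
have HSD : setSD_closed H.
  move=> A B BA [mA A0] [mB B0]; split; first exact: measurableD.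
  have mD : measurable (A `\` B) by exact: measurableD.
  have : (\int[mu]_(x in p @^-1` B `|` p @^-1` (A `\` B)) f x = 0)%E.
    by rewrite -preimage_setU setDUK.
  rewrite integral_setU ?B0 ?add0e//; [exact: mpre|exact: mpre| |].
    by rewrite -preimage_setU setDUK//; case: (IfS _ (mpre _ mA)) => /integrableP[].
  by apply/disj_setPS => x /= [? []].
have LH : lambda_system [set: T] H.
  split => //.
  move=> F ndF HF; split; first by apply: bigcupT_measurable => n; case: (HF n).
  have FS n : F n `<=` F n.+1 by apply/subsetPset; exact: ndF.
  (* An increasing union becomes a disjoint union of successive differences, to which countable
     additivity applies. *)
  rewrite -eq_bigcup_seqD preimage_bigcup integral_bigcup.
  - apply: eseries0 => -[|n] _ _; first by case: (HF 0%N).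
    by case: (HSD _ _ (FS n) (HF n.+1) (HF n)).
  - move=> i j _ _ [x /= [Fi Fj]].
    by apply: (trivIset_seqD ndF) => //; exists (p x).
  - case=> [|n]; first by apply: mpre; case: (HF 0%N).
    by apply: mpre; case: (HSD _ _ (FS n) (HF n.+1) (HF n)).
  - by apply: IfS; rewrite -preimage_bigcup eq_bigcup_seqD; apply: mpre; apply: bigcupT_measurable => n; case: (HF n).
suff : @measurable _ T `<=` H by move=> sub C /sub[].
have GH : G `<=` H.
  by move=> C GC; split; [rewrite TG; exact: sub_gen_smallest|exact: fG].
by rewrite TG; exact: (@lambda_system_subset _ G GI setT H LH GH).
Qed.

End PiLambda.

(** * Smooth functions vanishing on a half-line *)

Section FlatFunction.
Variable R : realType.

(** The classical function exp(-1/x), glued to 0, times negative powers of x: the linear span of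
    this family is closed under differentiation. *)
Definition flat (n : nat) (x : R) : R :=
  if 0 < x then x^-1 ^+ n * expR (- x^-1) else 0.

(** From exp(y) = exp(y / n)^n and exp(z) >= z. *)
Lemma expR_ge_power (n : nat) (y : R) : 0 <= y -> y ^+ n <= n%:R ^+ n * expR y.
Proof.
move=> y0; case: n => [|n]; first by rewrite !expr0 mul1r -expR0 ler_expR.
have n0 : (0 : R) < n.+1%:R by [].
have -> : expR y = expR (y / n.+1%:R) ^+ n.+1 by rewrite -expRM_natl; congr expR; field.
rewrite -exprMn lerXn2r ?nnegrE ?mulr_ge0 ?expR_ge0//.
rewrite -ler_pdivrMl// mulrC (le_trans _ (expR_ge1Dx _))//.
by rewrite lerDr.
Qed.

(** Comparison of exp(1/x) with the power n + 2 of 1/x. The quadratic decay makes the difference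
    quotient at 0 tend to 0. *)
Lemma flat_bound (n : nat) (x : R) : `|flat n x| <= n.+2%:R ^+ n.+2 * x ^+ 2.
Proof.
rewrite /flat; case: ifPn => [x0|_]; last by rewrite normr0 mulr_ge0 ?sqr_ge0 ?exprn_ge0.
have y0 : 0 <= x^-1 by rewrite invr_ge0 ltW.
rewrite ger0_norm ?mulr_ge0 ?exprn_ge0 ?expR_ge0//.
have := expR_ge_power n.+2 y0.
move=> h; have e0 := expR_gt0 x^-1.
rewrite expRN -(ler_pM2r e0) mulfVK ?gt_eqF// mulrAC.
rewrite -(ler_pM2r (_ : 0 < (x ^+ 2)^-1)) ?invr_gt0 ?exprn_gt0// mulfK ?gt_eqF ?exprn_gt0//.
by apply: le_trans h; rewrite -exprVn -exprD addn2.
Qed.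

Lemma is_derive_flat (n : nat) (x : R) :
  is_derive x 1 (flat n) (flat n.+2 x - n%:R * flat n.+1 x).
Proof.
case: (ltgtP 0 x) => [x0|x0|x0].
- have E : \forall y \near x, y^-1 ^+ n * expR (- y^-1) = flat n y.
    by near=> y; rewrite /flat ifT//; near: y; exact: lt_nbhsr.
  apply: (near_eq_is_derive (f:=fun y : R => y^-1 ^+ n * expR (- y^-1))) => //.
  have xN0 : x != 0 by rewrite gt_eqF.
  have dV : is_derive x 1 (fun y : R => y^-1) (- x ^- 2 *: 1).
    exact: (is_deriveV (f := id)).
  have dN : is_derive x^-1 1 (fun y : R => expR (- y)) (expR (- x^-1) * -1).
    by apply: (is_derive1_comp (f := expR) (g := -%R)).
  have dM : is_derive x^-1 1 (fun y : R => y ^+ n * expR (- y))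
      (x^-1 ^+ n *: (expR (- x^-1) * -1) + expR (- x^-1) *: ((n%:R * x^-1 ^+ n.-1) *: 1)).
    by apply: (is_deriveM (f := fun y : R => y ^+ n)); rewrite -exprfctE; exact: is_deriveX.
  apply: (is_derive_eq (is_derive1_comp dM dV)).
  rewrite /GRing.scale /= /flat x0 !mulr1 !mulrN1 -exprVn.
  move: (expR _) => e; move: (x^-1) => y.
  by case: n {dM E} => [|n] /=; rewrite !exprS ?expr0; ring.
- have E : \forall y \near x, 0 = flat n y.
    by near=> y; rewrite /flat ifF//; apply: le_gtF; near: y; apply: filterS (lt_nbhsl x0) => y /ltW.
  apply: (near_eq_is_derive (f:=fun y : R => 0 : R)) => //.
  by rewrite /flat (le_gtF (ltW x0)) mulr0 subrr; exact: is_derive_cst.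
- rewrite -x0 /flat ltxx mulr0 subrr.
  have cv : h^-1 *: (flat n (h *: 1 + 0) - flat n 0) @[h --> (0 : R)^'] --> (0 : R).
    apply/cvgrPdist_le => e e0; near=> h.
    rewrite sub0r normrN /GRing.scale /= mulr1 addr0 {2}/flat ltxx subr0 normrM.
    have h0 : h != 0 by near: h; exact: nbhs_dnbhs_neq.
    rewrite normfV ler_pdivrMl ?normr_gt0//; apply: le_trans (flat_bound _ _) _.
    have C0 : (0 : R) < n.+2%:R ^+ n.+2 by rewrite exprn_gt0.
    rewrite -real_normK ?num_real// expr2 mulrCA ler_wpM2l// mulrC -ler_pdivlMr//.
    near: h; apply: nbhs_dnbhs.
    have := @cvg_id _ (nbhs (0 : R)); move/cvgrPdist_le => /(_ (e / n.+2%:R ^+ n.+2)).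
    by rewrite divr_gt0// => /(_ isT); apply: filterS => h; rewrite sub0r normrN.
  split; first exact: cvgP cv.
  by apply/cvg_lim => //.
Unshelve. all: by end_near.
Qed.

End FlatFunction.

(** * Calculus of iterated directional derivatives *)

Section CkCalculus.
Variables (R : realType).
Implicit Types V W : normedModType R.

Lemma CkS V k (f : V -> R) : Ck k.+1 f -> Ck k f.
Proof.
elim: k f => [|k IH] f; first by case.
by move=> [cf df]; split=> // v; have [dfv ckf] := df v; split=> //; exact: IH.
Qed.

Lemma Ck_continuous V k (f : V -> R) : Ck k f -> continuous f.
Proof. by case: k => [//|k] []. Qed.

Lemma CkD V k (f g : V -> R) : Ck k f -> Ck k g -> Ck k (fun x => f x + g x).
Proof.
elim: k f g => [|k IH] f g; first by move=> cf cg x; apply: cvgD; [exact: cf|exact: cg].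
move=> [cf df] [cg dg]; split; first by move=> x; apply: cvgD; [exact: cf|exact: cg].
move=> v; have [dfv ckf] := df v; have [dgv ckg] := dg v; split.
  by move=> x; exact: derivableD.
rewrite (_ : 'D_v _ = fun x => 'D_v f x + 'D_v g x); first exact: IH.
by apply/funext => x; rewrite deriveD.
Qed.

Lemma Ck_cst V k (c : R) : Ck k (fun _ : V => c).
Proof.
elim: k c => [|k IH] c /=; first exact: cst_continuous.
split=> [|v]; first exact: cst_continuous.
split=> [x|]; first exact: derivable_cst.
rewrite (_ : 'D_v _ = fun _ => 0)//.
by apply/funext => x; rewrite derive_cst.
Qed.

Lemma CkM V k (f g : V -> R) : Ck k f -> Ck k g -> Ck k (fun x => f x * g x).
Proof.
elim: k f g => [|k IH] f g; first by move=> cf cg x; apply: cvgM; [exact: cf|exact: cg].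
move=> hf hg; have [cf df] := hf; have [cg dg] := hg.
split; first by move=> x; apply: cvgM; [exact: cf|exact: cg].
move=> v; have [dfv ckf] := df v; have [dgv ckg] := dg v; split.
  by move=> x; exact: derivableM.
rewrite (_ : 'D_v _ = fun x => f x * 'D_v g x + g x * 'D_v f x).
  by apply: CkD; apply: IH => //; exact: CkS.
by apply/funext => x; rewrite deriveM.
Qed.

Section Affine.
Variables (U V : normedModType R) (T L : U -> V).
Hypothesis cT : continuous T.
Hypothesis TL : forall (h : R) (v x : U), T (h *: v + x) = h *: L v + T x.

(** [T] is affine with linear part [L], so the difference quotients of [f \o T] along [v] and of [f]
    along [L v] are the same functions of h. *)
Lemma derive_affine (f : V -> R) v x :
  'D_v (f \o T) x = 'D_(L v) f (T x) /\
  (derivable (f \o T) x v <-> derivable f (T x) (L v)).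
Proof.
rewrite /derive /derivable.
rewrite (_ : (fun h => _) = (fun h => h^-1 *: ((f \o shift (T x)) (h *: L v) - f (T x)))) //.
by apply/funext => h; rewrite /= TL.
Qed.

Lemma Ck_affine k (f : V -> R) : Ck k f -> Ck k (f \o T).
Proof.
have cc (g : V -> R) : continuous g -> continuous (g \o T).
  by move=> cg x; apply: continuous_comp; [exact: cT|exact: cg].
elim: k f => [|k IH] f; first exact: cc.
move=> [cf df]; split; first exact: cc.
move=> v; have [dfv ckf] := df (L v); split.
  by move=> x; apply/(derive_affine f v x).2.
rewrite (_ : 'D_v _ = 'D_(L v) f \o T); first exact: IH.
by apply/funext => x; rewrite (derive_affine f v x).1.
Qed.

End Affine.

Lemma derive_scale_direction (f : R -> R) (x v d : R) :
  is_derive x 1 f d -> derivable f x v /\ 'D_v f x = v * d.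
Proof.
move=> [dfx dE].
have diff : differentiable f x by apply/derivable1_diffP.
split; first exact: diff_derivable.
rewrite deriveE// -[v in 'd f x v]mulr1 -[v * 1]/(v *: 1) linearZ /=.
by rewrite -dE deriveE.
Qed.

(** The induction on [k] runs over all [n] at once, because the derivative of [flat n] involves
    [flat n.+1] and [flat n.+2]. *)
Lemma Ck_flat k n : Ck k (@flat R n).
Proof.
have cf m : continuous (@flat R m).
  move=> x; apply: differentiable_continuous; apply/derivable1_diffP.
  by have [] := is_derive_flat m x.
elim: k n => [|k IH] n; first exact: cf.
split=> [|v]; first exact: cf.
split=> [x|]; first by have [] := derive_scale_direction v (is_derive_flat n x).
rewrite (_ : 'D_v _ = fun x => v * (flat n.+2 x + - n%:R * flat n.+1 x)).
  by apply: CkM; [exact: Ck_cst|apply: CkD => //; apply: CkM => //; exact: Ck_cst].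
by apply/funext => x; rewrite (derive_scale_direction v (is_derive_flat n x)).2 mulNr.
Qed.

End CkCalculus.

(** * Bump functions on boxes and distributions that vanish *)

Section Bump.
Variable R : realType.
Local Notation R3 := (R3 R).
Local Notation mu3 := (mu3 R).

Lemma flat0_ge0 (y : R) : 0 <= flat 0 y.
Proof. by rewrite /flat; case: ifP => // _; rewrite mul1r expR_ge0. Qed.

Lemma flat0_le1 (y : R) : flat 0 y <= 1.
Proof.
rewrite /flat; case: ifP => // y0; rewrite mul1r -[leRHS]expR0 ler_expR.
by rewrite oppr_le0 invr_ge0 ltW.
Qed.

Lemma flat0_dist1 (y : R) : 0 < y -> `|1 - flat 0 y| <= y^-1.
Proof.
move=> y0; rewrite ger0_norm ?subr_ge0 ?flat0_le1// /flat y0 mul1r lerBlDr addrC -lerBlDr.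
by have := expR_ge1Dx (- y^-1); lra.
Qed.

Lemma near_ge_succ (c : R) : \forall n \near \oo, c <= n.+1%:R.
Proof.
exists (Num.bound `|c|) => // n /= cn; apply: le_trans (ler_norm c) _.
by rewrite ltW// (lt_le_trans (archi_boundP (normr_ge0 c)))// ler_nat (leq_trans cn).
Qed.

(** Approximates the indicator of ]a, b]. The first factor vanishes for x <= a. In the second, the
    summand [n.+1%:R] keeps the argument large up to and including x = b, while for x > b the
    argument is nonpositive as soon as 1 / (n + 1) <= x - b; this also puts the support inside
    [a, b + 1]. *)
Definition bump (n : nat) (a b x : R) : R :=
  flat 0 (n.+1%:R * (x - a)) * flat 0 (n.+1%:R ^+ 2 * (b - x) + n.+1%:R).

Lemma bump_ge0 n a b x : 0 <= bump n a b x.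
Proof. by rewrite mulr_ge0 ?flat0_ge0. Qed.

Lemma bump_le1 n a b x : bump n a b x <= 1.
Proof. by rewrite mulr_ile1 ?flat0_ge0 ?flat0_le1. Qed.

Lemma bump_support n a b x : ~ (`[a, b + 1]%classic x) -> bump n a b x = 0.
Proof.
move=> xab; rewrite /bump /flat; case: ifP => [|_]; last by rewrite mul0r.
rewrite pmulr_rgt0// subr_gt0 => ax; case: ifP => [|_]; last by rewrite mulr0.
rewrite expr2 -mulrA -[X in _ + X]mulr1 -mulrDr pmulr_rgt0// => h; exfalso; apply: xab.
rewrite /= in_itv /= (ltW ax)/=.
have n1 : (1 : R) <= n.+1%:R by rewrite ler1n.
rewrite leNgt; apply/negP => xb; nra.
Qed.

Lemma bump_cvg a b x : bump n a b x @[n --> \oo] --> (\1_(`]a, b]%classic : set R) x : R).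
Proof.
have h1 (u : nat -> R) (c : R) : 0 < c -> (forall n, c * n.+1%:R <= u n) ->
    flat 0 (u n) @[n --> \oo] --> (1 : R).
  move=> c0 cu; apply/cvgrPdist_le => e e0.
  near=> n; have un : 0 < u n by rewrite (lt_le_trans _ (cu n))// mulr_gt0.
  apply: le_trans (flat0_dist1 un) _.
  rewrite -[leRHS]invrK lef_pV2 ?posrE ?invr_gt0//; apply: le_trans (cu n).
  rewrite mulrC -ler_pdivrMr//; near: n; exact: near_ge_succ.
have h0 (u : nat -> R) : (\forall n \near \oo, u n <= 0) ->
    flat 0 (u n) @[n --> \oo] --> (0 : R).
  move=> u0; apply: cvg_near_cst; apply: filterS u0 => n u0.
  by rewrite /flat ltNge u0.
rewrite indicE mem_setE in_itv /=; case: (boolP (a < x <= b)).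
  move=> /andP[ax xb]; rewrite -[X in _ --> X]mulr1; apply: cvgM.
    by apply: (h1 _ (x - a)) => [|n]; rewrite ?subr_gt0// mulrC.
  by apply: (h1 _ 1) => // n; rewrite mul1r lerDr mulr_ge0 ?sqr_ge0// subr_ge0.
rewrite negb_and -leNgt -ltNge => /orP[xa|bx].
  apply: cvg_near_cst; near=> n; rewrite /bump [flat 0 (_ * _)]/flat ifF ?mul0r//.
  by apply/negbTE; rewrite -leNgt pmulr_rle0// subr_le0.
have x0 : 0 < (x - b) by rewrite subr_gt0.
apply: cvg_near_cst; near=> n; rewrite /bump [flat 0 (_ + _)]/flat ifF ?mulr0//.
apply/negbTE; rewrite -leNgt expr2 -mulrA -[X in _ + X]mulr1 -mulrDr pmulr_rle0//.
have : (x - b)^-1 <= n.+1%:R by near: n; exact: near_ge_succ.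
by rewrite -[_^-1]mul1r ler_pdivrMr//; lra.
Unshelve. all: by end_near.
Qed.

Definition box (a b : R3) : set R3 :=
  [set r | [/\ a.1.1 < r.1.1 <= b.1.1, a.1.2 < r.1.2 <= b.1.2 & a.2 < r.2 <= b.2]].

Definition cbox (a b : R3) : set R3 :=
  (`[a.1.1, b.1.1]%classic `*` `[a.1.2, b.1.2]%classic) `*` `[a.2, b.2]%classic.

Definition bump3 (n : nat) (a b : R3) (r : R3) : R :=
  bump n a.1.1 b.1.1 r.1.1 * bump n a.1.2 b.1.2 r.1.2 * bump n a.2 b.2 r.2.

Lemma compact_cbox (a b : R3) : compact (cbox a b).
Proof.
by apply: compact_setX; [apply: compact_setX|]; exact: segment_compact.
Qed.

Lemma measurable_cbox (a b : R3) : measurable (cbox a b).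
Proof.
by apply: measurableX; [apply: measurableX|]; exact: measurable_itv.
Qed.

Lemma bump3_support n (a b x : R3) : ~ cbox a (b + ((1, 1), 1)) x -> bump3 n a b x = 0.
Proof.
move=> xK; rewrite /bump3.
have [x1|x1] := pselect (`[a.1.1, b.1.1 + 1]%classic x.1.1); last first.
  by rewrite (bump_support n x1) !mul0r.
have [x2|x2] := pselect (`[a.1.2, b.1.2 + 1]%classic x.1.2); last first.
  by rewrite (bump_support n x2) mulr0 mul0r.
have [x3|x3] := pselect (`[a.2, b.2 + 1]%classic x.2); last first.
  by rewrite (bump_support n x3) mulr0.
by exfalso; apply: xK.
Qed.

Lemma test_function_bump3 n (a b : R3) : test_function (bump3 n a b).
Proof.
split.
  have smooth (c d : R) (p : R3 -> R) : continuous p ->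
     (forall (h : R) (v x : R3), p (h *: v + x) = h *: p v + p x) ->
     forall k, Ck k (fun r : R3 => flat 0 (c * p r + d)).
    move=> cp lp k; apply: (@Ck_affine R R3 R (fun r : R3 => c * p r + d) (fun r : R3 => c * p r)).
    - by move=> x; apply: cvgD; [apply: cvgM; [exact: cvg_cst|exact: cp]|exact: cvg_cst].
    - by move=> h v x; rewrite lp /GRing.scale /=; ring.
    - exact: Ck_flat.
  have smooth1 (p : R3 -> R) (c d : R) : continuous p ->
     (forall (h : R) (v x : R3), p (h *: v + x) = h *: p v + p x) ->
     forall k, Ck k (fun r : R3 => bump n c d (p r)).
    move=> cp lp k; apply: CkM.
      rewrite (_ : (fun r => _) = fun r => flat 0 (n.+1%:R * p r + - (n.+1%:R * c))).
        exact: smooth.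
      by apply/funext => r; congr flat; ring.
    rewrite (_ : (fun r => _) = fun r => flat 0 (- n.+1%:R ^+ 2 * p r + (n.+1%:R ^+ 2 * d + n.+1%:R))).
      exact: smooth.
    by apply/funext => r; congr flat; ring.
  move=> k; apply: CkM; [apply: CkM|].
  - apply: (smooth1 (fun r : R3 => r.1.1)) => //.
    by move=> x; apply: (@continuous_comp _ _ _ fst fst); exact: cvg_fst.
  - apply: (smooth1 (fun r : R3 => r.1.2)) => //.
    by move=> x; apply: (@continuous_comp _ _ _ fst snd); [exact: cvg_fst|exact: cvg_snd].
  - apply: (smooth1 (fun r : R3 => r.2)) => //.
    by move=> x; exact: cvg_snd.
exists (cbox a (b + ((1, 1), 1))); first exact: compact_cbox.
exact: bump3_support.
Qed.

Lemma bump3_ge0 n a b r : 0 <= bump3 n a b r.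
Proof. by apply: mulr_ge0; [apply: mulr_ge0|]; exact: bump_ge0. Qed.

Lemma bump3_le1 n a b r : bump3 n a b r <= 1.
Proof.
apply: mulr_ile1; [by apply: mulr_ge0; exact: bump_ge0|exact: bump_ge0| |exact: bump_le1].
by apply: mulr_ile1; [exact: bump_ge0|exact: bump_ge0|exact: bump_le1|exact: bump_le1].
Qed.

Lemma measurable_box (a b : R3) : measurable (box a b).
Proof.
rewrite (_ : box a b = (`]a.1.1, b.1.1]%classic `*` `]a.1.2, b.1.2]%classic) `*` `]a.2, b.2]%classic).
  by apply: measurableX; [apply: measurableX|]; exact: measurable_itv.
apply/seteqP; split=> r /=; rewrite !in_itv /=; last by move=> [[? ?] ?]; split.
by move=> [? ? ?]; split; [split|].
Qed.

Lemma box_sub_cbox (a b : R3) : box a b `<=` cbox a b.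
Proof.
move=> r [/andP[? ?] /andP[? ?] /andP[? ?]]; split; [split|]; rewrite /= in_itv /=;
  by apply/andP; split => //; exact: ltW.
Qed.

Lemma continuous_bump n a b : continuous (bump n a b : R -> R).
Proof.
move=> x; apply: cvgM.
  apply: (@continuous_comp _ _ _ (fun x : R => n.+1%:R * (x - a)) (flat 0)).
    by apply: cvgM; [exact: cvg_cst|apply: cvgB; [exact: cvg_id|exact: cvg_cst]].
  exact: (Ck_continuous (Ck_flat R 0 0)).
apply: (@continuous_comp _ _ _ (fun x : R => n.+1%:R ^+ 2 * (b - x) + n.+1%:R) (flat 0)).
  apply: cvgD; last exact: cvg_cst.
  by apply: cvgM; [exact: cvg_cst|apply: cvgB; [exact: cvg_cst|exact: cvg_id]].
exact: (Ck_continuous (Ck_flat R 0 0)).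
Qed.

Lemma measurable_bump3 n (a b : R3) : measurable_fun [set: R3] (bump3 n a b).
Proof.
have m c d : measurable_fun [set: R] (bump n c d).
  by apply: continuous_measurable_fun; exact: continuous_bump.
apply: measurable_funM; [apply: measurable_funM|].
- apply: (measurableT_comp (m _ _) (_ : measurable_fun setT (fun r : R3 => r.1.1))).
  exact: measurableT_comp.
- apply: (measurableT_comp (m _ _) (_ : measurable_fun setT (fun r : R3 => r.1.2))).
  exact: measurableT_comp.
- exact: (measurableT_comp (m _ _)).
Qed.

Lemma bump3_cvg (a b r : R3) :
  bump3 n a b r @[n --> \oo] --> (\1_(box a b) r : R).
Proof.
rewrite (_ : \1_(box a b) r = \1_(`]a.1.1, b.1.1]%classic : set R) r.1.1 *
  \1_(`]a.1.2, b.1.2]%classic : set R) r.1.2 * \1_(`]a.2, b.2]%classic : set R) r.2).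
  by apply: cvgM; [apply: cvgM|]; exact: bump_cvg.
rewrite !indicE !mem_setE /= -!natrM !mulnb; congr (_%:R); congr nat_of_bool.
apply/idP/idP; rewrite !in_itv /= ?inE.
  by move=> [-> -> ->].
by move=> /andP[/andP[? ?] ?]; split.
Qed.

(** The functions [bump3 n a b] tend to the indicator of the half-open box and vanish off one
    compact set, on which |H| is an integrable majorant. *)
Lemma integral_box0 (H : R3 -> R) (a b : R3) : L1loc3 H ->
  (forall phi : R3 -> R, test_function phi -> \int[mu3]_r (H r * phi r) = 0) ->
  (\int[mu3]_(r in box a b) (H r)%:E = 0)%E.
Proof.
move=> HL H0; pose K := cbox a (b + ((1, 1), 1)).
have mK : measurable K by exact: measurable_cbox.
have IH : mu3.-integrable K (EFin \o H) by apply: HL; exact: compact_cbox.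
have mH : measurable_fun K H by exact: rint_measurable IH.
have bK : box a b `<=` K.
  move=> r [/andP[? ?] /andP[? ?] /andP[? ?]]; split; [split|]; rewrite /= in_itv /=;
    by apply/andP; split => //; [exact: ltW|by rewrite ler_wpDr].
have bumpK n r : ~ K r -> bump3 n a b r = 0 by exact: bump3_support.
have f0 n : (\int[mu3]_(r in K) (H r * bump3 n a b r)%:E = 0)%E.
  have In : mu3.-integrable K (EFin \o (fun r => H r * bump3 n a b r)).
    apply: rint_le IH => //.
      by apply: measurable_funM => //; apply: measurable_funS (measurable_bump3 n a b).
    by move=> r _; rewrite normrM ler_piMr// ger0_norm ?bump3_ge0 ?bump3_le1.
  have := H0 _ (test_function_bump3 n a b).
  rewrite (_ : \int[mu3]_r _ = \int[mu3]_(r in K) (H r * bump3 n a b r)); last first.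
    rewrite [RHS]Rintegral_mkcond; congr fine; apply: eq_integral => r _.
    by rewrite patchE; case: ifPn => // /negP; rewrite inE => /bumpK ->; rewrite mulr0.
  (* [fine] also maps infinite values to 0; integrability excludes them. *)
  rewrite /Rintegral => /eqP; rewrite fine_eq0; first by move/eqP.
  exact: integrable_fin_num In.
have [] := @dominated_convergence _ _ _ mu3 K mK
  (fun n r => (H r * bump3 n a b r)%:E) (fun r => (H r * \1_(box a b) r)%:E)
  (fun r => `|H r|%:E).
- by move=> n; apply/measurable_EFinP; apply: measurable_funM => //; apply: measurable_funS (measurable_bump3 n a b).
- apply/measurable_EFinP; apply: measurable_funM => //.
  by apply: measurable_indic; exact: measurable_box.
- apply: aeW => r _; apply: cvg_EFin; first by near=> n.
  by apply: cvgM; [exact: cvg_cst|exact: bump3_cvg].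
- exact: integrable_norm.
- apply: aeW => r n _; rewrite lee_fin normrM ler_piMr// ger0_norm ?bump3_ge0 ?bump3_le1//.
move=> _ _; rewrite (_ : [sequence _]_n = fun=> 0%E); last by apply/funext => n; exact: f0.
move=> /(cvg_lim (@ereal_hausdorff R)); rewrite lim_cst => [E|]; last exact: ereal_hausdorff.
rewrite [RHS]E; rewrite (integral_mkcond (box a b)) [RHS](integral_mkcond K).
apply: eq_integral => r _; rewrite !patchE indicE.
case: (boolP (r \in box a b)) => rb.
  by rewrite ifT ?mulr1//; move: rb; rewrite !inE; exact: bK.
by case: ifP => //; rewrite mulr0.
Unshelve. all: by end_near.
Qed.

Local Notation Mr := (measurableTypeR R).

(* The integral of [H] over a product set vanishes first for half-open intervals,
   then one factor at a time for all measurable sets. *)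
Lemma integral0_ae_eq0_on_box (H : R3 -> R) (a b : R3) : L1loc3 H ->
  (forall c d : R3, (\int[mu3]_(r in box c d) (H r)%:E = 0)%E) ->
  ae_eq mu3 (box a b) (EFin \o H) (cst 0%E).
Proof.
move=> HL H0; set Q := box a b.
have mQ : measurable Q by exact: measurable_box.
have IQ : mu3.-integrable Q (EFin \o H).
  by apply: (integrableS (measurable_cbox a b) mQ (@box_sub_cbox a b)); apply: HL; exact: compact_cbox.
pose f := (EFin \o H) \_ Q.
have If : mu3.-integrable [set: R3] f by apply/(integrable_mkcond _ mQ).
pose P (I J K : set Mr) := (\int[mu3]_(r in (I `*` J) `*` K) f r = 0)%E.
pose G := [set I : set Mr | ocitv I \/ I = setT].
have Pm I J K : measurable I -> measurable J -> measurable K ->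
    measurable ((I `*` J) `*` K : set R3).
  by move=> mI mJ mK; apply: measurableX => //; exact: measurableX.
have mG I : G I -> measurable I.
  move=> [oI|->]; last exact: measurableT.
  by apply: sub_sigma_algebra.
have GI c d I : G I -> exists x : R * R, `]x.1, x.2]%classic = I `&` `]c, d]%classic.
  move=> [[x _ <-]|->]; last by exists (c, d); rewrite setTI.
  by have [||z _ zE] := @ocitvI R `]x.1, x.2]%classic `]c, d]%classic; [exists x|exists (c, d)|exists z].
have base I J K : G I -> G J -> G K -> P I J K.
  move=> GI_ GJ GK; rewrite /P /f -integral_mkcondr.
  have [x xE] := GI a.1.1 b.1.1 _ GI_.
  have [y yE] := GI a.1.2 b.1.2 _ GJ.
  have [z zE] := GI a.2 b.2 _ GK.
  rewrite (_ : _ `&` Q = box ((x.1, y.1), z.1) ((x.2, y.2), z.2)); first exact: H0.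
  apply/seteqP; split => r.
    move=> [[[/= Ir Jr] Kr] [Qx Qy Qz]]; split => /=.
    - have : (I `&` `]a.1.1, b.1.1]%classic) r.1.1 by split => //=; rewrite in_itv.
      by rewrite -xE /= in_itv.
    - have : (J `&` `]a.1.2, b.1.2]%classic) r.1.2 by split => //=; rewrite in_itv.
      by rewrite -yE /= in_itv.
    - have : (K `&` `]a.2, b.2]%classic) r.2 by split => //=; rewrite in_itv.
      by rewrite -zE /= in_itv.
  move=> [/= r1 r2 r3].
  have : (`]x.1, x.2]%classic : set R) r.1.1 by rewrite /= in_itv.
  rewrite xE => -[Ir]; rewrite /= in_itv /= => Qx.
  have : (`]y.1, y.2]%classic : set R) r.1.2 by rewrite /= in_itv.
  rewrite yE => -[Jr]; rewrite /= in_itv /= => Qy.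
  have : (`]z.1, z.2]%classic : set R) r.2 by rewrite /= in_itv.
  by rewrite zE => -[Kr]; rewrite /= in_itv /= => Qz.
(* Extends the coordinate [p] from a generating class to all measurable sets, while [D] constrains
   the others. *)
have ext d (T : measurableType d) (p : R3 -> T) (G' : set (set T)) (D : set R3) :
    measurable_fun setT p -> @measurable _ T = <<s G' >> -> setI_closed G' -> measurable D ->
    (\int[mu3]_(r in D) f r = 0)%E ->
    (forall C, G' C -> (\int[mu3]_(r in p @^-1` C `&` D) f r = 0)%E) ->
    forall C, measurable C -> (\int[mu3]_(r in p @^-1` C `&` D) f r = 0)%E.
  move=> mp TG' GI' mD fD fG' C mC; rewrite integral_mkcondr.
  apply: (@integral_preimage0_sigma_algebra _ _ _ _ _ mu3 (f \_ D) p _ mp G') => //.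
  - by apply/(integrable_mkcond _ mD); exact: integrableS If.
  - by rewrite -integral_mkcond.
  - by move=> C' GC'; rewrite -integral_mkcondr; exact: fG'.
have oE : @measurable _ Mr = <<s @ocitv R >> by [].
have st1 I J K : measurable I -> G J -> G K -> P I J K.
  move=> mI GJ GK.
  have E C : (C `*` J) `*` K = (fun r : R3 => r.1.1) @^-1` C `&` ((setT `*` J) `*` K).
    by apply/seteqP; split => r /=; tauto.
  rewrite /P E; apply: (ext _ _ _ _ _ _ oE (@ocitvI R)) => //.
  - exact: measurableT_comp.
  - by apply: Pm => //; exact: mG.
  - by apply: base => //; right.
  - by move=> C oC; rewrite -E; apply: base => //; left.
have st2 I J K : measurable I -> measurable J -> G K -> P I J K.
  move=> mI mJ GK.
  have E C : (I `*` C) `*` K = (fun r : R3 => r.1.2) @^-1` C `&` ((I `*` setT) `*` K).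
    by apply/seteqP; split => r /=; tauto.
  rewrite /P E; apply: (ext _ _ _ _ _ _ oE (@ocitvI R)) => //.
  - exact: measurableT_comp.
  - by apply: Pm => //; exact: mG.
  - by apply: st1 => //; right.
  - by move=> C oC; rewrite -E; apply: st1 => //; left.
have st3 I J K : measurable I -> measurable J -> measurable K -> P I J K.
  move=> mI mJ mK.
  have E C : (I `*` J) `*` C = (fun r : R3 => r.2) @^-1` C `&` ((I `*` J) `*` setT).
    by apply/seteqP; split => r /=; tauto.
  rewrite /P E; apply: (ext _ _ _ _ _ _ oE (@ocitvI R)) => //.
  - exact: measurable_snd.
  - exact: Pm.
  - by apply: st2 => //; right.
  - by move=> C oC; rewrite -E; apply: st2 => //; left.
have rectI d1 d2 (T1 : measurableType d1) (T2 : measurableType d2) :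
    setI_closed [set A `*` B | A in @measurable _ T1 & B in @measurable _ T2].
  move=> _ _ [A mA [B mB <-]] [A' mA' [B' mB' <-]]; rewrite -setXI.
  by exists (A `&` A'); [exact: measurableI|exists (B `&` B') => //; exact: measurableI].
have st4 (D : set (Mr * Mr)) (K : set Mr) : measurable D -> measurable K ->
    (\int[mu3]_(r in D `*` K) f r = 0)%E.
  move=> mD mK.
  have E (C : set (Mr * Mr)) : C `*` K = (fun r : R3 => r.1) @^-1` C `&` (setT `*` K).
    by apply/seteqP; split => r /=; tauto.
  rewrite E; apply: (ext _ _ _ _ _ _ (measurable_prod_measurableType Mr Mr) (@rectI _ _ Mr Mr)) => //.
  - exact: measurable_fst.
  - exact: measurableX.
  - by rewrite -setXTT; exact: st3.
  - by move=> C [A mA [B mB <-]]; rewrite -E; exact: st3.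
have st5 (A : set R3) : measurable A -> (\int[mu3]_(r in A) f r = 0)%E.
  move=> mA; rewrite -[A]setIT.
  apply: (ext _ _ id _ _ _ (measurable_prod_measurableType (Mr * Mr)%type Mr) (@rectI _ _ (Mr * Mr)%type Mr)) => //.
  - by rewrite -setXTT; exact: st4.
  - by move=> C [D mD [B mB <-]]; rewrite setIT; exact: st4.
apply: integral_ae_eq => // A AQ mA.
rewrite integral0; have := st5 A mA; rewrite /f -integral_mkcondr.
by rewrite (setIidl AQ).
Qed.

Lemma weak_zero_ae_eq0 (H : R3 -> R) : L1loc3 H ->
  (forall phi : R3 -> R, test_function phi -> \int[mu3]_r (H r * phi r) = 0) ->
  {ae mu3, forall r, H r = 0}.
Proof.
move=> HL H0.
have box0 c d : (\int[mu3]_(r in box c d) (H r)%:E = 0)%E by exact: integral_box0.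
pose B (n : nat) : set R3 := box ((- n%:R, - n%:R), - n%:R) ((n%:R, n%:R), n%:R).
have : \forall r \ae mu3, forall n, B n r -> (EFin \o H) r = 0%E.
  by apply/ae_foralln => n; exact: integral0_ae_eq0_on_box.
apply: filterS => r Hr.
pose M := `|r.1.1| + `|r.1.2| + `|r.2|.
have M1 : `|r.1.1| <= M by rewrite /M -addrA lerDl addr_ge0.
have M2 : `|r.1.2| <= M by rewrite /M addrAC lerDr addr_ge0.
have M3 : `|r.2| <= M by rewrite /M lerDr addr_ge0.
have Mn : M < (Num.bound M)%:R by apply: archi_boundP; rewrite /M !addr_ge0.
have : (EFin \o H) r = 0%E.
  apply: (Hr (Num.bound M)).
  have k (x : R) : `|x| <= M -> - (Num.bound M)%:R < x <= (Num.bound M)%:R.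
    by move=> /ler_normlP[? ?]; apply/andP; split; lra.
  by split; exact: k.
by case.
Qed.

End Bump.

(** * Almost-everywhere statements and Fubini theorems for real functions *)

Section AlmostEverywhere.
Context d (T : measurableType d) (R : realType) (mu : {measure set T -> \bar R}).
Implicit Types P Q : T -> Prop.

Lemma ae_imp P Q : (forall x, P x -> Q x) ->
  {ae mu, forall x, P x} -> {ae mu, forall x, Q x}.
Proof. by move=> PQ; apply: filterS. Qed.

Lemma ae_imp2 P1 P2 Q : (forall x, P1 x -> P2 x -> Q x) ->
  {ae mu, forall x, P1 x} -> {ae mu, forall x, P2 x} -> {ae mu, forall x, Q x}.
Proof. by move=> PQ; apply: filterS2. Qed.

Lemma ae_imp3 P1 P2 P3 Q : (forall x, P1 x -> P2 x -> P3 x -> Q x) ->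
  {ae mu, forall x, P1 x} -> {ae mu, forall x, P2 x} -> {ae mu, forall x, P3 x} ->
  {ae mu, forall x, Q x}.
Proof. by move=> PQ; apply: filterS3. Qed.

End AlmostEverywhere.

Section RealFubini.
Context d1 d2 (T1 : measurableType d1) (T2 : measurableType d2) (R : realType).
Variables (m1 : {sigma_finite_measure set T1 -> \bar R}).
Variables (m2 : {sigma_finite_measure set T2 -> \bar R}).
Implicit Types F : T1 * T2 -> R.
Local Notation int F := ((m1 \x m2)%E.-integrable setT (EFin \o F)).

(** Tonelli applies to the positive and to the negative part, and the difference of the two
    integrals is measurable whatever values it takes. *)
Lemma measurable_integral_param (F : T1 * T2 -> \bar R) : measurable_fun setT F ->
  measurable_fun setT (fun x => \int[m2]_y F (x, y))%E.
Proof.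
move=> mF.
rewrite (_ : (fun x => _) = (fun x => (\int[m2]_y F^\+ (x, y) - \int[m2]_y F^\- (x, y))%E)).
  apply: emeasurable_funB.
    by apply: (measurable_fun_fubini_tonelli_F F^\+%E) => //; exact: measurable_funepos.
  by apply: (measurable_fun_fubini_tonelli_F F^\-%E) => //; exact: measurable_funeneg.
apply/funext => x; rewrite integralE; congr (_ - _)%E; apply: eq_integral => y _.
  by rewrite (funepos_comp F (pair x)).
by rewrite (funeneg_comp F (pair x)).
Qed.

Lemma measurable_Rintegral_param F : measurable_fun setT F ->
  measurable_fun setT (fun x => \int[m2]_y F (x, y)).
Proof.
move=> mF; apply: (measurableT_comp (@fine_measurable R setT measurableT)).
by apply: (measurable_integral_param (F := EFin \o F)); exact/measurable_EFinP.
Qed.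

(** The finite part of the inner integral is known to agree with the extended inner integral where
    the slice is integrable, which is almost everywhere. *)
Lemma Rfubini1 F : int F ->
  \int[(m1 \x m2)%E]_p F p = \int[m1]_x \int[m2]_y F (x, y).
Proof.
move=> IF; rewrite /Rintegral -(integral12_prod_meas1 IF); congr fine.
apply: ae_eq_integral => //.
- by case/integrableP: (integrable_fubini_F IF).
- apply/measurable_EFinP; apply: measurable_Rintegral_param.
  exact: rint_measurable IF.
- have := ae_integrable1 IF; apply: filterS => x Ix _.
  by rewrite /= /fubini_F fineK//; exact: integrable_fin_num Ix.
Qed.

Lemma rint_fubini1 F : int F ->
  m1.-integrable setT (EFin \o (fun x => \int[m2]_y F (x, y))).
Proof.
move=> IF; have I1 := integrable_fubini_F IF.
have mF : measurable_fun setT F by exact: rint_measurable IF.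
apply/integrableP; split; first by apply/measurable_EFinP; exact: measurable_Rintegral_param.
have [m1F] := integrableP _ _ _ I1; apply: le_lt_trans.
apply: ge0_le_integral => //.
- by apply/measurable_EFinP; apply: measurableT_comp => //; exact: measurable_Rintegral_param.
- by apply: measurableT_comp.
by move=> x _ /=; rewrite /Rintegral /fubini_F; case: (integral _ _ _) => [r||] //=; rewrite ?normr0 ?leey.
Qed.

Lemma rint_ge0_tonelli F : measurable_fun setT F -> (forall p, 0 <= F p) ->
  (\int[m1]_x \int[m2]_y (F (x, y))%:E < +oo)%E -> int F.
Proof.
move=> mF F0 h; apply/integrable12ltyP; first exact/measurable_EFinP.
apply: le_lt_trans h; rewrite le_eqVlt; apply/orP; left; apply/eqP.
by apply: eq_integral => x _; apply: eq_integral => y _ /=; rewrite ger0_norm.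
Qed.

Lemma rint_tensor (a : T1 -> R) (b : T2 -> R) :
  m1.-integrable setT (EFin \o a) -> m2.-integrable setT (EFin \o b) ->
  int (fun p => a p.1 * b p.2).
Proof.
move=> Ia Ib.
have ma := rint_measurable Ia; have mb := rint_measurable Ib.
apply/integrable12ltyP.
  by apply/measurable_EFinP; apply: measurable_funM; exact: measurableT_comp.
have Ina := integrable_norm Ia; have Inb := integrable_norm Ib.
rewrite (_ : (\int[m1]_x _)%E = (\int[m1]_x (`|a x|%:E * \int[m2]_y `|b y|%:E))%E); last first.
  apply: eq_integral => x _; rewrite -integralZl//.
  by apply: eq_integral => y _ /=; rewrite normrM EFinM.
have bfin := integrable_fin_num measurableT Inb.
rewrite -(fineK bfin) integralZr//; apply: lte_mul_pinfty => //.
- by apply: integral_ge0 => x _; rewrite lee_fin.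
- exact: integrable_fin_num Ina.
- by rewrite ltry.
Qed.

(** By Tonelli the double integral of |F| is 0. This exchanges the quantifiers: null sets of x that
    depend on y become, for almost every x, a null set of y. *)
Lemma ae_slices0 F : measurable_fun setT F ->
  (forall y, {ae m1, forall x, F (x, y) = 0}) ->
  {ae m1, forall x, {ae m2, forall y, F (x, y) = 0}}.
Proof.
move=> mF F0.
have mFE : measurable_fun setT (EFin \o F) by exact/measurable_EFinP.
have mA : measurable_fun setT (abse \o (EFin \o F)) by exact: measurableT_comp.
have E0 : (\int[m1]_x \int[m2]_y `|(F (x, y))%:E| = 0)%E.
  rewrite (@fubini_tonelli _ _ _ _ _ m1 m2 (abse \o (EFin \o F)))//=.
  apply: integral0_eq => y _.
  have mFy : measurable_fun setT (fun x => (F (x, y))%:E).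
    by apply/measurable_EFinP; exact: measurable_fun_pair1.
  apply/(ae_eq_integral_abs m1 measurableT mFy).
  by apply: filterS (F0 y) => x /= -> .
have mI : measurable_fun setT (fun x => \int[m2]_y `|(F (x, y))%:E|)%E.
  by apply: (measurable_fun_fubini_tonelli_F (abse \o (EFin \o F))) => // p /=.
have /(ae_eq_integral_abs m1 measurableT mI) : (\int[m1]_x `| \int[m2]_y `|(F (x, y))%:E| |)%E = 0%E.
  by rewrite -[RHS]E0; apply: eq_integral => x _; rewrite gee0_abs// integral_ge0.
apply: filterS => x /(_ I) x0.
have mFx : measurable_fun setT (fun y => (F (x, y))%:E).
  by apply/measurable_EFinP; exact: measurable_fun_pair2.
have /(ae_eq_integral_abs m2 measurableT mFx) := x0.
by apply: filterS => y /(_ I) [].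
Qed.

End RealFubini.

Lemma Rfubini2 d1 d2 (T1 : measurableType d1) (T2 : measurableType d2) (R : realType)
  (m1 : {sigma_finite_measure set T1 -> \bar R})
  (m2 : {sigma_finite_measure set T2 -> \bar R}) (F : T1 * T2 -> R) :
  (m1 \x m2)%E.-integrable setT (EFin \o F) ->
  \int[(m1 \x m2)%E]_p F p = \int[m2]_y \int[m1]_x F (x, y).
Proof.
move=> IF; rewrite /Rintegral -(integral21_prod_meas1 IF); congr fine.
apply: ae_eq_integral => //.
- exact: measurable_fubini_G IF.
- apply/measurable_EFinP; apply: (@measurable_Rintegral_param _ _ _ _ _ m1 (F \o (fun p => (p.2, p.1)))).
  apply: measurableT_comp; first exact: rint_measurable IF.
  exact: measurable_swap.
- have := ae_integrable2 IF; apply: filterS => x Ix _.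
  by rewrite /= /fubini_G fineK//; exact: integrable_fin_num Ix.
Qed.

(** * Borel sets of R^3 and R^6 *)

Section BorelProducts.
Variable R : realType.

(** A countable measurable family refining the balls [B x e]: second countability in a form that
    passes to products. Through it, open sets of the product topology are seen to belong to the
    product sigma-algebra. *)
Definition measurable_base d (T : measurableType d) (B : T -> R -> set T) : Prop :=
  exists U : nat -> set T, (forall i, measurable (U i)) /\
    forall x (e : R), 0 < e -> exists2 i, U i x & U i `<=` B x e.

Lemma measurable_baseR :
  @measurable_base _ (measurableTypeR R) (fun x e => [set y : measurableTypeR R | `|(x : R) - y| < e]).
Proof.
exists (fun i => if unpickle i is Some (n, k) then
  (`[(k : int)%:~R / n.+1%:R, (k + 1)%:~R / n.+1%:R]%classic : set (measurableTypeR R)) else set0).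
split=> [i|x e e0]; first by case: (unpickle i) => [[n k]|]; [exact: measurable_itv|exact: measurable0].
pose n := Num.bound e^-1; pose k := Num.floor ((x : R) * n.+1%:R).
have n0 : (0 : R) < n.+1%:R by [].
have h1 : k%:~R <= (x : R) * n.+1%:R by exact: floor_le_tmp.
have h2 : (x : R) * n.+1%:R < (k + 1)%:~R by exact: floorD1_gt.
exists (pickle (n, k)); rewrite pickleK /=.
  by rewrite in_itv /= ler_pdivrMr// ler_pdivlMr// h1 ltW.
move=> y /=; rewrite in_itv /= ler_pdivrMr// ler_pdivlMr// => /andP[y1 y2].
have en : 1 < e * n.+1%:R.
  rewrite -ltr_pdivrMl// mulr1; apply: lt_trans (archi_boundP _) _.
    by rewrite invr_ge0 ltW.
  by rewrite ltr_nat.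
rewrite -(ltr_pM2r n0) -[X in `|_| * X]ger0_norm; last exact: ltW.
rewrite -normrM mulrBl; apply: le_lt_trans en.
by rewrite ler_norml; move: h1 h2 y1 y2; rewrite intrD; lra.
Qed.

Lemma measurable_base_prod d1 d2 (T1 : measurableType d1) (T2 : measurableType d2)
    (B1 : T1 -> R -> set T1) (B2 : T2 -> R -> set T2) :
  measurable_base B1 -> measurable_base B2 ->
  @measurable_base _ (T1 * T2)%type (fun x e => B1 x.1 e `*` B2 x.2 e).
Proof.
move=> [U [mU UB]] [V [mV VB]].
exists (fun i => if unpickle i is Some (n, k) then U n `*` V k else set0).
split=> [i|x e e0]; first by case: (unpickle i) => [[n k]|]; [exact: measurableX|exact: measurable0].
have [i Ui UiB] := UB x.1 e e0; have [j Vj VjB] := VB x.2 e e0.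
exists (pickle (i, j)); rewrite pickleK; first by split.
by move=> y [/UiB ? /VjB ?]; split.
Qed.

(** [A] is the union of those members of the countable family that it contains. *)
Lemma measurable_of_base d (T : measurableType d) (B : T -> R -> set T) (A : set T) :
  measurable_base B -> (forall x, A x -> exists2 e, 0 < e & B x e `<=` A) -> measurable A.
Proof.
move=> [U [mU UB]] oA.
rewrite (_ : A = \bigcup_i (if `[< U i `<=` A >] then U i else set0)).
  by apply: bigcupT_measurable => i; case: ifP => // _; exact: measurable0.
apply/seteqP; split => x; last by move=> [i _]; case: asboolP => // sub /sub.
move=> Ax; have [e e0 BA] := oA x Ax; have [i Ui UiB] := UB x e e0.
exists i => //; case: asboolP => // nsub; exfalso; apply: nsub.
exact: subset_trans UiB BA.
Qed.

Lemma measurable_base3 : @measurable_base _ (R3 R) (fun x e => ball x e).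
Proof.
exact: (measurable_base_prod (measurable_base_prod measurable_baseR measurable_baseR) measurable_baseR).
Qed.

Lemma measurable_base6 : @measurable_base _ (R6 R) (fun x e => ball x e).
Proof. exact: (measurable_base_prod measurable_base3 measurable_base3). Qed.

Lemma open_measurable3 (A : set (R3 R)) : open A -> measurable A.
Proof.
move=> oA; apply: measurable_of_base measurable_base3 _ => x Ax.
by have /nbhs_ballP[e /= e0 eA] := open_nbhs_nbhs (conj oA Ax); exists e.
Qed.

Lemma open_measurable6 (A : set (R6 R)) : open A -> measurable A.
Proof.
move=> oA; apply: measurable_of_base measurable_base6 _ => x Ax.
by have /nbhs_ballP[e /= e0 eA] := open_nbhs_nbhs (conj oA Ax); exists e.
Qed.

Lemma compact_measurable3 (K : set (R3 R)) : compact K -> measurable K.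
Proof.
move=> cK; rewrite -[K]setCK; apply: measurableC; apply: open_measurable3.
by apply: closed_openC; apply: compact_closed => //; exact: norm_hausdorff.
Qed.

Lemma compact_measurable6 (K : set (R6 R)) : compact K -> measurable K.
Proof.
move=> cK; rewrite -[K]setCK; apply: measurableC; apply: open_measurable6.
by apply: closed_openC; apply: compact_closed => //; exact: norm_hausdorff.
Qed.

Lemma continuous_measurable3 (f : R3 R -> R) : continuous f -> measurable_fun [set: R3 R] f.
Proof.
move=> cf; apply: (measurability _ (RGenOpens.measurableE R)) => _ [_ [a [b ->] <-]].
rewrite setTI; apply: open_measurable3; apply: open_comp => // x _; exact: cf.
Qed.

Lemma continuous_measurable6 (f : R6 R -> R) : continuous f -> measurable_fun [set: R6 R] f.
Proof.
move=> cf; apply: (measurability _ (RGenOpens.measurableE R)) => _ [_ [a [b ->] <-]].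
rewrite setTI; apply: open_measurable6; apply: open_comp => // x _; exact: cf.
Qed.

Lemma compact_sub_cbox (K : set (R3 R)) : compact K ->
  exists n : nat, K `<=` cbox ((- n%:R, - n%:R), - n%:R) ((n%:R, n%:R), n%:R).
Proof.
move=> cK; have [M [_ KM]] := compact_bounded cK.
exists (Num.bound (`|M| + 1)) => x Kx.
have h : `|x| <= `|M| + 1.
  by apply: KM => //; rewrite (le_lt_trans (ler_norm M))// ltrDl.
have n0 : `|M| + 1 < (Num.bound (`|M| + 1))%:R by apply: archi_boundP; rewrite addr_ge0.
move: h; rewrite !prod_normE !ge_max => /andP[/andP[h1 h2] h3].
have k (y : R) : `|y| <= `|M| + 1 -> y \in `[- (Num.bound (`|M| + 1))%:R, (Num.bound (`|M| + 1))%:R].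
  by rewrite in_itv /= ler_norml => /andP[? ?]; apply/andP; split; lra.
by split; [split|]; exact: k.
Qed.

Lemma compact_sub_cbox6 (K : set (R6 R)) : compact K ->
  exists n : nat, let B := cbox ((- n%:R, - n%:R), - n%:R) ((n%:R, n%:R), n%:R) in
    K `<=` B `*` B.
Proof.
move=> cK.
have c1 : compact (fst @` K) by apply: continuous_compact => //; apply: continuous_subspaceT => x; exact: cvg_fst.
have c2 : compact (snd @` K) by apply: continuous_compact => //; apply: continuous_subspaceT => x; exact: cvg_snd.
have [n1 K1] := compact_sub_cbox c1; have [n2 K2] := compact_sub_cbox c2.
exists (maxn n1 n2) => B x Kx.
have k m (y : R) : (m <= maxn n1 n2)%N -> `[- m%:R, m%:R]%classic y -> `[- (maxn n1 n2)%:R, (maxn n1 n2)%:R]%classic y.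
  by rewrite /= !in_itv /= -(ler_nat R) => mn /andP[? ?]; apply/andP; split; lra.
have [[a1 a2] a3] := K1 x.1 (imageP _ Kx); have [[b1 b2] b3] := K2 x.2 (imageP _ Kx).
by split; (split; [split|]); [apply: k a1|apply: k a2|apply: k a3|apply: k b1|apply: k b2|apply: k b3];
  rewrite ?leq_maxl ?leq_maxr.
Qed.

Lemma cbox_finite (a b : R3 R) : (mu3 R (cbox a b) < +oo)%E.
Proof.
have fin (c d : R) : (@lebesgue_measure R `[c, d]%classic < +oo)%E.
  by rewrite lebesgue_measure_itv /=; case: ifP => _; rewrite -?EFinB ltry.
have m (c d : R) : measurable (`[c, d]%classic : set (measurableTypeR R)) by exact: measurable_itv.
rewrite (_ : mu3 R _ = (mu2 R (`[a.1.1, b.1.1]%classic `*` `[a.1.2, b.1.2]%classic) *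
  @lebesgue_measure R `[a.2, b.2]%classic)%E).
  apply: lte_mul_pinfty => //.
  rewrite (_ : mu2 R _ = (@lebesgue_measure R `[a.1.1, b.1.1]%classic *
    @lebesgue_measure R `[a.1.2, b.1.2]%classic)%E).
    by rewrite fin_numM// ge0_fin_numE.
  exact: product_measure1E.
by apply: product_measure1E => //; exact: measurableX.
Qed.

End BorelProducts.

(** * Weak derivatives and absolute continuity on lines *)

Section LineCalculus.
Variable R : realType.
Local Notation R3 := (R3 R).
Local Notation mu3 := (mu3 R).
Local Notation leb := (@lebesgue_measure R).
Local Notation I01 := (`[0, 1]%classic : set R).

Definition line (e : R3) (f : R3 -> R) (x : R3) (s : R) : R := f (x + s *: e).

(* Absolute continuity on almost every segment in direction [e]. The exceptional
   null set may depend on [t]. *)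
Definition ac_lines (e : R3) (f g : R3 -> R) : Prop :=
  [/\ measurable_fun [set: R3] f, measurable_fun [set: R3] g,
      {ae mu3, forall x, leb.-integrable I01 (EFin \o line e g x)} &
      forall t : R, 0 <= t <= 1 ->
        {ae mu3, forall x, line e f x t = primitive (f x) (line e g x) t}].

Lemma measurable_line_map (e : R3) :
  measurable_fun [set: R3 * measurableTypeR R] (fun p : R3 * measurableTypeR R => p.1 + (p.2 : R) *: e).
Proof.
have m2 : measurable_fun [set: R3 * measurableTypeR R] (fun p : R3 * measurableTypeR R => (p.2 : R)).
  exact: measurable_snd.
have m11 : measurable_fun [set: R3 * measurableTypeR R] (fun p : R3 * measurableTypeR R => (p.1.1.1 : R)).
  by do 2![apply: (measurableT_comp measurable_fst)]; exact: measurable_fst.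
have m12 : measurable_fun [set: R3 * measurableTypeR R] (fun p : R3 * measurableTypeR R => (p.1.1.2 : R)).
  by apply: (measurableT_comp measurable_snd); apply: (measurableT_comp measurable_fst); exact: measurable_fst.
have m13 : measurable_fun [set: R3 * measurableTypeR R] (fun p : R3 * measurableTypeR R => (p.1.2 : R)).
  by apply: (measurableT_comp measurable_snd); exact: measurable_fst.
apply: measurable_fun_pair; [apply: measurable_fun_pair|].
- by apply: (measurable_funD m11); exact: measurable_funM.
- by apply: (measurable_funD m12); exact: measurable_funM.
- by apply: (measurable_funD m13); exact: measurable_funM.
Qed.

Lemma measurable_line (e : R3) (f : R3 -> R) : measurable_fun [set: R3] f ->
  measurable_fun [set: R3 * measurableTypeR R] (fun p : R3 * measurableTypeR R => line e f p.1 p.2).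
Proof. by move=> mf; exact: (measurableT_comp mf (measurable_line_map e)). Qed.

Lemma primitive_lineE (e : R3) (f g : R3 -> R) x (t : R) :
  primitive (f x) (line e g x) t =
  f x + \int[leb]_s (\1_(`[0, t]%classic : set R) s * line e g x s).
Proof.
rewrite /primitive Rintegral_mkcond; congr (_ + _); apply: eq_Rintegral => s _.
by rewrite patchE indicE; case: ifP => _; rewrite ?mul1r ?mul0r.
Qed.

(** The variable end point [p.2] is moved into an indicator, which turns the primitive into a
    parameter integral of a jointly measurable function. *)
Lemma measurable_primitive_line (e : R3) (f g : R3 -> R) :
  measurable_fun [set: R3] f -> measurable_fun [set: R3] g ->
  measurable_fun [set: R3 * measurableTypeR R]
    (fun p : R3 * measurableTypeR R => primitive (f p.1) (line e g p.1) p.2).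
Proof.
move=> mf mg.
under eq_fun do rewrite primitive_lineE.
apply: measurable_funD; first exact: (measurableT_comp mf measurable_fst).
pose F (q : (R3 * measurableTypeR R) * measurableTypeR R) : R :=
  \1_([set z : (R3 * measurableTypeR R) * measurableTypeR R | 0 <= z.2 /\ z.2 <= z.1.2]) q
  * line e g q.1.1 q.2.
have mF : measurable_fun setT F.
  apply: measurable_funM; last first.
    apply: (measurableT_comp (measurable_line e mg) (_ : measurable_fun setT
      (fun q : (R3 * measurableTypeR R) * measurableTypeR R => (q.1.1, q.2)))).
    by apply: measurable_fun_pair; [apply: (measurableT_comp measurable_fst); exact: measurable_fst|exact: measurable_snd].
  apply: measurable_indic.
  have ms : measurable_fun [set: (R3 * measurableTypeR R) * measurableTypeR R]
      (fun z : (R3 * measurableTypeR R) * measurableTypeR R => (z.2 : R)) by exact: measurable_snd.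
  have mt : measurable_fun [set: (R3 * measurableTypeR R) * measurableTypeR R]
      (fun z : (R3 * measurableTypeR R) * measurableTypeR R => (z.1.2 : R)).
    by apply: (measurableT_comp measurable_snd); exact: measurable_fst.
  rewrite (_ : [set z | _] = [set z | 0 <= (z.2 : R)] `&` [set z | (z.2 : R) <= z.1.2])//.
  apply: measurableI; rewrite -[X in measurable X]setTI.
    exact: (measurable_fun_ler (f := cst 0)).
  exact: measurable_fun_ler.
rewrite (_ : (fun x => _) = (fun p => \int[leb]_s F (p, s))).
  exact: measurable_Rintegral_param.
apply/funext => p; apply: eq_Rintegral => s _; rewrite /F /= !indicE; congr (_%:R * _); congr nat_of_bool.
by apply/idP/idP; rewrite !inE /= in_itv /= => /andP.
Qed.

(** The null set in [ac_lines] may depend on the parameter. Fubini yields one null set of lines off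
    which the identity holds at almost every parameter, and that is enough under a further
    integral. *)
Lemma ac_lines_ae (e : R3) (f g : R3 -> R) : ac_lines e f g ->
  {ae mu3, forall x, {ae leb, forall s : R, 0 <= s <= 1 ->
     line e f x s = primitive (f x) (line e g x) s}}.
Proof.
move=> [mf mg Ig fg].
pose F (p : R3 * measurableTypeR R) : R :=
  \1_I01 p.2 * (line e f p.1 p.2 - primitive (f p.1) (line e g p.1) p.2).
have mF : measurable_fun setT F.
  apply: measurable_funM.
    by apply: (measurableT_comp (_ : measurable_fun setT (\1_I01 : measurableTypeR R -> R)) measurable_snd).
  by apply: measurable_funB; [exact: measurable_line|exact: measurable_primitive_line].
have := @ae_slices0 _ _ _ _ _ mu3 leb F mF _.
have F0 y : {ae mu3, forall x, F (x, y) = 0}.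
  rewrite /F /= indicE; case: (boolP (y \in I01)) => [|_]; last by apply: aeW => x; rewrite mul0r.
  rewrite inE /= in_itv /= => /fg; apply: ae_imp => x ->; rewrite subrr mulr0//.
move=> /(_ F0); apply: ae_imp => x; apply: ae_imp => s Fs s01.
move: Fs; rewrite /F /= indicE mem_set /= ?in_itv// mul1r => /eqP.
by rewrite subr_eq0 => /eqP.
Qed.

Lemma primitive_ae_eq (c t : R) (g h : R -> R) : measurable_fun I01 h ->
  leb.-integrable I01 (EFin \o g) -> 0 <= t <= 1 ->
  {ae leb, forall s : R, 0 <= s <= 1 -> g s = h s} ->
  leb.-integrable I01 (EFin \o h) /\ primitive c g t = primitive c h t.
Proof.
move=> mh ig t01 gh.
have mg : measurable_fun I01 g by exact: rint_measurable ig.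
have s01 : (`[0, t]%classic : set R) `<=` I01.
  by move=> s /=; rewrite !in_itv /= => /andP[? ?]; apply/andP; split; lra.
split.
  apply/integrableP; split; first exact/measurable_EFinP.
  have [_] := integrableP _ _ _ ig; apply: le_lt_trans; rewrite le_eqVlt; apply/orP; left; apply/eqP.
  apply: ae_eq_integral => //.
  - by apply/measurable_EFinP; apply: measurableT_comp.
  - by apply/measurable_EFinP; apply: measurableT_comp.
  - by apply: ae_imp gh => s gh /=; rewrite in_itv /= => /gh ->.
congr (_ + _); congr fine; apply: ae_eq_integral => //.
- by apply/measurable_EFinP; apply: measurable_funS mg.
- by apply/measurable_EFinP; apply: measurable_funS mh.
- by apply: ae_imp gh => s gh /s01; rewrite /= in_itv /= => /gh ->.
Qed.

Lemma measurable_line1 (e : R3) (f : R3 -> R) x (D : set R) :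
  measurable_fun [set: R3] f -> measurable_fun D (line e f x).
Proof.
move=> mf; apply: measurable_funS (measurableT) (@subsetT _ D) _.
exact: (measurable_fun_pair2 x (measurable_line e mf)).
Qed.

(** On almost every line both factors agree at almost every parameter with their primitives, to
    which the one-dimensional product rule applies; replacing the primitives by the functions inside
    the integral changes nothing. *)
Lemma ac_lines_mul (e : R3) (f1 g1 f2 g2 : R3 -> R) :
  ac_lines e f1 g1 -> ac_lines e f2 g2 ->
  ac_lines e (fun x => f1 x * f2 x) (fun x => g1 x * f2 x + f1 x * g2 x).
Proof.
move=> a1 a2; have [mf1 mg1 I1 E1] := a1; have [mf2 mg2 I2 E2] := a2.
have mf : measurable_fun [set: R3] (fun x => f1 x * f2 x) by exact: measurable_funM.
have mg : measurable_fun [set: R3] (fun x => g1 x * f2 x + f1 x * g2 x).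
  by apply: measurable_funD; exact: measurable_funM.
have key t : 0 <= t <= 1 -> {ae mu3, forall x,
   leb.-integrable I01 (EFin \o line e (fun x => g1 x * f2 x + f1 x * g2 x) x) /\
   primitive (f1 x) (line e g1 x) t * primitive (f2 x) (line e g2 x) t =
   primitive (f1 x * f2 x) (line e (fun x => g1 x * f2 x + f1 x * g2 x) x) t}.
  move=> t01.
  have LL : {ae mu3, forall x, {ae leb, forall s : R, 0 <= s <= 1 ->
      line e f1 x s = primitive (f1 x) (line e g1 x) s /\
      line e f2 x s = primitive (f2 x) (line e g2 x) s}}.
    apply: ae_imp2 (ac_lines_ae a1) (ac_lines_ae a2) => x.
    by apply: ae_imp2 => s h1 h2 s01; split; [exact: h1|exact: h2].
  apply: ae_imp3 I1 I2 LL => x i1 i2 L.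
  have [ip /(_ t t01) ->] := primitive_mul (f1 x) (f2 x) i1 i2.
  apply: primitive_ae_eq => //; first exact: measurable_line1.
  by apply: ae_imp L => s L /L [E1s E2s]; rewrite /line -/(line e f1 x s) -/(line e f2 x s) E1s E2s.
split => //.
  by have := key 0 ltac:(lra); apply: ae_imp => x [].
move=> t t01; have := key t t01; have := E1 t t01; have := E2 t t01.
apply: ae_imp3 => x e2 e1 [_ <-].
by rewrite -e1 -e2.
Qed.

(** The one-dimensional chain rule on almost every line, followed by replacing the primitive by [f]
    under the integral. The rule serves for the profile and for the trigonometric functions, whose
    derivatives are Lipschitz. *)
Lemma ac_lines_chain (e : R3) (f g : R3 -> R) (Phi dPhi : R -> R) (M : R) :
  ac_lines e f g -> (forall x : R, is_derive x 1 Phi (dPhi x)) ->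
  0 <= M -> (forall x y, `|dPhi x - dPhi y| <= M * `|x - y|) ->
  ac_lines e (Phi \o f) (fun x => dPhi (f x) * g x).
Proof.
move=> a dP M0 lip; have [mf mg I1 E1] := a.
have mdPhi : measurable_fun [set: R] dPhi.
  apply: continuous_measurable_fun => x; apply/cvgrPdist_le => eps e0.
  near=> y; apply: le_trans (lip _ _) _.
  apply: (@le_trans _ _ ((M + 1) * `|x - y|)); first by rewrite ler_wpM2r// lerDl.
  rewrite mulrC -ler_pdivlMr; last by lra.
  by near: y; apply: cvgr_dist_le => //; rewrite divr_gt0//; lra.
have mPhi : measurable_fun [set: R] Phi.
  apply: continuous_measurable_fun => x; apply: differentiable_continuous.
  by apply/derivable1_diffP; have [] := dP x.
have mh : measurable_fun [set: R3] (fun x => dPhi (f x) * g x).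
  by apply: measurable_funM => //; exact: measurableT_comp.
have key t : 0 <= t <= 1 -> {ae mu3, forall x,
   leb.-integrable I01 (EFin \o line e (fun x => dPhi (f x) * g x) x) /\
   Phi (primitive (f x) (line e g x) t) =
   primitive (Phi (f x)) (line e (fun x => dPhi (f x) * g x) x) t}.
  move=> t01; apply: ae_imp2 I1 (ac_lines_ae a) => x i1 L.
  have [ip /(_ t t01) ->] := primitive_chain (f x) i1 dP M0 lip.
  apply: primitive_ae_eq => //; first exact: measurable_line1.
  by apply: ae_imp L => s L /L Es; rewrite /line -/(line e f x s) Es.
split => //.
- exact: measurableT_comp.
- by have := key 0 ltac:(lra); apply: ae_imp => x [].
move=> t t01; apply: ae_imp2 (E1 t t01) (key t t01) => x e1 [_ <-].
by rewrite -e1.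
Unshelve. all: by end_near.
Qed.

Lemma is_derive_line (e : R3) (f : R3 -> R) (x : R3) (s : R) :
  derivable f (x + s *: e) e -> is_derive s 1 (line e f x) ('D_e f (x + s *: e)).
Proof.
move=> df.
have TL (h v y : R) : x + (h *: v + y) *: e = h *: (v *: e) + (x + y *: e).
  by rewrite scalerDl scalerA addrCA.
have [E1 E2] := @derive_affine R R R3 (fun s : R => x + s *: e) (fun v => v *: e) TL f 1 s.
rewrite scale1r in E1 E2.
by split; [exact/E2|exact: E1].
Qed.

Lemma continuous_line (e : R3) (f : R3 -> R) (x : R3) :
  continuous f -> continuous (line e f x).
Proof.
move=> cf s; apply: (@continuous_comp _ _ _ (fun s : R => x + s *: e) f); last exact: cf.
by apply: cvgD; [exact: cvg_cst|apply: cvgZl; exact: cvg_id].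
Qed.

Lemma continuous_Rintegrable (f : R -> R) (a b : R) : continuous f ->
  leb.-integrable `[a, b] (EFin \o f).
Proof.
move=> cf; apply: continuous_compact_integrable; first exact: segment_compact.
exact: continuous_subspaceT.
Qed.

Lemma primitive_of_continuous (f g : R -> R) (t : R) : continuous g ->
  (forall s : R, is_derive s 1 f (g s)) -> 0 <= t -> f t = primitive (f 0) g t.
Proof.
move=> cg df; rewrite le_eqVlt => /orP[/eqP <-|t0]; first by rewrite primitive0.
have cf : continuous f.
  by move=> s; apply: differentiable_continuous; apply/derivable1_diffP; have [] := df s.
rewrite /primitive /Rintegral (@continuous_FTC2 R g f 0 t)//=.
- by rewrite addrCA subrr addr0.
- exact: continuous_subspaceT.
- split => [s _| |].
  + by have [] := df s.
  + by apply: cvg_at_right_filter; exact: cf.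
  + by apply: cvg_at_left_filter; exact: cf.
- by move=> s _; rewrite derive1E; have [_ ->] := df s.
Qed.

Lemma ac_lines_C1 (e : R3) (f : R3 -> R) : continuous f ->
  (forall x, derivable f x e) -> continuous ('D_e f) -> ac_lines e f ('D_e f).
Proof.
move=> cf df cdf; split; [exact: continuous_measurable3|exact: continuous_measurable3| |].
  apply: aeW => x; apply: continuous_Rintegrable; exact: continuous_line.
move=> t /andP[t0 t1]; apply: aeW => x.
rewrite (primitive_of_continuous (g := line e ('D_e f) x) _ _ t0).
- by rewrite /line scale0r addr0.
- exact: continuous_line.
- by move=> s; apply: is_derive_line.
Qed.

End LineCalculus.

(** * Operations on test functions *)

Section TestFunctions.
Variables (R : realType).
Implicit Types V U : normedModType R.

Lemma test_continuous V (phi : V -> R) : test_function phi -> continuous phi.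
Proof. by move=> [ck _]; exact: (Ck_continuous (ck 0%N)). Qed.

Lemma test_derivable V (phi : V -> R) x v : test_function phi -> derivable phi x v.
Proof. by move=> [ck _]; have [_ /(_ v)[]] := ck 1%N. Qed.

Lemma test_function_derive V (phi : V -> R) v : test_function phi -> test_function ('D_v phi).
Proof.
move=> [ck [K cK phiK]]; split; first by move=> k; have [_ /(_ v)[]] := ck k.+1.
exists K => // x xK.
have oK : open (~` K).
  by apply: closed_openC; apply: compact_closed => //; exact: norm_hausdorff.
have E : \forall y \near x, 0 = phi y.
  by near=> y; rewrite phiK//; near: y; exact: open_nbhs_nbhs.
have := near_eq_is_derive (f := cst 0) (v := v) (df := 0) E (is_derive_cst _ _ _).
by case.
Unshelve. all: by end_near.
Qed.

(** The support of [phi \o T] lies in the compact image of [K] under the left inverse [S]; [T] may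
    be a translation or the embedding of a slice. *)
Lemma test_function_affine U V (T L : U -> V) (S : V -> U) (phi : V -> R) :
  continuous T -> (forall (h : R) (v x : U), T (h *: v + x) = h *: L v + T x) ->
  continuous S -> (forall x, S (T x) = x) ->
  test_function phi -> test_function (phi \o T).
Proof.
move=> cT TL cS ST [ck [K cK phiK]]; split; first by move=> k; exact: (Ck_affine cT TL).
exists (S @` K).
  by apply: continuous_compact => //; exact: continuous_subspaceT.
move=> x xK; apply: phiK => Tx; apply: xK.
by exists (T x).
Qed.

Lemma test_bounded V (phi : V -> R) : test_function phi ->
  exists2 M, 0 <= M & forall x, `|phi x| <= M.
Proof.
move=> tphi; have [_ [K cK phiK]] := tphi.
have [M [_ KM]] : bounded_set (phi @` K).
  apply: compact_bounded; apply: continuous_compact => //.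
  by apply: continuous_subspaceT; exact: test_continuous.
exists (`|M| + 1) => [|x]; first by rewrite addr_ge0.
have [Kx|nKx] := pselect (K x); last by rewrite phiK// normr0 addr_ge0.
by apply: KM; [rewrite (le_lt_trans (ler_norm M))// ltrDl|exists x].
Qed.

End TestFunctions.

(** * From weak derivatives to lines and back *)

Section WeakToLines.
Variable R : realType.
Local Notation R3 := (R3 R).
Local Notation mu3 := (mu3 R).
Local Notation leb := (@lebesgue_measure R).

Lemma test_function_shift (phi : R3 -> R) (v : R3) :
  test_function phi -> test_function (fun x => phi (x + v)).
Proof.
apply: (@test_function_affine R R3 R3 (fun x => x + v) id (fun x => x - v)).
- by move=> x; apply: cvgD; [exact: cvg_id|exact: cvg_cst].
- by move=> h u x; rewrite addrA.
- by move=> x; apply: cvgB; [exact: cvg_id|exact: cvg_cst].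
- by move=> x; rewrite addrK.
Qed.

Lemma derive_shift3 (phi : R3 -> R) (v e x : R3) :
  'D_e (fun x => phi (x + v)) x = 'D_e phi (x + v).
Proof.
by have [] := @derive_affine R R3 R3 (fun x => x + v) id (fun h u y => esym (addrA _ _ _)) phi e x.
Qed.

Lemma L1loc3_measurable (f : R3 -> R) : L1loc3 f -> measurable_fun [set: R3] f.
Proof.
move=> fL; pose C (n : nat) : set R3 := cbox ((- n%:R, - n%:R), - n%:R) ((n%:R, n%:R), n%:R).
have CT : \bigcup_n C n = [set: R3].
  apply/seteqP; split => // x _.
  have [n xn] := @compact_sub_cbox R [set x] (@compact_set1 _ x).
  by exists n => //; exact: xn.
rewrite -CT; apply/measurable_fun_bigcup => n; first exact: measurable_cbox.
by apply: rint_measurable; apply: fL; exact: compact_cbox.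
Qed.

(** Boundedness and compact support are expressed together by |psi| <= M 1_K, which covers test
    functions and indicators of compact sets alike. *)
Lemma L1loc3_mul (f psi : R3 -> R) (K : set R3) (M : R) : L1loc3 f ->
  measurable_fun [set: R3] psi -> compact K -> 0 <= M ->
  (forall x, `|psi x| <= M * \1_K x) -> mu3.-integrable setT (EFin \o (fun x => f x * psi x)).
Proof.
move=> fL mpsi cK M0 psiK; have mK := compact_measurable3 cK.
have IK : mu3.-integrable setT (EFin \o (fun x => M * (\1_K x * f x))).
  by apply: rintZl => //; apply/(rint_indic _ mK); exact: fL.
apply: rint_le IK => //; first by apply: measurable_funM => //; exact: L1loc3_measurable.
move=> x _; rewrite !normrM mulrC (ger0_norm M0) mulrA ler_wpM2r//.
by apply: le_trans (psiK x) _; rewrite [`|\1_K x|]ger0_norm// indicE.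
Qed.

Lemma test_dominated (phi : R3 -> R) : test_function phi ->
  exists K M, [/\ compact K, 0 <= M & forall x, `|phi x| <= M * \1_K x].
Proof.
move=> tphi; have [_ [K cK phiK]] := tphi; have [M M0 phiM] := test_bounded tphi.
exists K, M; split => // x; rewrite indicE; case: (boolP (x \in K)) => xK.
  by rewrite mulr1.
by rewrite phiK ?normr0 ?mulr0//; move: xK; rewrite notin_setE.
Qed.

Lemma L1loc3_test (f phi : R3 -> R) : L1loc3 f -> test_function phi ->
  mu3.-integrable setT (EFin \o (fun x => f x * phi x)).
Proof.
move=> fL tphi; have [K [M [cK M0 KM]]] := test_dominated tphi.
apply: (L1loc3_mul fL _ cK M0 KM).
by apply: continuous_measurable3; exact: test_continuous.
Qed.

Section Sheared.
Variables (e : R3) (f psi : R3 -> R) (K : set R3) (M : R) (t : R).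
Hypotheses (fL : L1loc3 f) (mpsi : measurable_fun [set: R3] psi) (cK : compact K).
Hypotheses (M0 : 0 <= M) (psiK : forall x, `|psi x| <= M * \1_K x).
Hypothesis (t01 : 0 <= t <= 1).
Local Notation I := (`[0, t]%classic : set R).

(** Contains the support of every translate of [psi] by s e with 0 <= s <= 1. *)
Let K' : set R3 := (fun p : R3 * R => p.1 + p.2 *: e) @` (K `*` `[0, 1]).

Let cK' : compact K'.
Proof.
apply: continuous_compact; last by apply: compact_setX => //; exact: segment_compact.
apply: continuous_subspaceT => p; apply: cvgD; first exact: cvg_fst.
by apply: cvgZl; exact: cvg_snd.
Qed.

Let mf : measurable_fun [set: R3] f. Proof. exact: L1loc3_measurable. Qed.

Let psi_shift (x : R3) (s : R) : 0 <= s <= 1 -> `|line e psi x (- s)| <= M * \1_K' x.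
Proof.
move=> s01; apply: le_trans (psiK _) _; rewrite ler_wpM2l// !indicE ler_nat.
case: (boolP (_ \in K)) => // xK; rewrite [(x \in K')]mem_set//.
exists (x + (- s) *: e, s); last by rewrite /= -addrA -scalerDl addNr scale0r addr0.
by split; [move: xK; rewrite inE|rewrite /= in_itv].
Qed.

(** [Q] is [Q'] composed with the shear (x, s) -> (x + s e, s). With the translation on [psi]
    instead of the locally integrable [f], a tensor product dominates; invariance of [mu3] in each
    slice s then carries integrability from [Q'] over to [Q]. *)
Let Q' (p : R3 * measurableTypeR R) : R := \1_I p.2 * (f p.1 * line e psi p.1 (- (p.2 : R))).
Let Q (p : R3 * measurableTypeR R) : R := \1_I p.2 * (line e f p.1 p.2 * psi p.1).

Let mI : measurable_fun [set: R3 * measurableTypeR R] (fun p : R3 * measurableTypeR R => \1_I p.2 : R).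
Proof. by apply: (measurableT_comp (_ : measurable_fun setT (\1_I : measurableTypeR R -> R)) measurable_snd). Qed.

Let mQ' : measurable_fun setT Q'.
Proof.
apply: measurable_funM; first exact: mI.
apply: measurable_funM; first exact: (measurableT_comp mf measurable_fst).
have mopp : measurable_fun [set: R3 * measurableTypeR R]
    (fun p : R3 * measurableTypeR R => (p.1, - (p.2 : R) : measurableTypeR R)).
  by apply: measurable_fun_pair; [exact: measurable_fst|apply: (measurableT_comp (@oppr_measurable R setT)); exact: measurable_snd].
exact: (measurableT_comp (measurable_line e mpsi) mopp).
Qed.

Let mQ : measurable_fun setT Q.
Proof.
apply: measurable_funM; first exact: mI.
by apply: measurable_funM; [exact: measurable_line|exact: (measurableT_comp mpsi measurable_fst)].
Qed.

Let IQ' : (mu3 \x leb)%E.-integrable setT (EFin \o Q').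
Proof.
have I1 : mu3.-integrable setT (EFin \o (fun x => f x * (M * \1_K' x))).
  apply: (L1loc3_mul fL _ cK' M0) => [|x]; last by rewrite ger0_norm// mulr_ge0// indicE.
  by apply: measurable_funM => //; apply: measurable_indic; exact: compact_measurable3.
have I2 : leb.-integrable setT (EFin \o (\1_I : R -> R)) by exact: integrable_indic_itv.
apply: rint_le (rint_tensor I1 I2) => // -[x s] _.
rewrite /Q' /= mulrC [\1_I s]indicE; case: (boolP (s \in I)) => sI; last first.
  by rewrite mulr0 normr0 normr_ge0.
rewrite !mulr1 !normrM ler_wpM2l// -normrM [leRHS]ger0_norm ?mulr_ge0// ?indicE//.
have := @psi_shift x s; rewrite indicE; apply.
have s0t : `[0, t]%classic s by rewrite inE in sI.
by move: s0t t01; rewrite /= in_itv /= => /andP[? ?] /andP[? ?]; apply/andP; split; lra.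
Qed.

Lemma shear_slice (s : R) : \int[mu3]_x (line e f x s * psi x) =
  \int[mu3]_x (f x * line e psi x (- s)).
Proof.
rewrite -(Rintegral_preserves (preserves_mu3_add (s *: e)) (F := fun x => f x * line e psi x (- s))).
  by apply: eq_Rintegral => x _; rewrite /line -[x + s *: e + _]addrA -scalerDl subrr scale0r addr0.
by apply: measurable_funM => //; exact: (measurable_fun_pair1 (- s : measurableTypeR R) (measurable_line e mpsi)).
Qed.

Let IQ : (mu3 \x leb)%E.-integrable setT (EFin \o Q).
Proof.
have mQE : measurable_fun setT (EFin \o Q) by exact/measurable_EFinP.
have mQE' : measurable_fun setT (EFin \o Q') by exact/measurable_EFinP.
apply/(integrable21ltyP mu3 leb mQE).
have /(integrable21ltyP mu3 leb mQE') := IQ'; apply: le_lt_trans.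
rewrite le_eqVlt; apply/orP; left; apply/eqP; apply: eq_integral => s _.
rewrite -(integral_preserves (preserves_mu3_add (s *: e)) (F := fun x => `|(EFin \o Q') (x, s)|%E)).
  by apply: eq_integral => x _; rewrite /Q /Q' /line /= -[x + s *: e + _]addrA -scalerDl subrr scale0r addr0.
by apply: measurableT_comp => //; apply: measurable_fun_pair1.
Qed.

Let slice (x : R3) : \int[leb]_s Q (x, s) = primitive 0 (line e f x) t * psi x.
Proof.
rewrite /primitive add0r (Rintegral_indic leb `[0, t]%classic (line e f x)) [RHS]mulrC -RintegralZ_measurable//.
  by apply: eq_Rintegral => s _; rewrite /Q /=; ring.
by apply: measurable_funM; [exact: measurable_indic|exact: measurable_line1].
Qed.

Lemma integrable_primitive_line :
  mu3.-integrable setT (EFin \o (fun x => primitive 0 (line e f x) t * psi x)).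
Proof.
have := rint_fubini1 IQ.
by congr integrable; apply/funext => x /=; rewrite slice.
Qed.

Lemma sheared_slices_integrable : {ae mu3, forall x,
  leb.-integrable setT (EFin \o (fun s : R => \1_I s * (line e f x s * psi x)))}.
Proof. exact: (ae_integrable1 IQ). Qed.

Lemma measurable_sheared_integral :
  measurable_fun [set: measurableTypeR R] (fun s : measurableTypeR R => \1_I s * \int[mu3]_x (line e f x s * psi x)).
Proof.
apply: measurable_funM => //; pose Qs (p : measurableTypeR R * R3) : R := line e f p.2 p.1 * psi p.2.
apply: (@measurable_Rintegral_param _ _ (measurableTypeR R) R3 _ mu3 Qs).
apply: measurable_funM; last exact: (measurableT_comp mpsi measurable_snd).
exact: (measurableT_comp (measurable_line e mf) (@measurable_swap _ _ (measurableTypeR R) R3)).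
Qed.

Lemma shear_fubini1 : \int[mu3]_x (primitive 0 (line e f x) t * psi x) =
  \int[leb]_s (\1_I s * \int[mu3]_x (line e f x s * psi x)).
Proof.
transitivity (\int[mu3]_x \int[leb]_s Q (x, s)).
  by apply: eq_Rintegral => x _; rewrite slice.
rewrite -(Rfubini1 IQ) (Rfubini2 IQ); apply: eq_Rintegral => s _.
rewrite -RintegralZ_measurable//; apply: measurable_funM => //.
exact: (measurable_fun_pair1 (s : measurableTypeR R) (measurable_line e mf)).
Qed.

Lemma shear_fubini2 :
  \int[leb]_s (\1_I s * \int[mu3]_x (f x * line e psi x (- s))) =
  \int[mu3]_x (f x * primitive 0 (fun s => line e psi x (- s)) t).
Proof.
have mo (x : R3) : measurable_fun [set: measurableTypeR R] (fun s : measurableTypeR R => line e psi x (- s)).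
  exact: (measurableT_comp (measurable_fun_pair2 x (measurable_line e mpsi)) (preserves_lebesgue_opp R).1).
transitivity (\int[leb]_s \int[mu3]_x Q' (x, s)).
  apply: eq_Rintegral => s _; rewrite -RintegralZ_measurable//.
  by apply: measurable_funM => //; exact: (measurable_fun_pair1 (- s : measurableTypeR R) (measurable_line e mpsi)).
rewrite -(Rfubini2 IQ') (Rfubini1 IQ'); apply: eq_Rintegral => x _.
rewrite /primitive add0r (Rintegral_indic leb `[0, t]%classic (fun s => line e psi x (- s))) -RintegralZ_measurable//.
  by apply: eq_Rintegral => s _; rewrite /Q' /=; ring.
by apply: measurable_funM; [exact: measurable_indic|exact: mo].
Qed.

End Sheared.

(* The difference quotient identity is tested against [phi] and moved onto [f] by
   two applications of Fubini. *)
Lemma is_wpartial_ac_lines (a : 'I_3) (f g : R3 -> R) :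
  is_wpartial a f g -> ac_lines (unit_vec R a) f g.
Proof.
move=> [fL gL wfg]; set e := unit_vec R a.
have mf := L1loc3_measurable fL; have mg := L1loc3_measurable gL.
have ae_int : {ae mu3, forall x, leb.-integrable (`[0, 1]%classic : set R) (EFin \o line e g x)}.
  pose C (n : nat) : set R3 := cbox ((- n%:R, - n%:R), - n%:R) ((n%:R, n%:R), n%:R).
  have : {ae mu3, forall x, forall n : nat, leb.-integrable setT (EFin \o (fun s : R =>
      \1_(`[0, 1]%classic : set R) s * (line e g x s * \1_(C n) x)))}.
    apply: ae_foralln => n; have t11 : 0 <= (1 : R) <= 1 by rewrite ler01 lexx.
    have cC : compact (C n) by exact: compact_cbox.
    apply: (sheared_slices_integrable e gL _ cC ler01 _ t11).
      by apply: measurable_indic; exact: measurable_cbox.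
    by move=> x; rewrite mul1r ger0_norm ?indicE.
  apply: ae_imp => x Hx; have [n xn] := @compact_sub_cbox R [set x] (@compact_set1 _ x).
  have mI : measurable (`[0, 1]%classic : set (measurableTypeR R)) by exact: measurable_itv.
  apply/(rint_indic _ mI); have := Hx n.
  congr integrable; apply/funext => s /=; rewrite [\1_(C n) x]indicE mem_set ?mulr1//.
  exact: xn.
split => // t t01.
pose P (k : R3 -> R) x := primitive 0 (line e k x) t.
(* The defect of the fundamental theorem of calculus on [0, t]; it is locally integrable and
   vanishes as a distribution. *)
pose H x := line e f x t - f x - P g x.
suff : {ae mu3, forall x, H x = 0}.
  apply: ae_imp => x /eqP; rewrite /H subr_eq0 => /eqP Hx.
  by rewrite /primitive -[line e f x t](subrK (f x)) Hx /P /primitive add0r addrC.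
apply: weak_zero_ae_eq0.
  move=> K cK; have mK := compact_measurable3 cK.
  have m1 : measurable_fun [set: R3] (\1_K : R3 -> R) by exact: measurable_indic.
  have d1 x : `|\1_K x : R| <= 1 * \1_K x by rewrite mul1r ger0_norm ?indicE.
  apply: rintB => //; [apply: rintB => //|]; last 1 first.
  - have := integrable_primitive_line e gL m1 cK ler01 d1 t01.
    move=> IP; apply/(rint_indic _ mK); move: IP.
    by congr integrable; apply/funext => x; rewrite /P /= mulrC.
  - pose T := (fun x : R3 => x + t *: e) @` K.
    have cT : compact T.
      apply: continuous_compact => //; apply: continuous_subspaceT => x.
      by apply: cvgD; [exact: cvg_id|exact: cvg_cst].
    have mT : measurable_fun [set: R3] (\1_T : R3 -> R).
      by apply: measurable_indic; exact: compact_measurable3.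
    have dT (x : R3) : `|\1_T x : R| <= 1 * \1_T x by rewrite mul1r ger0_norm ?indicE.
    have := integrable_preserves (preserves_mu3_add (t *: e)) (L1loc3_mul fL mT cT ler01 dT).
    move=> /(integrableS measurableT mK (@subsetT _ _)); apply: eq_integrable => // x.
    rewrite inE => Kx; rewrite /= /line indicE mem_set ?mulr1//.
    by exists x.
  - exact: fL.
move=> phi tphi.
have [K [M [cK M0 KM]]] := test_dominated tphi.
have tdphi := test_function_derive e tphi.
have [K' [M' [cK' M'0 KM']]] := test_dominated tdphi.
have mphi : measurable_fun [set: R3] phi by apply: continuous_measurable3; exact: test_continuous.
have mdphi : measurable_fun [set: R3] ('D_e phi) by apply: continuous_measurable3; exact: test_continuous.
(* For each s the translate of [phi] by s e is a test function, so the definition of the weak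
   derivative applies inside the integral over s. *)
have Pg : \int[mu3]_x (P g x * phi x) = - \int[mu3]_x (P f x * 'D_e phi x).
  rewrite /P (shear_fubini1 e gL mphi cK M0 KM t01) (shear_fubini1 e fL mdphi cK' M'0 KM' t01).
  rewrite -mulN1r -RintegralZ_measurable//; last exact: (measurable_sheared_integral e t fL mdphi).
  apply: eq_Rintegral => s _; rewrite mulN1r -mulrN; congr (_ * _).
  rewrite (shear_slice e gL mphi s) (shear_slice e fL mdphi s).
  have Ew := wfg _ (test_function_shift ((- s) *: e) tphi).
  rewrite -[LHS]opprK; congr (- _); rewrite -[LHS]Ew; apply: eq_Rintegral => x _.
  by rewrite derive_shift3.
(* On the side of the test function the integral over s is explicit: the derivative along the line
   integrates to phi(x) - phi(x - t e). *)
have Pf : \int[mu3]_x (P f x * 'D_e phi x) = \int[mu3]_x (f x * (phi x - line e phi x (- t))).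
  rewrite /P (shear_fubini1 e fL mdphi cK' M'0 KM' t01).
  under eq_Rintegral do rewrite (shear_slice e fL mdphi).
  rewrite (shear_fubini2 e fL mdphi cK' M'0 KM' t01).
  apply: eq_Rintegral => x _; congr (_ * _).
  have [t0 t1] := andP t01.
  have lc : continuous (fun s : R => line e ('D_e phi) x (- s)).
    move=> s; apply: (@continuous_comp _ _ _ -%R (line e ('D_e phi) x)).
      by apply: cvgN; exact: cvg_id.
    by apply: continuous_line; exact: test_continuous.
  have dl (s : R) : is_derive s 1 (fun s : R => phi x - line e phi x (- s)) (line e ('D_e phi) x (- s)).
    have d1 : is_derive (- s) 1 (line e phi x) (line e ('D_e phi) x (- s)).
      by apply: is_derive_line; exact: test_derivable.
    have d2 := is_derive1_comp d1 (is_deriveN (is_derive_id s (1 : R))).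
    by have := is_deriveB (is_derive_cst (phi x) s (1 : R)) d2; rewrite mulrN1 sub0r opprK.
  rewrite (primitive_of_continuous lc dl t0); congr (primitive _ _ _).
  by rewrite oppr0 /line scale0r addr0 subrr.
have Ifphi := L1loc3_test fL tphi.
have Ifs : mu3.-integrable setT (EFin \o (fun x => f x * line e phi x (- t))).
  exact: (L1loc3_test fL (test_function_shift ((- t) *: e) tphi)).
have IP := integrable_primitive_line e gL mphi cK M0 KM t01.
have shift_eq (x : R3) : line e f x t * phi x = f (x + t *: e) * line e phi (x + t *: e) (- t).
  by rewrite /line -[x + t *: e + _]addrA -scalerDl subrr scale0r addr0.
have Il : mu3.-integrable setT (EFin \o (fun x => line e f x t * phi x)).
  have := integrable_preserves (preserves_mu3_add (t *: e)) Ifs.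
  by congr integrable; apply/funext => x; rewrite /= shift_eq.
transitivity (\int[mu3]_x (line e f x t * phi x - f x * phi x - P g x * phi x)).
  by apply: eq_Rintegral => x _; rewrite /H; ring.
rewrite RintegralB//; last exact: rintB.
rewrite RintegralB// Pg Pf opprK (shear_slice e fL mphi t).
rewrite -RintegralB// -RintegralD//; last first.
- by have := rintB measurableT Ifphi Ifs; congr integrable; apply/funext => x /=; rewrite mulrBr.
- exact: rintB.
rewrite (_ : (fun x => _) = fun=> 0) ?Rintegral_cst ?mul0r//.
by apply/funext => x; ring.
Qed.

(** The product with a test function is absolutely continuous on lines. The integral over all x of
    its increment along x to x + e is 0 by translation invariance, and by Fubini it is the integral
    of the derivative given by the product rule. *)
Lemma ac_lines_is_wpartial (a : 'I_3) (f g : R3 -> R) : L1loc3 f -> L1loc3 g ->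
  ac_lines (unit_vec R a) f g -> is_wpartial a f g.
Proof.
move=> fL gL afg; split => // phi tphi; set e := unit_vec R a.
have tdphi := test_function_derive e tphi.
have aphi : ac_lines e phi ('D_e phi).
  apply: ac_lines_C1; [exact: test_continuous| |exact: test_continuous].
  by move=> x; exact: test_derivable.
have [mF mG _ /(_ 1 ltac:(lra)) E] := ac_lines_mul afg aphi.
have I1 := L1loc3_test fL tphi; have I2 := L1loc3_test gL tphi.
have I3 := L1loc3_test fL tdphi.
pose F x := f x * phi x; pose G x := g x * phi x + f x * 'D_e phi x.
have IG : mu3.-integrable setT (EFin \o G) by exact: rintD.
pose W (p : R3 * measurableTypeR R) : R := \1_(`[0, 1]%classic : set R) p.2 * line e G p.1 p.2.
have mW : measurable_fun setT W.
  apply: measurable_funM; last exact: measurable_line.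
  by apply: (measurableT_comp (_ : measurable_fun setT (\1_(`[0, 1]%classic : set R) : measurableTypeR R -> R)) measurable_snd).
have IW : (mu3 \x leb)%E.-integrable setT (EFin \o W).
  have I01 : leb.-integrable setT (EFin \o (\1_`[0, 1] : R -> R)) by exact: integrable_indic_itv.
  have mWE : measurable_fun setT (EFin \o W) by exact/measurable_EFinP.
  have IT := rint_tensor IG I01.
  have mTE := measurable_int _ IT.
  apply/(integrable21ltyP mu3 leb mWE).
  have /(integrable21ltyP mu3 leb mTE) := IT; apply: le_lt_trans.
  rewrite le_eqVlt; apply/orP; left; apply/eqP; apply: eq_integral => s _.
  rewrite -(integral_preserves (preserves_mu3_add (s *: e)) (F := fun x => `|(G x * \1_(`[0, 1]%classic : set R) s)%:E|%E)).
    by apply: eq_integral => x _; rewrite /W /line /= mulrC.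
  apply: measurableT_comp => //; apply/measurable_EFinP; apply: measurable_funM => //.
have E1 : \int[mu3]_x \int[leb]_s W (x, s) = \int[mu3]_x G x.
  rewrite -(Rfubini1 IW) (Rfubini2 IW).
  transitivity (\int[leb]_s (\int[mu3]_x G x * \1_(`[0, 1]%classic : set R) s)).
    apply: eq_Rintegral => s _; rewrite /W /= RintegralZ_measurable//; last first.
      exact: (measurable_fun_pair1 (s : measurableTypeR R) (measurable_line e mG)).
    have Es : \int[mu3]_x line e G x s = \int[mu3]_x G x.
      exact: (Rintegral_preserves (preserves_mu3_add (s *: e)) mG).
    by rewrite [LHS]mulrC -Es.
  rewrite RintegralZ_measurable//.
  rewrite (_ : \int[leb]_s _ = 1) ?mulr1//.
  rewrite -[RHS](_ : \int[leb]_(s in `[0, 1]) 1 = 1).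
    by rewrite [RHS]Rintegral_indic; apply: eq_Rintegral => s _; rewrite mulr1.
  have l1 : (@lebesgue_measure R `[0%R, 1%R]%classic = 1)%E.
    by rewrite lebesgue_measure_itv /= lte_fin ltr01 -EFinB subr0.
  by rewrite Rintegral_cst// mul1r -[RHS]/(fine 1%:E); congr fine; exact: l1.
have E2 : \int[mu3]_x \int[leb]_s W (x, s) = \int[mu3]_x (line e F x 1 - F x).
  congr fine; apply: ae_eq_integral => //.
  - by apply/measurable_EFinP; exact: measurable_Rintegral_param.
  - apply/measurable_EFinP; apply: measurable_funB => //.
    exact: (measurable_fun_pair1 (1 : measurableTypeR R) (measurable_line e mF)).
  apply: ae_imp E => x Ex _; congr EFin.
  have Ex' : line e F x 1 = primitive (F x) (line e G x) 1 := Ex.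
  rewrite Ex' /primitive (Rintegral_indic leb `[0, 1]%classic (line e G x)).
  by rewrite [F x + _]addrC addrK.
have E3 : \int[mu3]_x (line e F x 1 - F x) = 0.
  rewrite RintegralB//; last first.
    exact: (integrable_preserves (preserves_mu3_add (1 *: e)) I1).
  by rewrite (Rintegral_preserves (preserves_mu3_add (1 *: e)) mF) subrr.
by apply/eqP; rewrite -addr_eq0 addrC -RintegralD// -/G -[eqbRHS]E3 -E2 E1.
Qed.

End WeakToLines.

(** * Complex integrals *)

Section ComplexIntegration.
Local Open Scope complex_scope.
Variable R : realType.
Implicit Types z w : R[i].

Definition modulus z : R := Num.sqrt (sqr_modulus z).

Lemma sqr_modulus_ge0 z : 0 <= sqr_modulus z.
Proof. by rewrite addr_ge0// sqr_ge0. Qed.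

Lemma sqr_modulusM z w : sqr_modulus (z * w) = sqr_modulus z * sqr_modulus w.
Proof. by case: z w => [a b] [c d]; rewrite /sqr_modulus /=; ring. Qed.

Lemma sqr_modulus_conj z : sqr_modulus z^*%C = sqr_modulus z.
Proof. by case: z => a b; rewrite /sqr_modulus /= sqrrN. Qed.

Lemma sqr_modulus_real (x : R) : sqr_modulus x%:C = x ^+ 2.
Proof. by rewrite /sqr_modulus /= expr0n addr0. Qed.

Lemma mulConj z : z^*%C * z = (sqr_modulus z)%:C.
Proof. by case: z => a b; apply/eqP; rewrite eq_complex /sqr_modulus /=; apply/andP; split; apply/eqP; ring. Qed.

Lemma modulus_ge0 z : 0 <= modulus z.
Proof. exact: sqrtr_ge0. Qed.

Lemma sqr_modulusE z : modulus z ^+ 2 = sqr_modulus z.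
Proof. by rewrite sqr_sqrtr// sqr_modulus_ge0. Qed.

Lemma modulusM z w : modulus (z * w) = modulus z * modulus w.
Proof. by rewrite /modulus sqr_modulusM sqrtrM// sqr_modulus_ge0. Qed.

Lemma modulus_conj z : modulus z^*%C = modulus z.
Proof. by rewrite /modulus sqr_modulus_conj. Qed.

Lemma modulus_real (x : R) : modulus x%:C = `|x|.
Proof. by rewrite /modulus sqr_modulus_real sqrtr_sqr. Qed.

Lemma Re_le_modulus z : `|complex.Re z| <= modulus z.
Proof. by rewrite -sqrtr_sqr ler_wsqrtr// lerDl sqr_ge0. Qed.

Lemma Im_le_modulus z : `|complex.Im z| <= modulus z.
Proof. by rewrite -sqrtr_sqr ler_wsqrtr// lerDr sqr_ge0. Qed.

Lemma ReM z w : complex.Re (z * w) = complex.Re z * complex.Re w - complex.Im z * complex.Im w.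
Proof. by case: z w => [a b] [c d]. Qed.

Lemma ImM z w : complex.Im (z * w) = complex.Re z * complex.Im w + complex.Im z * complex.Re w.
Proof. by case: z w => [a b] [c d]. Qed.

Lemma ReD z w : complex.Re (z + w) = complex.Re z + complex.Re w.
Proof. by case: z w => [a b] [c d]. Qed.

Lemma ImD z w : complex.Im (z + w) = complex.Im z + complex.Im w.
Proof. by case: z w => [a b] [c d]. Qed.

Lemma ReN z : complex.Re (- z) = - complex.Re z. Proof. by case: z. Qed.
Lemma ImN z : complex.Im (- z) = - complex.Im z. Proof. by case: z. Qed.

Lemma Re_conj z : complex.Re z^*%C = complex.Re z. Proof. by case: z. Qed.
Lemma Im_conj z : complex.Im z^*%C = - complex.Im z. Proof. by case: z. Qed.

Lemma complex_eq z w : complex.Re z = complex.Re w -> complex.Im z = complex.Im w -> z = w.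
Proof. by case: z w => [a b] [c d] /= -> ->. Qed.

Lemma conjM z w : (z * w)^*%C = z^*%C * w^*%C.
Proof. by case: z w => [a b] [c d]; apply: complex_eq => /=; ring. Qed.

Lemma conj_real (x : R) : (x%:C)^*%C = x%:C.
Proof. by apply: complex_eq => //=; rewrite oppr0. Qed.

Section Generic.
Context d (T : measurableType d) (mu : {measure set T -> \bar R}).
Implicit Types F G : T -> R[i].

Definition cmeasurable F := measurable_fun [set: T] (fun x => complex.Re (F x)) /\
  measurable_fun [set: T] (fun x => complex.Im (F x)).

Lemma cmeasurableM F G : cmeasurable F -> cmeasurable G -> cmeasurable (fun x => F x * G x).
Proof.
move=> [F1 F2] [G1 G2]; split.
  under eq_fun do rewrite ReM.
  by apply: measurable_funB; exact: measurable_funM.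
under eq_fun do rewrite ImM.
by apply: measurable_funD; exact: measurable_funM.
Qed.

Lemma cmeasurableD F G : cmeasurable F -> cmeasurable G -> cmeasurable (fun x => F x + G x).
Proof.
move=> [F1 F2] [G1 G2]; split.
  by under eq_fun do rewrite ReD; exact: measurable_funD.
by under eq_fun do rewrite ImD; exact: measurable_funD.
Qed.

Lemma cmeasurable_conj F : cmeasurable F -> cmeasurable (fun x => (F x)^*%C).
Proof.
move=> [F1 F2]; split.
  by under eq_fun do rewrite Re_conj.
by under eq_fun do rewrite Im_conj; exact: measurableT_comp.
Qed.

Lemma cmeasurable_real (f : T -> R) : measurable_fun setT f -> cmeasurable (fun x => (f x)%:C).
Proof. by move=> mf; split => //=; exact: measurable_cst. Qed.

Lemma cmeasurable_cst z : cmeasurable (fun=> z).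
Proof. by split; exact: measurable_cst. Qed.

Lemma cmeasurable_sum (I : Type) (s : seq I) (F : I -> T -> R[i]) :
  (forall i, cmeasurable (F i)) -> cmeasurable (fun x => \sum_(i <- s) F i x).
Proof.
move=> mF; elim: s => [|i s IH].
  by under eq_fun do rewrite big_nil; exact: cmeasurable_cst.
by under eq_fun do rewrite big_cons; exact: cmeasurableD.
Qed.

Lemma measurable_sqr_modulus F : cmeasurable F -> measurable_fun setT (fun x => sqr_modulus (F x)).
Proof.
by move=> [F1 F2]; apply: measurable_funD; exact: measurable_funX.
Qed.

Lemma measurable_modulus F : cmeasurable F -> measurable_fun setT (fun x => modulus (F x)).
Proof.
move=> mF; apply: (measurableT_comp (_ : measurable_fun setT (@Num.sqrt R))).
  by apply: continuous_measurable_fun; exact: sqrt_continuous.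
exact: measurable_sqr_modulus.
Qed.

Local Notation cI := (cintegrable mu [set: T]).

Lemma cintegrable_le F (g : T -> R) : cmeasurable F -> mu.-integrable setT (EFin \o g) ->
  (forall x, modulus (F x) <= g x) -> cI F.
Proof.
move=> [F1 F2] Ig Fg; split; apply: rint_le Ig => // x _; apply: le_trans (ler_norm (g x));
  apply: le_trans (Fg x); [exact: Re_le_modulus|exact: Im_le_modulus].
Qed.

Lemma cintegrableD F G : cI F -> cI G -> cI (fun x => F x + G x).
Proof.
move=> [F1 F2] [G1 G2]; split.
  by under eq_fun do rewrite ReD; exact: rintD.
by under eq_fun do rewrite ImD; exact: rintD.
Qed.

Lemma cintegrable_conj F : cI F -> cI (fun x => (F x)^*%C).
Proof.
move=> [F1 F2]; split.
  by under eq_fun do rewrite Re_conj.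
by under eq_fun do rewrite Im_conj; exact: rintN.
Qed.

Lemma cintegrableZ z F : cI F -> cI (fun x => z * F x).
Proof.
move=> [F1 F2]; split.
  by under eq_fun do rewrite ReM; apply: rintB => //; exact: rintZl.
by under eq_fun do rewrite ImM; apply: rintD => //; exact: rintZl.
Qed.

Lemma cintegrable_sum (I : Type) (s : seq I) (F : I -> T -> R[i]) :
  (forall i, cI (F i)) -> cI (fun x => \sum_(i <- s) F i x).
Proof.
move=> mF; elim: s => [|i s IH].
  by under eq_fun do rewrite big_nil; split; exact: rint0.
by under eq_fun do rewrite big_cons; exact: cintegrableD.
Qed.

Local Notation ci := (cint mu [set: T]).

Lemma eq_cint A F G : (forall x, A x -> F x = G x) -> cint mu A F = cint mu A G.
Proof. by move=> FG; congr (_ +i* _); apply: eq_Rintegral => x; rewrite inE => Ax; rewrite FG. Qed.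

Lemma cintD F G : cI F -> cI G -> ci (fun x => F x + G x) = ci F + ci G.
Proof.
move=> [F1 F2] [G1 G2]; apply: complex_eq => /=.
  by under eq_Rintegral do rewrite ReD; rewrite RintegralD.
by under eq_Rintegral do rewrite ImD; rewrite RintegralD.
Qed.

Lemma cintZ z F : cI F -> ci (fun x => z * F x) = z * ci F.
Proof.
move=> [F1 F2]; case: z => a b; apply: complex_eq => /=.
  under eq_Rintegral do rewrite ReM /=; rewrite RintegralB//; [|exact: rintZl..].
  by rewrite !RintegralZl.
under eq_Rintegral do rewrite ImM /=; rewrite RintegralD//; [|exact: rintZl..].
by rewrite !RintegralZl.
Qed.

Lemma cint_conj F : cI F -> ci (fun x => (F x)^*%C) = (ci F)^*%C.
Proof.
move=> [F1 F2]; apply: complex_eq => /=.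
  by under eq_Rintegral do rewrite Re_conj.
under eq_Rintegral do rewrite Im_conj -mulN1r.
by rewrite RintegralZl// mulN1r.
Qed.

Lemma cintN F : cI F -> ci (fun x => - F x) = - ci F.
Proof.
move=> IF; rewrite -mulN1r -cintZ//; apply: eq_cint => x _.
by rewrite mulN1r.
Qed.

Lemma cint_sum (I : Type) (s : seq I) (F : I -> T -> R[i]) :
  (forall i, cI (F i)) -> ci (fun x => \sum_(i <- s) F i x) = \sum_(i <- s) ci (F i).
Proof.
move=> IF; elim: s => [|i s IH].
  rewrite big_nil; apply: complex_eq => /=;
  under eq_Rintegral do rewrite big_nil /=;
  by rewrite Rintegral_cst// mul0r.
rewrite big_cons -IH -cintD//; last exact: cintegrable_sum.
by apply: eq_cint => x _; rewrite big_cons.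
Qed.

Lemma cint_real A (f : T -> R) : cint mu A (fun x => (f x)%:C) = (\int[mu]_(x in A) f x)%:C.
Proof.
apply: complex_eq => //=.
by rewrite /Rintegral integral0.
Qed.

(** Extension by zero: L^2(K) is treated as a subspace of L^2(R^3), and the Hilbert space estimates
    are made in the whole space. *)
Definition restrict (A : set T) F : T -> R[i] := fun x => (\1_A x)%:C * F x.

Lemma cint_restrict A F : measurable A -> cint mu A F = ci (restrict A F).
Proof.
move=> mA; apply: complex_eq => /=; rewrite (Rintegral_indic mu A); apply: eq_Rintegral => x _.
  by rewrite ReM /= mul0r subr0.
by rewrite ImM /= mul0r addr0.
Qed.

Lemma memL2_restrict A F : measurable A -> memL2 mu A F -> memL2 mu setT (restrict A F).
Proof.
move=> mA [F1 F2 Foo].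
have RE (f : T -> R) : (fun x => \1_A x * f x) = f \_ A.
  by apply/funext => x; rewrite patchE indicE; case: ifP; rewrite ?mul1r ?mul0r.
split.
- rewrite (_ : (fun x => _) = (fun x => \1_A x * complex.Re (F x))).
    by rewrite RE; apply/(measurable_restrictT _ mA).
  by apply/funext => x; rewrite ReM /= mul0r subr0.
- rewrite (_ : (fun x => _) = (fun x => \1_A x * complex.Im (F x))).
    by rewrite RE; apply/(measurable_restrictT _ mA).
  by apply/funext => x; rewrite ImM /= mul0r addr0.
apply: le_lt_trans Foo; rewrite [leRHS]integral_mkcond le_eqVlt; apply/orP; left; apply/eqP.
apply: eq_integral => x _; rewrite sqr_modulusM sqr_modulus_real patchE indicE.
by case: ifP => _; rewrite ?expr1n ?mul1r// expr0n mul0r.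
Qed.

Lemma memL2_cmeasurable F : memL2 mu setT F -> cmeasurable F.
Proof. by case. Qed.

Lemma memL2P F : memL2 mu setT F <->
  cmeasurable F /\ mu.-integrable setT (EFin \o (fun x => sqr_modulus (F x))).
Proof.
split=> [[F1 F2 Foo]|[mF IF]].
  split; [by split|apply/integrableP; split].
    by apply/measurable_EFinP; apply: measurable_sqr_modulus.
  apply: le_lt_trans Foo; rewrite le_eqVlt; apply/orP; left; apply/eqP; apply: eq_integral => x _ /=.
  by rewrite ger0_norm// sqr_modulus_ge0.
split; [exact: mF.1|exact: mF.2|].
have [_] := integrableP _ _ _ IF; apply: le_lt_trans.
rewrite le_eqVlt; apply/orP; left; apply/eqP; apply: eq_integral => x _ /=.
by rewrite ger0_norm// sqr_modulus_ge0.
Qed.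

Lemma memL2_le F (g : T -> R) : cmeasurable F -> mu.-integrable setT (EFin \o g) ->
  (forall x, sqr_modulus (F x) <= g x) -> memL2 mu setT F.
Proof.
move=> mF Ig Fg; apply/memL2P; split => //; apply: rint_le Ig => //; first exact: measurable_sqr_modulus.
by move=> x _; rewrite ger0_norm ?sqr_modulus_ge0// (le_trans (Fg x))// ler_norm.
Qed.

Lemma memL2D F G : memL2 mu setT F -> memL2 mu setT G -> memL2 mu setT (fun x => F x + G x).
Proof.
move=> /memL2P[mF IF] /memL2P[mG IG].
apply: (memL2_le (cmeasurableD mF mG) (rintD measurableT (rintZl measurableT 2 IF) (rintZl measurableT 2 IG))) => x.
case: (F x) (G x) => [a b] [a' b']; rewrite /sqr_modulus /=.
have := sqr_ge0 (a - a'); have := sqr_ge0 (b - b'); nra.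
Qed.

Lemma memL2_sum (I : Type) (s : seq I) (F : I -> T -> R[i]) :
  (forall i, memL2 mu setT (F i)) -> memL2 mu setT (fun x => \sum_(i <- s) F i x).
Proof.
move=> LF; elim: s => [|i s IH].
  apply/memL2P; split.
    by under eq_fun do rewrite big_nil; exact: cmeasurable_cst.
  rewrite (_ : EFin \o _ = EFin \o fun=> 0); first exact: rint0.
  by apply/funext => x /=; rewrite big_nil sqr_modulus_real expr0n.
by under eq_fun do rewrite big_cons; exact: memL2D.
Qed.

Lemma memL2_conj F : memL2 mu setT F -> memL2 mu setT (fun x => (F x)^*%C).
Proof.
move=> /memL2P[mF IF]; apply: (memL2_le (cmeasurable_conj mF) IF) => x.
by rewrite sqr_modulus_conj.
Qed.

Lemma memL2Z z F : memL2 mu setT F -> memL2 mu setT (fun x => z * F x).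
Proof.
move=> /memL2P[mF IF].
apply: (memL2_le (cmeasurableM (cmeasurable_cst z) mF) (rintZl measurableT (sqr_modulus z) IF)) => x.
by rewrite sqr_modulusM.
Qed.

Lemma cintegrable_mul F G : memL2 mu setT F -> memL2 mu setT G -> cI (fun x => F x * G x).
Proof.
move=> /memL2P[mF IF] /memL2P[mG IG].
apply: (cintegrable_le (cmeasurableM mF mG) (rintD measurableT IF IG)) => x.
rewrite modulusM -!sqr_modulusE.
have := sqr_ge0 (modulus (F x) - modulus (G x)); have := modulus_ge0 (F x); have := modulus_ge0 (G x); nra.
Qed.

End Generic.

Section ComplexFubini.
Context d1 d2 (T1 : measurableType d1) (T2 : measurableType d2).
Variables (m1 : {sigma_finite_measure set T1 -> \bar R}).
Variables (m2 : {sigma_finite_measure set T2 -> \bar R}).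
Implicit Types F : T1 * T2 -> R[i].

Lemma cmeasurable_slice1 F y : cmeasurable F -> cmeasurable (fun x => F (x, y)).
Proof. by move=> [F1 F2]; split; [exact: (measurable_fun_pair1 y F1)|exact: (measurable_fun_pair1 y F2)]. Qed.

Lemma cmeasurable_slice2 F x : cmeasurable F -> cmeasurable (fun y => F (x, y)).
Proof. by move=> [F1 F2]; split; [exact: (measurable_fun_pair2 x F1)|exact: (measurable_fun_pair2 x F2)]. Qed.

Lemma cmeasurable_cint F : cmeasurable F -> cmeasurable (fun x => cint m2 setT (fun y => F (x, y))).
Proof.
move=> [F1 F2]; split => /=; [exact: (measurable_Rintegral_param m2 F1)|exact: (measurable_Rintegral_param m2 F2)].
Qed.

Lemma cfubini1 F : cintegrable (m1 \x m2)%E setT F ->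
  cint (m1 \x m2)%E setT F = cint m1 setT (fun x => cint m2 setT (fun y => F (x, y))).
Proof. by move=> [F1 F2]; congr (_ +i* _); [exact: (Rfubini1 F1)|exact: (Rfubini1 F2)]. Qed.

Lemma cfubini2 F : cintegrable (m1 \x m2)%E setT F ->
  cint (m1 \x m2)%E setT F = cint m2 setT (fun y => cint m1 setT (fun x => F (x, y))).
Proof. by move=> [F1 F2]; congr (_ +i* _); [exact: (Rfubini2 F1)|exact: (Rfubini2 F2)]. Qed.

Lemma cintegrable_marginal F : cintegrable (m1 \x m2)%E setT F ->
  cintegrable m1 setT (fun x => cint m2 setT (fun y => F (x, y))).
Proof. by move=> [F1 F2]; split; [exact: (rint_fubini1 F1)|exact: (rint_fubini1 F2)]. Qed.

Lemma cintegrable_tensor (f : T1 -> R[i]) (g : T2 -> R[i]) :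
  cintegrable m1 setT f -> cintegrable m2 setT g ->
  cintegrable (m1 \x m2)%E setT (fun p => f p.1 * g p.2).
Proof.
move=> [f1 f2] [g1 g2]; split.
  by under eq_fun do rewrite ReM; apply: rintB => //; [exact: (rint_tensor f1 g1)|exact: (rint_tensor f2 g2)].
by under eq_fun do rewrite ImM; apply: rintD => //; [exact: (rint_tensor f1 g2)|exact: (rint_tensor f2 g1)].
Qed.

Lemma cint_tensor (f : T1 -> R[i]) (g : T2 -> R[i]) :
  cintegrable m1 setT f -> cintegrable m2 setT g ->
  cint (m1 \x m2)%E setT (fun p => f p.1 * g p.2) = cint m1 setT f * cint m2 setT g.
Proof.
move=> If Ig; rewrite cfubini1; last exact: cintegrable_tensor.
rewrite [RHS]mulrC -cintZ//; apply: eq_cint => x _ /=.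
by rewrite cintZ// mulrC.
Qed.

End ComplexFubini.
End ComplexIntegration.

(** * The Hilbert space L^2(R^3) *)

Section HilbertSpace.
Local Open Scope complex_scope.
Variable R : realType.
Local Notation R3 := (R3 R).
Local Notation R6 := (R6 R).
Local Notation mu3 := (mu3 R).
Local Notation mu6 := (mu6 R).
Local Notation L2 := (memL2 mu3 [set: R3]).
Local Notation L6 := (memL2 mu6 [set: R6]).
Local Notation inn := (inner [set: R3]).
Implicit Types (f g e : R3 -> R[i]) (K : set R3) (B : R6 -> R[i]).

Definition norm2 f : R := \int[mu3]_r sqr_modulus (f r).

Lemma norm2_ge0 f : 0 <= norm2 f.
Proof. by apply: Rintegral_ge0 => x _; exact: sqr_modulus_ge0. Qed.

Lemma cintegrable_inner e f : L2 e -> L2 f -> cintegrable mu3 setT (fun r => (e r)^*%C * f r).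
Proof. by move=> Le Lf; apply: cintegrable_mul => //; exact: memL2_conj. Qed.

Lemma inner_conj e f : L2 e -> L2 f -> inn f e = (inn e f)^*%C.
Proof.
move=> Le Lf; rewrite /inner -(cint_conj (cintegrable_inner Le Lf)); apply: eq_cint => r _.
by rewrite conjM conjcK mulrC.
Qed.

Lemma memL2_axpy f e c : L2 f -> L2 e -> L2 (fun r => f r - c * e r).
Proof.
move=> Lf Le; have := memL2D Lf (memL2Z (- c) Le).
by congr memL2; apply/funext => r; rewrite mulNr.
Qed.

Lemma inner_axpy e f g c : L2 e -> L2 f -> L2 g ->
  inn e (fun r => f r - c * g r) = inn e f - c * inn e g.
Proof.
move=> Le Lf Lg; have I1 := cintegrable_inner Le Lf; have I2 := cintegrable_inner Le Lg.
rewrite -mulNr /inner -cintZ// -cintD//; last exact: cintegrableZ.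
by apply: eq_cint => r _; ring.
Qed.

Lemma norm2_axpy f e c : L2 f -> L2 e -> norm2 (fun r => f r - c * e r) =
  norm2 f - 2 * complex.Re (c^*%C * inn e f) + sqr_modulus c * norm2 e.
Proof.
move=> Lf Le; have [_ If] := (memL2P _ _).1 Lf; have [_ Ie] := (memL2P _ _).1 Le.
have I1 := cintegrable_inner Le Lf; have [I2 _] := cintegrableZ (c^*%C) I1.
rewrite /inner -(cintZ (c^*%C) I1) /= /norm2 -!RintegralZl// -RintegralB//; last exact: rintZl.
rewrite -RintegralD//; [|by apply: rintB => //; exact: rintZl|exact: rintZl].
apply: eq_Rintegral => r _; case: (f r) (e r) c {I2} => [a b] [a' b'] [x y].
by rewrite /sqr_modulus /=; ring.
Qed.

(** The squared norm of f - t <e, f> e is a nonnegative quadratic polynomial in the real number t,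
    evaluated at t = 1 / ||e||^2. For ||e|| = 0 it is affine in t and would become negative unless
    <e, f> = 0. *)
Lemma cauchy_schwarz e f : L2 e -> L2 f -> sqr_modulus (inn e f) <= norm2 e * norm2 f.
Proof.
move=> Le Lf; set z := inn e f; set s := sqr_modulus z; have s0 : 0 <= s by exact: sqr_modulus_ge0.
have E (t : R) : 0 <= norm2 f - 2 * t * s + t ^+ 2 * s * norm2 e.
  have := norm2_ge0 (fun r => f r - (t%:C * z) * e r).
  rewrite norm2_axpy// -/z sqr_modulusM sqr_modulus_real conjM conj_real -mulrA mulConj -/s.
  by rewrite ReM /= mul0r subr0 mulrA.
have e0 := norm2_ge0 e; have f0 := norm2_ge0 f.
move: e0; rewrite le_eqVlt => /orP[/eqP e0|e0].
  rewrite -e0 mul0r leNgt; apply/negP => sp.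
  have := E ((norm2 f + 1) / s); rewrite -e0 mulr0 addr0 -mulrA mulfVK ?gt_eqF//; lra.
have := E (norm2 e)^-1; rewrite [_ ^+ 2 * s]mulrC expr2 -!mulrA mulVf ?gt_eqF// mulr1.
rewrite -[s <= _](ler_pM2l (x := (norm2 e)^-1)) ?invr_gt0// mulKf ?gt_eqF//; nra.
Qed.

Lemma restrictM K f g r : (restrict K f r)^*%C * restrict K g r = restrict K (fun r => (f r)^*%C * g r) r.
Proof.
rewrite /restrict indicE; case: (r \in K); first by rewrite !mul1r.
by rewrite !mul0r rmorph0 mul0r.
Qed.

Lemma inner_restrict K f g : measurable K ->
  inner K f g = inn (restrict K f) (restrict K g).
Proof. by move=> mK; rewrite /inner cint_restrict//; apply: eq_cint => r _; rewrite restrictM. Qed.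

Lemma norm2_restrict K f : measurable K ->
  norm2 (restrict K f) = \int[mu3]_(r in K) sqr_modulus (f r).
Proof.
move=> mK; rewrite (Rintegral_indic mu3 K); apply: eq_Rintegral => r _.
by rewrite sqr_modulusM sqr_modulus_real indicE; case: (_ \in _); rewrite ?expr1n ?expr0n.
Qed.

Section Parseval.
Variables (K : set R3) (e : nat -> R3 -> R[i]).
Hypotheses (mK : measurable K) (onb : orthonormal_basis K e).

Let e' k := restrict K (e k).
Let Le k : L2 (e' k). Proof. by apply: memL2_restrict => //; case: onb. Qed.
Let ortho k l : inn (e' k) (e' l) = (k == l)%:R.
Proof. by rewrite /e' -inner_restrict//; case: onb. Qed.
Let enorm k : norm2 (e' k) = 1.
Proof.
have := ortho k k; rewrite eqxx => /(congr1 (@complex.Re R)) /= <-.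
by apply: eq_Rintegral => r _; rewrite mulConj.
Qed.

(** The induction carries the inner products of the remainder with the later basis vectors: they are
    still the coefficients of [f], which identifies the next term to subtract. *)
Lemma bessel f n : memL2 mu3 K f ->
  let r := fun x => restrict K f x - \sum_(k < n) inner K (e k) f * e' k x in
  [/\ L2 r, forall m, (n <= m)%N -> inn (e' m) r = inner K (e m) f &
    norm2 r = norm2 (restrict K f) - \sum_(k < n) sqr_modulus (inner K (e k) f)].
Proof.
move=> LKf; have Lf := memL2_restrict mK LKf.
elim: n => [|n [Lr ip nr]] /=.
  have -> : (fun x => restrict K f x - \sum_(k < 0) inner K (e k) f * e' k x) = restrict K f.
    by apply/funext => x; rewrite big_ord0 subr0.
  by split => //; [move=> m _; rewrite -inner_restrict|rewrite big_ord0 subr0].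
set c := fun k => inner K (e k) f in Lr ip nr *.
have -> : (fun x => restrict K f x - \sum_(k < n.+1) c k * e' k x) =
    (fun x => (restrict K f x - \sum_(k < n) c k * e' k x) - c n * e' n x).
  by apply/funext => x; rewrite big_ord_recr /= opprD addrA.
split; first exact: memL2_axpy.
  move=> m nm; rewrite inner_axpy// ip ?(ltnW nm)// ortho gtn_eqF// mulr0 subr0//.
rewrite norm2_axpy// ip// enorm mulConj /= mulr1 nr big_ord_recr /=; ring.
Qed.

Lemma parseval f : memL2 mu3 K f ->
  (fun n => \sum_(k < n) sqr_modulus (inner K (e k) f)) @ \oo --> \int[mu3]_(r in K) sqr_modulus (f r).
Proof.
move=> LKf; have [_ _ /(_ f LKf) cv] := onb.
rewrite -norm2_restrict// -[X in _ --> X]subr0.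
have -> : (fun n => \sum_(k < n) sqr_modulus (inner K (e k) f)) =
    (fun n => norm2 (restrict K f) - \int[mu3]_(r in K)
           sqr_modulus (f r - \sum_(k < n) inner K (e k) f * e k r)).
  apply/funext => n; have [_ _ nr] := bessel n LKf.
  rewrite -norm2_restrict// -[X in _ - X](_ : norm2 (fun x => restrict K f x - \sum_(k < n) inner K (e k) f * e' k x) = _).
    by rewrite nr opprB addrC subrK.
  congr norm2; apply/funext => x; rewrite [RHS]mulrBr mulr_sumr; congr (_ - _).
  by apply: eq_bigr => k _; rewrite /e' /restrict mulrCA.
by apply: cvgB => //; exact: cvg_cst.
Qed.

Lemma parseval_ereal f : memL2 mu3 K f ->
  (\sum_(0 <= k <oo) (sqr_modulus (inner K (e k) f))%:E = (\int[mu3]_(r in K) sqr_modulus (f r))%:E)%E.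
Proof.
move=> LKf; apply/cvg_lim => //.
have -> : (fun n => \sum_(0 <= k < n) (sqr_modulus (inner K (e k) f))%:E)%E =
   EFin \o (fun n => \sum_(k < n) sqr_modulus (inner K (e k) f)).
  by apply/funext => n /=; rewrite big_mkord sumEFin.
by apply: cvg_EFin; [exact: nearW|exact: parseval].
Qed.

End Parseval.

Lemma memL2_subset d (T : measurableType d) (mu : {measure set T -> \bar R}) (A : set T) (F : T -> R[i]) :
  measurable A -> memL2 mu setT F -> memL2 mu A F.
Proof.
move=> mA [F1 F2 Foo]; split; [exact: measurable_funS F1|exact: measurable_funS F2|].
apply: le_lt_trans Foo; apply: ge0_subset_integral => //.
  by apply/measurable_EFinP; apply: (measurable_sqr_modulus (conj F1 F2)).
by move=> x _; rewrite lee_fin sqr_modulus_ge0.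
Qed.

Lemma kapply_restrict K B f : measurable K -> kapply K B f = kapply setT B (restrict K f).
Proof.
move=> mK; apply/funext => r; rewrite /kapply cint_restrict//; apply: eq_cint => s _.
by rewrite /restrict mulrCA.
Qed.

Lemma kform_restrict K B f : measurable K -> kform K B f = kform setT B (restrict K f).
Proof.
move=> mK; rewrite /kform setXTT cint_restrict; last exact: measurableX.
apply: eq_cint => -[r s] _; rewrite /restrict /= !indicE in_setX conjM conj_real.
case: (r \in K); case: (s \in K); rewrite /= ?mul1r//; ring.
Qed.

Lemma memL2_tensor (f g : R3 -> R[i]) : L2 f -> L2 g -> L6 (fun p : R6 => f p.1 * g p.2).
Proof.
move=> /memL2P[mf If] /memL2P[mg Ig]; apply: (memL2_le _ (rint_tensor If Ig)) => [|p].
  case: mf mg => [f1 f2] [g1 g2]; apply: cmeasurableM.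
    by split; [exact: (measurableT_comp f1 measurable_fst)|exact: (measurableT_comp f2 measurable_fst)].
  by split; [exact: (measurableT_comp g1 measurable_snd)|exact: (measurableT_comp g2 measurable_snd)].
by rewrite sqr_modulusM.
Qed.

Lemma cintegrable_kform B f : L6 B -> L2 f ->
  cintegrable mu6 setT (fun p : R6 => (f p.1)^*%C * B p * f p.2).
Proof.
move=> LB Lf; have := cintegrable_mul LB (memL2_tensor (memL2_conj Lf) Lf).
by congr cintegrable; apply/funext => p; ring.
Qed.

(** With every slice of [B] square integrable the integral in [kapply] converges at each r, so that
    Fubini links it to the form without exceptional points. *)
Lemma inner_kapply K B f : measurable K -> L6 B -> (forall r, L2 (fun s => B (r, s))) ->
  memL2 mu3 K f -> inner K f (kapply K B f) = kform K B f.
Proof.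
move=> mK LB LBr LKf; have Lf := memL2_restrict mK LKf.
rewrite kform_restrict// /kform setXTT (cfubini1 (cintegrable_kform LB Lf)).
rewrite /inner cint_restrict//; apply: eq_cint => r _.
rewrite -restrictM /restrict -[_%:C * kapply _ _ _ _]/(restrict K (kapply K B f) r).
rewrite [in LHS]/restrict kapply_restrict// mulrCA -cintZ; last first.
  by apply: cintegrable_mul => //.
rewrite -cintZ; last by apply: cintegrableZ; apply: cintegrable_mul.
apply: eq_cint => s _ /=; rewrite /restrict indicE conjM conj_real.
by case: (r \in K); rewrite ?mul1r ?mul0r// mulrA.
Qed.

End HilbertSpace.

(** * Kernels of the form G^dagger * G *)

Lemma rint_swap d1 d2 (T1 : measurableType d1) (T2 : measurableType d2) (R : realType)
  (m1 : {sigma_finite_measure set T1 -> \bar R})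
  (m2 : {sigma_finite_measure set T2 -> \bar R}) (F : T1 * T2 -> R) :
  (m1 \x m2)%E.-integrable setT (EFin \o F) ->
  (m2 \x m1)%E.-integrable setT (EFin \o (fun q => F (q.2, q.1))).
Proof.
move=> IF; have mF : measurable_fun setT (EFin \o F) by exact: measurable_int IF.
have mS : measurable_fun setT (EFin \o (fun q : T2 * T1 => F (q.2, q.1))).
  exact: (measurableT_comp mF (@measurable_swap _ _ T2 T1)).
apply/(integrable21ltyP m2 m1 mS).
by have /(integrable12ltyP m1 m2 mF) := IF.
Qed.

Section GramKernels.
Local Open Scope complex_scope.
Variable R : realType.
Local Notation R3 := (R3 R).
Local Notation R6 := (R6 R).
Local Notation mu3 := (mu3 R).
Local Notation mu6 := (mu6 R).
Local Notation L2 := (memL2 mu3 [set: R3]).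
Local Notation L6 := (memL2 mu6 [set: R6]).
Local Notation inn := (inner [set: R3]).
Implicit Types (f : R3 -> R[i]) (K : set R3) (A B g : R6 -> R[i]).

(* With slices in L^2 everywhere, and not just almost everywhere, [gram] below is
   hermitian and satisfies Cauchy-Schwarz at every point. *)
Definition sliceL2 A : Prop :=
  [/\ cmeasurable A, forall u, L2 (fun r => A (u, r)), forall r, L2 (fun u => A (u, r)) & L6 A].

(** For the factor of a density matrix this is the density. *)
Definition col2 A r : R := norm2 (fun u => A (u, r)).
Definition row2 A u : R := norm2 (fun r => A (u, r)).

Lemma sliceL2_int A : sliceL2 A -> mu6.-integrable setT (EFin \o (fun p => sqr_modulus (A p))).
Proof. by case=> _ _ _ /memL2P[]. Qed.

Lemma row2_int A : sliceL2 A -> mu3.-integrable setT (EFin \o row2 A).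
Proof. by move=> /sliceL2_int; exact: (@rint_fubini1 _ _ R3 R3 R mu3 mu3 (fun p => sqr_modulus (A p))). Qed.

Lemma total_row2 A : sliceL2 A -> \int[mu6]_p sqr_modulus (A p) = \int[mu3]_u row2 A u.
Proof. by move=> /sliceL2_int; exact: (@Rfubini1 _ _ R3 R3 R mu3 mu3 (fun p => sqr_modulus (A p))). Qed.

Lemma total_col2 A : sliceL2 A -> \int[mu6]_p sqr_modulus (A p) = \int[mu3]_r col2 A r.
Proof. by move=> /sliceL2_int; exact: (@Rfubini2 _ _ R3 R3 R mu3 mu3 (fun p => sqr_modulus (A p))). Qed.

Lemma col2_int A : sliceL2 A -> mu3.-integrable setT (EFin \o col2 A).
Proof.
move=> /sliceL2_int IA.
exact: (@rint_fubini1 _ _ R3 R3 R mu3 mu3 (fun q => sqr_modulus (A (q.2, q.1)))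
  (@rint_swap _ _ R3 R3 R mu3 mu3 (fun p => sqr_modulus (A p)) IA)).
Qed.

Definition gram A B : R6 -> R[i] := kprod setT (kadj A) B.

Lemma gramE A B p : gram A B p = inn (fun u => A (u, p.1)) (fun u => B (u, p.2)).
Proof. by []. Qed.

Lemma gram_hermitian A : sliceL2 A -> kadj (gram A A) = gram A A.
Proof. by move=> [_ _ Ar _]; apply/funext => -[r s]; rewrite /kadj !gramE -inner_conj. Qed.

Lemma gram_le A B p : sliceL2 A -> sliceL2 B ->
  sqr_modulus (gram A B p) <= col2 A p.1 * col2 B p.2.
Proof. by move=> [_ _ Ar _] [_ _ Br _]; rewrite gramE; exact: cauchy_schwarz. Qed.

Lemma gram_cmeasurable A B : sliceL2 A -> sliceL2 B -> cmeasurable (gram A B).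
Proof.
move=> [mA _ _ _] [mB _ _ _].
apply: (@cmeasurable_cint R _ _ R6 R3 mu3 (fun q => (A (q.2, q.1.1))^*%C * B (q.2, q.1.2))).
have m1 : measurable_fun [set: R6 * R3] (fun q : R6 * R3 => (q.2, q.1.1)).
  apply: measurable_fun_pair; first exact: measurable_snd.
  exact: (measurableT_comp measurable_fst measurable_fst).
have m2 : measurable_fun [set: R6 * R3] (fun q : R6 * R3 => (q.2, q.1.2)).
  apply: measurable_fun_pair; first exact: measurable_snd.
  exact: (measurableT_comp measurable_snd measurable_fst).
case: mA mB => [A1 A2] [B1 B2]; apply: cmeasurableM.
  by apply: cmeasurable_conj; split; [exact: (measurableT_comp A1 m1)|exact: (measurableT_comp A2 m1)].
by split; [exact: (measurableT_comp B1 m2)|exact: (measurableT_comp B2 m2)].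
Qed.

Lemma gram_memL2 A B : sliceL2 A -> sliceL2 B -> L6 (gram A B).
Proof.
move=> SA SB; apply: (memL2_le (gram_cmeasurable SA SB) (rint_tensor (col2_int SA) (col2_int SB))) => p.
exact: gram_le.
Qed.

Lemma gram_slice A B r : sliceL2 A -> sliceL2 B -> L2 (fun s => gram A B (r, s)).
Proof.
move=> SA SB; have mG := gram_cmeasurable SA SB.
apply: (memL2_le (cmeasurable_slice2 r mG) (rintZl measurableT (col2 A r) (col2_int SB))) => s.
exact: gram_le.
Qed.

Section Fubini.
Variables (A B : R6 -> R[i]) (psi : R6 -> R[i]) (b : R3 -> R).
Hypotheses (SA : sliceL2 A) (SB : sliceL2 B) (mpsi : cmeasurable psi).
Hypotheses (mb : measurable_fun setT b) (b0 : forall r, 0 <= b r).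
Hypothesis (Ib : mu3.-integrable setT (EFin \o (fun r => b r ^+ 2))).
Hypothesis (psib : forall p, modulus (psi p) <= b p.1 * b p.2).

Let F (q : R3 * R6) : R[i] := (A (q.1, q.2.1))^*%C * B (q.1, q.2.2) * psi q.2.
Let m1 : measurable_fun [set: R3 * R6] (fun q : R3 * R6 => (q.1, q.2.1)).
Proof.
apply: measurable_fun_pair; first exact: measurable_fst.
exact: (measurableT_comp measurable_fst measurable_snd).
Qed.
Let m2 : measurable_fun [set: R3 * R6] (fun q : R3 * R6 => (q.1, q.2.2)).
Proof.
apply: measurable_fun_pair; first exact: measurable_fst.
exact: (measurableT_comp measurable_snd measurable_snd).
Qed.

(** Tonelli: at fixed u the mass of [W] in p is [row2 C u] times a constant, and [row2 C] is
    integrable. *)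
Let dom C (SC : sliceL2 C) (W : R3 * R6 -> R) : measurable_fun setT W -> (forall q, 0 <= W q) ->
  (forall u, mu6.-integrable setT (fun p => (W (u, p))%:E) /\
     \int[mu6]_p W (u, p) = row2 C u * \int[mu3]_s (b s ^+ 2)) ->
  (mu3 \x mu6)%E.-integrable setT (EFin \o W).
Proof.
move=> mW W0 H; apply: rint_ge0_tonelli => //.
have I1 := rintZr measurableT (\int[mu3]_s (b s ^+ 2)) (row2_int SC).
have [_] := integrableP _ _ _ I1; apply: le_lt_trans.
rewrite le_eqVlt; apply/orP; left; apply/eqP; apply: eq_integral => u _.
have [Iu Eu] := H u.
rewrite [RHS](_ : _ = `|\int[mu6]_p W (u, p)|%:E); last by rewrite Eu.
rewrite ger0_norm; last by apply: Rintegral_ge0 => p _; exact: W0.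
by rewrite /Rintegral fineK//; exact: (integrable_fin_num measurableT Iu).
Qed.

Let W1 (q : R3 * R6) := sqr_modulus (A (q.1, q.2.1)) * b q.2.2 ^+ 2.
Let W2 (q : R3 * R6) := b q.2.1 ^+ 2 * sqr_modulus (B (q.1, q.2.2)).

Let IW1 : (mu3 \x mu6)%E.-integrable setT (EFin \o W1).
Proof.
have [mA Au _ _] := SA; apply: (dom SA).
- apply: measurable_funM; first exact: (measurableT_comp (measurable_sqr_modulus mA) m1).
  apply: measurable_funX; exact: (measurableT_comp mb (measurableT_comp measurable_snd measurable_snd)).
- by move=> q; rewrite mulr_ge0// ?sqr_modulus_ge0// sqr_ge0.
move=> u; have [_ Iu] := (memL2P _ _).1 (Au u); have IT := rint_tensor Iu Ib.
split; first exact: IT.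
rewrite (Rfubini1 IT) /W1 /=.
under eq_Rintegral do rewrite RintegralZl//.
by rewrite RintegralZr.
Qed.

Let IW2 : (mu3 \x mu6)%E.-integrable setT (EFin \o W2).
Proof.
have [mB Bu _ _] := SB; apply: (dom SB).
- apply: measurable_funM; last exact: (measurableT_comp (measurable_sqr_modulus mB) m2).
  apply: measurable_funX; exact: (measurableT_comp mb (measurableT_comp measurable_fst measurable_snd)).
- by move=> q; rewrite mulr_ge0// ?sqr_modulus_ge0// sqr_ge0.
move=> u; have [_ Iu] := (memL2P _ _).1 (Bu u); have IT := rint_tensor Ib Iu.
split; first exact: IT.
rewrite (Rfubini1 IT) /W2 /=.
under eq_Rintegral do rewrite RintegralZl//.
by rewrite RintegralZr// mulrC.
Qed.

(* AM-GM on [|A(u,r)| b(s)] and [|B(u,s)| b(r)] gives an integrable majorant. *)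
Lemma gram_integrable : cintegrable (mu3 \x mu6)%E setT F.
Proof.
have [[A1 A2] _ _ _] := SA; have [[B1 B2] _ _ _] := SB; have [p1 p2] := mpsi.
apply: (cintegrable_le _ (rintD measurableT IW1 IW2)).
  apply: cmeasurableM; [apply: cmeasurableM|].
  - by apply: cmeasurable_conj; split; [exact: (measurableT_comp A1 m1)|exact: (measurableT_comp A2 m1)].
  - by split; [exact: (measurableT_comp B1 m2)|exact: (measurableT_comp B2 m2)].
  by split; [exact: (measurableT_comp p1 measurable_snd)|exact: (measurableT_comp p2 measurable_snd)].
move=> [u [r s]]; rewrite /F /W1 /W2 !modulusM modulus_conj /= -!sqr_modulusE.
have h := psib (r, s); rewrite /= in h.
have [a0 c0] := (modulus_ge0 (A (u, r)), modulus_ge0 (B (u, s))).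
apply: le_trans (ler_wpM2l (mulr_ge0 a0 c0) h) _.
have := sqr_ge0 (modulus (A (u, r)) * b s - modulus (B (u, s)) * b r).
have : 0 <= (modulus (A (u, r)) * b s) * (modulus (B (u, s)) * b r).
  by rewrite !mulr_ge0.
nra.
Qed.

(** Serves both for psi(r, s) = conj f(r) f(s), which yields the quadratic form, and for test
    functions, which yield weak derivatives. In either case psi is dominated by b(r) b(s) with b
    square integrable. *)
Lemma gram_fubini : cint mu6 setT (fun p => gram A B p * psi p) =
  cint mu3 setT (fun u => cint mu6 setT (fun p : R6 => (A (u, p.1))^*%C * B (u, p.2) * psi p)).
Proof.
rewrite -[RHS](cfubini1 gram_integrable) (cfubini2 gram_integrable); apply: eq_cint => p _.
have [_ _ Ar _] := SA; have [_ _ Br _] := SB.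
rewrite mulrC gramE -cintZ; last exact: cintegrable_inner.
by apply: eq_cint => u _; rewrite mulrC.
Qed.

End Fubini.

Lemma kapply_slice A f u : sliceL2 A -> L2 f -> cintegrable mu3 setT (fun s => A (u, s) * f s).
Proof. by move=> [_ Au _ _] Lf; exact: cintegrable_mul. Qed.

(** For fixed u the integral over (r, s) splits into the integral of A(u, s) f(s) and its conjugate,
    so the form is the squared norm of A f. *)
Lemma kform_gram A f : sliceL2 A -> L2 f ->
  kform setT (gram A A) f = (\int[mu3]_u sqr_modulus (kapply setT A f u))%:C.
Proof.
move=> SA Lf; have [mf If] := (memL2P _ _).1 Lf.
have mpsi : @cmeasurable R _ R6 (fun p => (f p.1)^*%C * f p.2).
  exact: (memL2_cmeasurable (memL2_tensor (memL2_conj Lf) Lf)).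
transitivity (cint mu6 setT (fun p => gram A A p * ((f p.1)^*%C * f p.2))).
  by rewrite /kform setXTT; apply: eq_cint => p _; ring.
rewrite (@gram_fubini A A (fun p => (f p.1)^*%C * f p.2) (fun r => modulus (f r)) SA SA mpsi).
- rewrite -cint_real; apply: eq_cint => u _.
  have Iu := kapply_slice u SA Lf.
  rewrite -mulConj /kapply -(cint_conj Iu) -cint_tensor//; last exact: cintegrable_conj.
  by apply: eq_cint => p _; rewrite conjM; ring.
- exact: measurable_modulus.
- by move=> r; exact: modulus_ge0.
- by under eq_fun do rewrite /= sqr_modulusE.
- by move=> p; rewrite modulusM modulus_conj.
Qed.

Lemma kapply_memL2 A f : sliceL2 A -> L2 f ->
  mu3.-integrable setT (EFin \o (fun u => sqr_modulus (kapply setT A f u))).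
Proof.
move=> SA Lf; have [mA Au Ar LA] := SA; have [mf If] := (memL2P _ _).1 Lf.
have mT : cmeasurable (kapply setT A f).
  apply: (@cmeasurable_cint R _ _ R3 R3 mu3 (fun q => A q * f q.2)).
  apply: cmeasurableM => //; case: mf => f1 f2.
  by split; [exact: (measurableT_comp f1 measurable_snd)|exact: (measurableT_comp f2 measurable_snd)].
apply: (rint_le measurableT _ _ (rintZr measurableT (norm2 f) (row2_int SA))).
  exact: measurable_sqr_modulus.
move=> u _; rewrite !ger0_norm ?sqr_modulus_ge0 ?mulr_ge0 ?norm2_ge0//.
have := cauchy_schwarz (memL2_conj (Au u)) Lf.
rewrite /inner /kapply; under [cint _ _ _]eq_cint do rewrite conjcK.
congr (_ <= _ * _); congr (Rintegral _ _ _); apply/funext => r.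
by rewrite sqr_modulus_conj.
Qed.

Section Family.
Variables (m : nat) (g : 'I_m -> R6 -> R[i]).
Hypothesis Sg : forall a, sliceL2 (g a).
(** One member gives the density matrix itself, three give its derivative nabla_1 . nabla_2. *)
Let B : R6 -> R[i] := fun p => \sum_(a < m) gram (g a) (g a) p.

Lemma gsum_memL2 : L6 B.
Proof. by apply: memL2_sum => a; exact: gram_memL2. Qed.

Lemma gsum_slice r : L2 (fun s => B (r, s)).
Proof.
apply: (@memL2_sum R _ _ mu3 _ _ (fun a s => gram (g a) (g a) (r, s))) => a.
exact: gram_slice (Sg a) (Sg a).
Qed.

Lemma gsum_hermitian : kadj B = B.
Proof.
apply/funext => p; rewrite /kadj /B [LHS](_ : _ = \sum_(a < m) kadj (gram (g a) (g a)) p).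
  by apply: eq_bigr => a _; rewrite gram_hermitian.
by rewrite /kadj; elim/big_rec2: _ => [|a x y _ <-]; apply: complex_eq; rewrite /= ?ReD ?ImD /= ?oppr0// ?Re_conj ?Im_conj ?ReD ?ImD// opprD.
Qed.

Lemma kform_gsum K f : measurable K -> memL2 mu3 K f ->
  kform K B f = (\sum_(a < m) \int[mu3]_u sqr_modulus (kapply K (g a) f u))%:C.
Proof.
move=> mK LKf; have Lf := memL2_restrict mK LKf; rewrite kform_restrict//.
transitivity (\sum_(a < m) kform setT (gram (g a) (g a)) (restrict K f)).
  rewrite /kform setXTT -cint_sum => [|a]; last exact: cintegrable_kform (gram_memL2 _ _) Lf.
  by apply: eq_cint => p _; rewrite /B mulr_sumr mulr_suml.
rewrite (eq_bigr (fun a => (\int[mu3]_u sqr_modulus (kapply K (g a) f u))%:C)).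
  by rewrite -rmorph_sum.
move=> a _; rewrite (kform_gram (Sg a) Lf).
by apply: (congr1 (fun x : R => x%:C)); apply: eq_Rintegral => u _; rewrite (kapply_restrict (g a) f mK).
Qed.

Lemma kpositive_gsum K : measurable K -> kpositive K B.
Proof.
move=> mK f Lf; rewrite kform_gsum// lecE /= eqxx /=.
by apply: sumr_ge0 => a _; apply: Rintegral_ge0 => u _; exact: sqr_modulus_ge0.
Qed.

Definition gsum_trace K : R := \sum_(a < m) \int[mu3]_u \int[mu3]_(r in K) sqr_modulus (g a (u, r)).

Section Trace.
Variables (K : set R3) (e : nat -> R3 -> R[i]).
Hypotheses (mK : measurable K) (onb : orthonormal_basis K e).

Let eL k : memL2 mu3 K (e k). Proof. by case: onb. Qed.

Lemma gsum_inner k : inner K (e k) (kapply K B (e k)) =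
  (\sum_(a < m) \int[mu3]_u sqr_modulus (inner K (e k) (fun r => (g a (u, r))^*%C)))%:C.
Proof.
rewrite (inner_kapply mK gsum_memL2 gsum_slice (eL k)) (kform_gsum mK (eL k)).
apply: (congr1 (fun x : R => x%:C)).
apply: eq_bigr => a _; apply: eq_Rintegral => u _; have [_ gu _ _] := Sg a.
rewrite kapply_restrict// inner_restrict// -sqr_modulus_conj -cint_conj; last first.
  by apply: cintegrable_mul; [exact: gu|exact: memL2_restrict].
congr sqr_modulus; apply: eq_cint => r _; rewrite /restrict !conjM conj_real indicE.
by case: (r \in K); rewrite /= ?mul1r ?mul0r ?mulr0// mulrC.
Qed.

(** All terms are nonnegative, so the sum over k passes under the integral over u; Parseval in
    L^2(K), applied to the conjugate of g_a(u, .), then eliminates the basis. *)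
Lemma gsum_trace_ereal :
  (\sum_(0 <= k <oo) (complex.Re (inner K (e k) (kapply K B (e k))))%:E = (gsum_trace K)%:E)%E.
Proof.
pose c a k u := sqr_modulus (inner K (e k) (fun r => (g a (u, r))^*%C)).
have mc a k : measurable_fun setT (c a k).
  have [mg _ _ _] := Sg a; apply: measurable_sqr_modulus.
  rewrite (_ : (fun u => _) = (fun u => cint mu3 setT (fun r => (restrict K (e k) r)^*%C * (g a (u, r))^*%C))).
    apply: (@cmeasurable_cint R _ _ R3 R3 mu3 (fun q => (restrict K (e k) q.2)^*%C * (g a q)^*%C)).
    apply: cmeasurableM; last exact: cmeasurable_conj.
    have /memL2P[[e1 e2] _] := memL2_restrict mK (eL k).
    by apply: cmeasurable_conj; split; [exact: (measurableT_comp e1 measurable_snd)|exact: (measurableT_comp e2 measurable_snd)].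
  apply/funext => u; rewrite /inner cint_restrict//; apply: eq_cint => r _.
  by rewrite /restrict conjM conj_real mulrA.
have c0 a k u : 0 <= c a k u by exact: sqr_modulus_ge0.
have ci a k : mu3.-integrable setT (EFin \o c a k).
  have [_ gu _ _] := Sg a.
  have := kapply_memL2 (Sg a) (memL2_restrict mK (eL k)).
  congr integrable; apply/funext => u /=; congr EFin.
  rewrite /c inner_restrict// -[LHS]sqr_modulus_conj -cint_conj; last first.
    by apply: cintegrable_mul; [exact: gu|exact: memL2_restrict].
  congr sqr_modulus; apply: eq_cint => r _; rewrite /restrict !conjM conj_real indicE.
  by case: (r \in K); rewrite /= ?mul1r ?mul0r ?mulr0// mulrC.
transitivity (\sum_(0 <= k <oo) \sum_(a < m) \int[mu3]_u (c a k u)%:E)%E.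
  apply: eq_eseriesr => k _; rewrite gsum_inner /= -sumEFin; apply: eq_bigr => a _.
  by rewrite /Rintegral fineK//; exact: (integrable_fin_num measurableT (ci a k)).
rewrite nneseries_sum; last by move=> a k _; apply: integral_ge0 => u _; rewrite lee_fin.
rewrite /gsum_trace -sumEFin; apply: eq_bigr => a _.
have [mg gu gr Lg] := Sg a.
rewrite -(integral_nneseries mu3 measurableT (f := fun k u => (c a k u)%:E)); last 2 first.
  by move=> k; exact/measurable_EFinP.
  by move=> k u _; rewrite lee_fin.
pose v u := \int[mu3]_(r in K) sqr_modulus (g a (u, r)).
transitivity (\int[mu3]_u (v u)%:E)%E.
  apply: eq_integral => u _; rewrite (parseval_ereal mK onb).
    by congr EFin; apply: eq_Rintegral => r _; rewrite sqr_modulus_conj.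
  by apply: memL2_subset => //; exact: memL2_conj.
have vE u : v u = \int[mu3]_r (\1_K r * sqr_modulus (g a (u, r))).
  by rewrite /v (Rintegral_indic mu3 K).
rewrite /Rintegral fineK//; apply: integrable_fin_num => //.
apply: (rint_le measurableT _ _ (row2_int (Sg a))).
  change (measurable_fun setT v); rewrite (funext vE).
  apply: (@measurable_Rintegral_param _ _ R3 R3 R mu3 (fun q => \1_K q.2 * sqr_modulus (g a q))).
  apply: measurable_funM; last exact: measurable_sqr_modulus.
  exact: (measurableT_comp (measurable_indic mK) measurable_snd).
move=> u _; rewrite !ger0_norm ?norm2_ge0//; last first.
  by apply: Rintegral_ge0 => r _; exact: sqr_modulus_ge0.
apply: le_Rintegral_subset => //; first by have [_] := (memL2P _ _).1 (gu u).
by move=> r _; exact: sqr_modulus_ge0.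
Qed.

End Trace.

Lemma gsum_trace_class K : measurable K -> trace_class K B.
Proof.
move=> mK; have LB : memL2 mu6 (K `*` K) B.
  by apply: memL2_subset; [exact: measurableX|exact: gsum_memL2].
(* [B] is hermitian and positive, hence its own absolute value. *)
split => //; exists B.
  split => //; first exact: kpositive_gsum.
  by apply: aeW => p _; rewrite gsum_hermitian.
by move=> e onb; rewrite gsum_trace_ereal// ltry.
Qed.

Lemma gsum_has_trace K : measurable K -> has_trace K B (gsum_trace K)%:C.
Proof.
move=> mK e onb; split => /=.
  have t0 k : (0 <= (complex.Re (inner K (e k) (kapply K B (e k))))%:E)%E.
    rewrite gsum_inner//= lee_fin; apply: sumr_ge0 => a _.
    by apply: Rintegral_ge0 => u _; exact: sqr_modulus_ge0.
  have h n : (0 <= n)%N -> xpredT n -> (0 <= (complex.Re (inner K (e n) (kapply K B (e n))))%:E)%E by move=> _ _.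
  have := is_cvg_nneseries h; rewrite (gsum_trace_ereal mK onb) => /fine_cvg.
  have -> : (fine \o (fun n => \sum_(0 <= k < n) (complex.Re (inner K (e k) (kapply K B (e k))))%:E)%E) =
      (fun n => \sum_(k < n) complex.Re (inner K (e k) (kapply K B (e k)))).
    by apply/funext => n; rewrite /= big_mkord sumEFin.
  by [].
have E : (fun n => \sum_(k < n) complex.Im (inner K (e k) (kapply K B (e k)))) = fun=> 0.
  by apply/funext => n; rewrite big1// => k _; rewrite (gsum_inner mK onb).
have H : (fun n => \sum_(k < n) complex.Im (inner K (e k) (kapply K B (e k)))) @ \oo --> (0 : R).
  by rewrite E; exact: cvg_cst.
exact: H.
Qed.

End Family.
End GramKernels.

(** * Weak derivatives of kernels by slices *)

Lemma cintegrable_marginal2 d1 d2 (T1 : measurableType d1) (T2 : measurableType d2) (R : realType)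
  (m1 : {sigma_finite_measure set T1 -> \bar R})
  (m2 : {sigma_finite_measure set T2 -> \bar R}) (F : T1 * T2 -> R[i]) :
  cintegrable (m1 \x m2)%E setT F ->
  cintegrable m2 setT (fun y => cint m1 setT (fun x => F (x, y))).
Proof. by move=> [/rint_swap F1 /rint_swap F2]; split; [exact: (rint_fubini1 F1)|exact: (rint_fubini1 F2)]. Qed.

Section WeakDerivativesBySlices.
Local Open Scope complex_scope.
Variable R : realType.
Local Notation R3 := (R3 R).
Local Notation R6 := (R6 R).
Local Notation mu3 := (mu3 R).
Local Notation mu6 := (mu6 R).
Local Notation L2 := (memL2 mu3 [set: R3]).
Local Notation L6 := (memL2 mu6 [set: R6]).
Implicit Types (F f H : R3 -> R[i]) (G g : R6 -> R[i]) (a : 'I_3) (phi : R6 -> R).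

Definition cwpartial a F f : Prop :=
  is_wpartial a (fun r => complex.Re (F r)) (fun r => complex.Re (f r)) /\
  is_wpartial a (fun r => complex.Im (F r)) (fun r => complex.Im (f r)).

Lemma is_wpartialN a (f g : R3 -> R) : is_wpartial a f g ->
  is_wpartial a (fun r => - f r) (fun r => - g r).
Proof.
move=> [fL gL fg]; have LN (h : R3 -> R) : L1loc3 h -> L1loc3 (fun r => - h r).
  by move=> hL K cK; apply: rintN; exact: hL.
split; [exact: LN|exact: LN|] => phi tphi.
have I1 := L1loc3_test fL (test_function_derive (unit_vec R a) tphi).
have I2 := L1loc3_test gL tphi.
under eq_Rintegral do rewrite mulNr -mulN1r.
under [in RHS]eq_Rintegral do rewrite mulNr -mulN1r.
by rewrite !RintegralZl// fg// mulrN.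
Qed.

Lemma cwpartial_conj a F f : cwpartial a F f ->
  cwpartial a (fun r => (F r)^*%C) (fun r => (f r)^*%C).
Proof.
move=> [h1 /is_wpartialN h2]; split.
  by move: h1; congr is_wpartial; apply/funext => r; rewrite Re_conj.
by move: h2; congr is_wpartial; apply/funext => r; rewrite Im_conj.
Qed.

Lemma cwpartial_test a F f (phi : R3 -> R) : cwpartial a F f -> test_function phi ->
  cint mu3 setT (fun r => F r * ('D_(unit_vec R a) phi r)%:C) =
  - cint mu3 setT (fun r => f r * (phi r)%:C).
Proof.
move=> [[_ _ h1] [_ _ h2]] tphi; apply: complex_eq; rewrite ?ReN ?ImN /=.
  under eq_Rintegral do rewrite ReM /= mulr0 subr0.
  under [in RHS]eq_Rintegral do rewrite ReM /= mulr0 subr0.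
  exact: h1.
under eq_Rintegral do rewrite ImM /= mulr0 add0r.
under [in RHS]eq_Rintegral do rewrite ImM /= mulr0 add0r.
exact: h2.
Qed.

Lemma test_slice2 phi u : test_function phi -> test_function (fun r => phi (u, r)).
Proof.
apply: (@test_function_affine R R3 R6 (fun r : R3 => (u, r)) (fun r => (0, r)) snd).
- by move=> r; apply: (cvg_pair (G := nbhs u) (H := nbhs r)); [exact: cvg_cst|exact: cvg_id].
- by move=> h v x; congr (_, _); rewrite /= scaler0 add0r.
- by move=> r; exact: cvg_snd.
- by [].
Qed.

Lemma test_slice1 phi s : test_function phi -> test_function (fun r => phi (r, s)).
Proof.
apply: (@test_function_affine R R3 R6 (fun r : R3 => (r, s)) (fun r => (r, 0)) fst).
- by move=> r; apply: (cvg_pair (G := nbhs r) (H := nbhs s)); [exact: cvg_id|exact: cvg_cst].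
- by move=> h v x; congr (_, _); rewrite /= scaler0 add0r.
- by move=> r; exact: cvg_fst.
- by [].
Qed.

Lemma derive_slice2 phi u (e r : R3) :
  'D_e (fun r => phi (u, r)) r = 'D_((0 : R3), e) phi (u, r).
Proof.
have TL (h : R) (v x : R3) : (u, h *: v + x) = h *: ((0, v) : R6) + (u, x).
  by congr (_, _); rewrite /= scaler0 add0r.
by have [] := @derive_affine R R3 R6 (fun r : R3 => (u, r)) (fun r => (0, r)) TL phi e r.
Qed.

Lemma derive_slice1 phi s (e r : R3) :
  'D_e (fun r => phi (r, s)) r = 'D_(e, (0 : R3)) phi (r, s).
Proof.
have TL (h : R) (v x : R3) : (h *: v + x, s) = h *: ((v, 0) : R6) + (x, s).
  by congr (_, _); rewrite /= scaler0 add0r.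
by have [] := @derive_affine R R3 R6 (fun r : R3 => (r, s)) (fun r => (r, 0)) TL phi e r.
Qed.

Lemma integrable_indic_cbox (x y : R3) : mu3.-integrable setT (EFin \o (\1_(cbox x y) : R3 -> R)).
Proof.
have mB := measurable_cbox x y; apply/integrableP; split.
  by apply/measurable_EFinP; exact: measurable_indic.
rewrite (eq_integral (fun r => (\1_(cbox x y) r)%:E)); last by move=> r _; rewrite /= ger0_norm// indicE.
by rewrite integral_indic// setIT; exact: cbox_finite.
Qed.

Lemma test6_dominated phi : test_function phi ->
  exists b : R3 -> R, [/\ measurable_fun setT b, forall r, 0 <= b r,
    mu3.-integrable setT (EFin \o (fun r => b r ^+ 2)) & forall p, `|phi p| <= b p.1 * b p.2].
Proof.
move=> tphi; have [_ [K cK phiK]] := tphi; have [M M0 phiM] := test_bounded tphi.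
have [n Kn] := compact_sub_cbox6 cK; set B := cbox _ _ in Kn.
(* The product b(r) b(s) is (1 + M)^2 >= M on the support, so no square root of [M] is needed. *)
exists (fun r => (1 + M) * \1_B r); split.
- by apply: measurable_funM => //; apply: measurable_indic; exact: measurable_cbox.
- by move=> r; rewrite mulr_ge0 ?addr_ge0// indicE.
- have := rintZl measurableT ((1 + M) ^+ 2) (integrable_indic_cbox ((- n%:R, - n%:R), - n%:R) ((n%:R, n%:R), n%:R)).
  by congr integrable; apply/funext => r /=; rewrite exprMn indicE; case: (_ \in _); rewrite ?expr1n ?expr0n.
move=> p; have [Kp|nKp] := pselect (K p); last first.
  by rewrite phiK// normr0 !mulr_ge0 ?addr_ge0// indicE.
have [/= B1 B2] := Kn p Kp; rewrite !indicE !mem_set// !mulr1.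
by apply: le_trans (phiM p) _; nra.
Qed.

Lemma test3_memL2 (phi : R3 -> R) : test_function phi -> L2 (fun r => (phi r)%:C).
Proof.
move=> tphi; have [K [M [cK M0 phiK]]] := test_dominated tphi.
have [n Kn] := compact_sub_cbox cK.
have IB := integrable_indic_cbox ((- n%:R, - n%:R), - n%:R) ((n%:R, n%:R), n%:R).
apply: (memL2_le _ (rintZl measurableT (M ^+ 2) IB)) => [|r].
  by apply: cmeasurable_real; apply: continuous_measurable3; exact: test_continuous.
rewrite sqr_modulus_real -(real_normK (num_real (phi r))) /=.
have := phiK r; rewrite !indicE; case: (boolP (r \in K)) => rK; last first.
  rewrite mulr0 => h; have -> : `|phi r| = 0 by apply/eqP; rewrite eq_le h normr_ge0.
  by rewrite expr0n mulr_ge0 ?sqr_ge0.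
rewrite mem_set; last by apply: Kn; rewrite inE in rK.
by rewrite !mulr1 => h; rewrite lerXn2r// nnegrE.
Qed.

Lemma test6_cmeasurable phi : test_function phi -> @cmeasurable R _ R6 (fun p => (phi p)%:C).
Proof.
by move=> tphi; apply: cmeasurable_real; apply: continuous_measurable6; exact: test_continuous.
Qed.

Lemma test6_memL2 phi : test_function phi -> L6 (fun p => (phi p)%:C).
Proof.
move=> tphi; have [b [mb b0 Ib phib]] := test6_dominated tphi.
apply: (memL2_le (test6_cmeasurable tphi) (rint_tensor Ib Ib)) => p.
rewrite sqr_modulus_real -exprMn -(real_normK (num_real (phi p))).
by rewrite lerXn2r ?nnegrE// mulr_ge0.
Qed.

(** By |x| <= x^2 + 1 for each component, the constant being integrable over compact sets. *)
Lemma L1loc6_memL2 G : L6 G -> L1loc6 G.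
Proof.
move=> /memL2P[mG IG] K cK; have [n Kn] := compact_sub_cbox6 cK; set B := cbox _ _ in Kn.
have IB := integrable_indic_cbox ((- n%:R, - n%:R), - n%:R) ((n%:R, n%:R), n%:R).
have I := rintD measurableT IG (rint_tensor IB IB).
have mK := compact_measurable6 cK.
have key (f : R6 -> R) : measurable_fun setT f -> (forall p, f p ^+ 2 <= sqr_modulus (G p)) ->
    mu6.-integrable K (EFin \o f).
  move=> mf fG; apply/(rint_indic mu6 mK); apply: (rint_le measurableT _ _ I).
    by apply: measurable_funM => //; exact: measurable_indic.
  move=> p _; rewrite [leRHS]ger0_norm; last first.
    by rewrite addr_ge0 ?sqr_modulus_ge0// mulr_ge0// indicE.
  rewrite indicE; case: (boolP (p \in K)) => Kp; last first.
    by rewrite mul0r normr0 addr_ge0 ?sqr_modulus_ge0// mulr_ge0// indicE.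
  have [/= B1 B2] : (B `*` B) p by apply: Kn; rewrite inE in Kp.
  rewrite mul1r !indicE !mem_set// mulr1; have -> : (true%:R : R) = 1 by [].
  apply: le_trans (lerD (fG p) (lexx _)).
  rewrite -(real_normK (num_real (f p))); move: `|f p| => x.
  by have := sqr_ge0 (x - 1); have := sqr_ge0 x; nra.
split; apply: key; [exact: mG.1| |exact: mG.2|] => p; by rewrite /sqr_modulus ?lerDl ?lerDr sqr_ge0.
Qed.

(** Fubini in u: since every slice has a weak derivative, integration by parts is done for fixed u
    against the slice of the test function. *)
Lemma is_wpartial2_slices a G g : L6 G -> L6 g ->
  (forall u, cwpartial a (fun r => G (u, r)) (fun r => g (u, r))) -> is_wpartial2 a G g.
Proof.
move=> LG Lg Gg; split; [exact: L1loc6_memL2|exact: L1loc6_memL2|] => phi tphi.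
have tD := test_function_derive ((0 : R3), unit_vec R a) tphi.
have I1 := cintegrable_mul LG (test6_memL2 tD).
have I2 := cintegrable_mul Lg (test6_memL2 tphi).
rewrite [LHS](cfubini1 I1) (cfubini1 I2) -(cintN (cintegrable_marginal I2)); apply: eq_cint => u _.
rewrite -(cwpartial_test (Gg u) (test_slice2 u tphi)).
by apply: eq_cint => r _; rewrite derive_slice2.
Qed.

Lemma memL2_tensor_test F H phi : L2 F -> L2 H -> test_function phi ->
  cintegrable mu6 setT (fun p : R6 => F p.1 * H p.2 * (phi p)%:C).
Proof. by move=> LF LH tphi; exact: cintegrable_mul (memL2_tensor LF LH) (test6_memL2 tphi). Qed.

Lemma tensor_wpartial2 a F f H phi : L2 F -> L2 f -> L2 H -> cwpartial a F f -> test_function phi ->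
  cint mu6 setT (fun p : R6 => H p.1 * F p.2 * ('D_((0 : R3), unit_vec R a) phi p)%:C) =
  - cint mu6 setT (fun p : R6 => H p.1 * f p.2 * (phi p)%:C).
Proof.
move=> LF Lf LH Ff tphi; have tD := test_function_derive ((0 : R3), unit_vec R a) tphi.
have I1 := memL2_tensor_test LH LF tD; have I2 := memL2_tensor_test LH Lf tphi.
rewrite [LHS](cfubini1 I1) (cfubini1 I2) -(cintN (cintegrable_marginal I2)); apply: eq_cint => r _ /=.
have cZ (k : R3 -> R[i]) (h : R3 -> R) : L2 k -> test_function h ->
    cint mu3 setT (fun s => H r * k s * (h s)%:C) = H r * cint mu3 setT (fun s => k s * (h s)%:C).
  move=> Lk th; rewrite -cintZ; last exact: cintegrable_mul Lk (test3_memL2 th).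
  by apply: eq_cint => s _; rewrite mulrA.
rewrite (cZ _ _ Lf (test_slice2 r tphi)) (cZ _ _ LF (test_slice2 r tD)) -mulrN; congr (_ * _).
rewrite -(cwpartial_test Ff (test_slice2 r tphi)).
by apply: eq_cint => s _; rewrite derive_slice2.
Qed.

Lemma tensor_wpartial1 a F f H phi : L2 F -> L2 f -> L2 H -> cwpartial a F f -> test_function phi ->
  cint mu6 setT (fun p : R6 => F p.1 * H p.2 * ('D_(unit_vec R a, (0 : R3)) phi p)%:C) =
  - cint mu6 setT (fun p : R6 => f p.1 * H p.2 * (phi p)%:C).
Proof.
move=> LF Lf LH Ff tphi; have tD := test_function_derive (unit_vec R a, (0 : R3)) tphi.
have I1 := memL2_tensor_test LF LH tD; have I2 := memL2_tensor_test Lf LH tphi.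
rewrite [LHS](cfubini2 I1) (cfubini2 I2) -(cintN (cintegrable_marginal2 I2)); apply: eq_cint => s _ /=.
have cZ (k : R3 -> R[i]) (h : R3 -> R) : L2 k -> test_function h ->
    cint mu3 setT (fun r => k r * H s * (h r)%:C) = H s * cint mu3 setT (fun r => k r * (h r)%:C).
  move=> Lk th; rewrite -cintZ; last exact: cintegrable_mul Lk (test3_memL2 th).
  by apply: eq_cint => r _; ring.
rewrite (cZ _ _ Lf (test_slice1 s tphi)) (cZ _ _ LF (test_slice1 s tD)) -mulrN; congr (_ * _).
rewrite -(cwpartial_test Ff (test_slice1 s tphi)).
by apply: eq_cint => r _; rewrite derive_slice1.
Qed.

(** For fixed u the kernel conj G(u, r) G(u, s) is a tensor product and the two derivatives fall on
    different factors; the signs of the two integrations by parts cancel. *)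
Lemma is_wgrad1_dot_grad2_slices G (g : 'I_3 -> R6 -> R[i]) :
  sliceL2 G -> (forall a, sliceL2 (g a)) ->
  (forall a u, cwpartial a (fun r => G (u, r)) (fun r => g a (u, r))) ->
  is_wgrad1_dot_grad2 (gram G G) (fun p => \sum_(a < 3) gram (g a) (g a) p).
Proof.
move=> SG Sg Gg; split.
- by apply: L1loc6_memL2; exact: gram_memL2.
- by apply: L1loc6_memL2; exact: gsum_memL2.
move=> phi tphi.
pose psi a := 'D_(unit_vec R a, (0 : R3)) ('D_((0 : R3), unit_vec R a) phi).
have tD2 a := test_function_derive ((0 : R3), unit_vec R a) tphi.
have tpsi a : test_function (psi a) by exact: test_function_derive (tD2 a).
transitivity (\sum_(a < 3) cint mu6 setT (fun p => gram G G p * (psi a p)%:C)).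
  rewrite -cint_sum => [|a]; last exact: cintegrable_mul (gram_memL2 SG SG) (test6_memL2 (tpsi a)).
  by apply: eq_cint => p _; rewrite rmorph_sum mulr_sumr.
transitivity (\sum_(a < 3) cint mu6 setT (fun p => gram (g a) (g a) p * (phi p)%:C)); last first.
  rewrite -cint_sum => [|a]; last exact: cintegrable_mul (gram_memL2 (Sg a) (Sg a)) (test6_memL2 tphi).
  by apply: eq_cint => p _; rewrite mulr_suml.
apply: eq_bigr => a _.
have [b [mb b0 Ib phib]] := test6_dominated tphi.
have [c [mc c0 Ic psic]] := test6_dominated (tpsi a).
rewrite (gram_fubini SG SG (test6_cmeasurable (tpsi a)) mc c0 Ic); last by move=> p; rewrite modulus_real.
rewrite (gram_fubini (Sg a) (Sg a) (test6_cmeasurable tphi) mb b0 Ib); last by move=> p; rewrite modulus_real.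
apply: eq_cint => u _; have [_ Gu _ _] := SG; have [_ gu _ _] := Sg a.
rewrite (tensor_wpartial1 (memL2_conj (Gu u)) (memL2_conj (gu u)) (Gu u) (cwpartial_conj (Gg a u)) (tD2 a)).
by rewrite (tensor_wpartial2 (Gu u) (gu u) (memL2_conj (gu u)) (Gg a u) tphi) opprK.
Qed.

End WeakDerivativesBySlices.

(** * The Lorentzian profile *)

Section Lorentzian.
Variable R : realType.
Local Notation leb := (@lebesgue_measure R).
Implicit Types (x y t s m d : R).

(** Slow decay is essential here: for a Gaussian the ratio of a translate to the original is
    unbounded. *)
Definition lor t : R := (1 + t ^+ 2)^-1.

Lemma lor_gt0 t : 0 < lor t.
Proof. by rewrite invr_gt0; have := sqr_ge0 t; lra. Qed.

Let lorE t : lor t * (1 + t ^+ 2) = 1.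
Proof. by rewrite mulVf//; have := sqr_ge0 t; lra. Qed.

Lemma lor_le1 t : lor t <= 1.
Proof. by have := lorE t; have := sqr_ge0 t; have := lor_gt0 t; nra. Qed.

Lemma sqr_lor_le1 t : t ^+ 2 * lor t <= 1.
Proof. by have := lorE t; have := lor_gt0 t; nra. Qed.

Lemma norm_lor_le1 t : `|t * lor t| <= 1.
Proof.
rewrite ler_norml; have := lorE t; have := lor_gt0 t; have := sqr_ge0 (t - 1); have := sqr_ge0 (t + 1).
by move=> *; apply/andP; split; nra.
Qed.

(** With s = t + d the claim reads 1 + t^2 <= (1 + |d| + d^2)(1 + s^2), and the cross term is
    absorbed by 2|s||d| <= |d|(1 + s^2). *)
Lemma lor_shift t d : lor (t + d) <= (1 + `|d| + d ^+ 2) * lor t.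
Proof.
have := lorE t; have := lorE (t + d); have := lor_gt0 t; have := lor_gt0 (t + d).
set a := lor t; set b := lor (t + d) => b0 a0 E1 E2.
have key : 1 + t ^+ 2 <= (1 + `|d| + d ^+ 2) * (1 + (t + d) ^+ 2).
  have -> : t = (t + d) - d by ring.
  rewrite subrK; move: (t + d) => s.
  have h1 : - (2 * s * d) <= `|d| * (1 + s ^+ 2).
    apply: le_trans (ler_norm _) _; rewrite normrN !normrM (ger0_norm (_ : 0 <= 2)) ?ler0n//.
    rewrite mulrC ler_wpM2l// -(real_normK (num_real s)); have := sqr_ge0 (`|s| - 1); nra.
  have := sqr_ge0 s; have := sqr_ge0 d; have := sqr_ge0 (s * d); nra.
have : a * b * (1 + t ^+ 2) <= a * b * ((1 + `|d| + d ^+ 2) * (1 + (t + d) ^+ 2)).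
  by rewrite ler_wpM2l// mulr_ge0// ltW.
rewrite mulrAC E2 mul1r [leRHS](_ : _ = (1 + `|d| + d ^+ 2) * a * (b * (1 + (t + d) ^+ 2))); last by ring.
by rewrite E1 mulr1.
Qed.

Definition dlor t : R := - 2 * t * lor t ^+ 2.

Lemma is_derive_lor t : is_derive t 1 lor (dlor t).
Proof.
have nz : 1 + t ^+ 2 != 0 by have := sqr_ge0 t; lra.
have d1 : is_derive t 1 (fun x : R => 1 + x ^+ 2) (2 * t).
  have d0 := is_deriveD (is_derive_cst (1 : R) t (1 : R)) (is_deriveX 2 (is_derive_id t (1 : R))).
  by apply: (is_derive_eq d0); rewrite add0r /= expr1 [_ *: _]mulr1.
apply: (is_derive_eq (@is_deriveV R (fun x => 1 + x ^+ 2) t _ 1 nz d1)).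
by rewrite /dlor /lor exprVn [_ *: _]mulNr mulrC; ring.
Qed.

Lemma continuous_lor : continuous lor.
Proof. by move=> t; apply/differentiable_continuous/derivable1_diffP; have [] := is_derive_lor t. Qed.

(** The identity (1 + t^2)^2 - 4 t^2 = (t^2 - 1)^2 gives 4 t^2 lor^2 <= 1, and lor^2 <= lor bounds
    what remains. *)
Lemma dlor2_le t : dlor t ^+ 2 <= lor t.
Proof.
have := lorE t; have := lor_gt0 t; have := lor_le1 t; rewrite /dlor; set a := lor t => a1 a0 E.
have : 4 * t ^+ 2 * a * a <= 1.
  have E2 : (a * (1 + t ^+ 2)) ^+ 2 = 1 by rewrite E expr1n.
  rewrite -[leRHS]E2 -subr_ge0 (_ : _ - _ = a ^+ 2 * (t ^+ 2 - 1) ^+ 2); last by ring.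
  by rewrite mulr_ge0// sqr_ge0.
have a3 : a * a <= a by nra.
move=> h; have -> : (- 2 * t * a ^+ 2) ^+ 2 = (4 * t ^+ 2 * a * a) * (a * a) by ring.
nra.
Qed.

Lemma lor_lip x y : `|lor x - lor y| <= 2 * `|x - y|.
Proof.
have -> : lor x - lor y = (y - x) * ((x * lor x) * lor y + (y * lor y) * lor x).
  have := lorE x; have := lorE y; set a := lor x; set b := lor y => E1 E2.
  have -> : a - b = a * (b * (1 + y ^+ 2)) - b * (a * (1 + x ^+ 2)) by rewrite E1 E2 !mulr1.
  by ring.
rewrite normrM distrC mulrC ler_wpM2r//.
apply: le_trans (ler_normD _ _) _; rewrite [2%R](_ : _ = 1 + 1)//.
by apply: lerD; rewrite normrM -[1]mulr1 ler_pM// ?norm_lor_le1// ger0_norm ?lor_le1// ltW// lor_gt0.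
Qed.

Lemma xlor_lip x y : `|x * lor x - y * lor y| <= 2 * `|x - y|.
Proof.
have -> : x * lor x - y * lor y = (x - y) * (lor x * lor y - (x * lor x) * (y * lor y)).
  have := lorE x; have := lorE y; set a := lor x; set b := lor y => E1 E2.
  have -> : x * a - y * b = x * a * (b * (1 + y ^+ 2)) - y * b * (a * (1 + x ^+ 2)) by rewrite E1 E2 !mulr1.
  by ring.
rewrite normrM mulrC ler_wpM2r//.
apply: le_trans (ler_normB _ _) _; rewrite [2%R](_ : _ = 1 + 1)//.
by apply: lerD; rewrite normrM -[1]mulr1 ler_pM// ?norm_lor_le1// ger0_norm ?lor_le1// ltW// lor_gt0.
Qed.

(** A Lipschitz derivative is what the chain rule on lines asks for. *)
Lemma dlor_lip x y : `|dlor x - dlor y| <= 8 * `|x - y|.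
Proof.
have -> : dlor x - dlor y = - 2 * ((x * lor x - y * lor y) * lor x + (y * lor y) * (lor x - lor y)).
  by rewrite /dlor; ring.
rewrite normrM normrN (ger0_norm (_ : 0 <= 2)) ?ler0n//.
have h1 : `|(x * lor x - y * lor y) * lor x| <= 2 * `|x - y|.
  by rewrite normrM -[leRHS]mulr1 ler_pM// ?xlor_lip// ger0_norm ?lor_le1// ltW// lor_gt0.
have h2 : `|(y * lor y) * (lor x - lor y)| <= 2 * `|x - y|.
  by rewrite normrM -[leRHS]mul1r ler_pM// ?norm_lor_le1// lor_lip.
have := ler_normD ((x * lor x - y * lor y) * lor x) ((y * lor y) * (lor x - lor y)); nra.
Qed.

Lemma measurable_lor : measurable_fun [set: R] lor.
Proof. by apply: continuous_measurable_fun; exact: continuous_lor. Qed.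

Lemma integrable_lor : leb.-integrable setT (EFin \o lor).
Proof.
apply/integrableP; split; first by apply/measurable_EFinP; exact: measurable_lor.
rewrite [X in (X < _)%E](_ : _ = \int[leb]_t (lor t)%:E)%E; last first.
  by apply: eq_integral => t _; rewrite /= ger0_norm// ltW// lor_gt0.
rewrite ge0_symfun_integralT; [|by move=> t; rewrite ltW// lor_gt0|exact: continuous_lor|]; last first.
  by move=> t; rewrite /lor /= sqrrN.
rewrite [X in (_ * X)%E](_ : _ = (pi / 2)%:E); first by rewrite -EFinM ltry.
rewrite -integral0y_oneDsqr; congr integral.
by apply/seteqP; split => t /=; rewrite in_itv /= andbT.
Qed.

Lemma integrable_le_lor (k : R -> R) (C : R) : measurable_fun setT k ->
  (forall t, `|k t| <= C * lor t) -> leb.-integrable setT (EFin \o k).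
Proof.
move=> mk kC; apply: rint_le (rintZl measurableT C integrable_lor) => // t _.
by apply: le_trans (kC t) _; exact: ler_norm.
Qed.

Lemma integrable_translate (k : R -> R) m : leb.-integrable setT (EFin \o k) ->
  leb.-integrable setT (EFin \o (fun t => k (t - m))).
Proof. exact: integrable_preserves (preserves_lebesgue_add (- m)). Qed.

Lemma Rintegral_translate (k : R -> R) m : measurable_fun setT k ->
  \int[leb]_t k (t - m) = \int[leb]_t k t.
Proof. exact: Rintegral_preserves (preserves_lebesgue_add (- m)). Qed.

Definition lor2_mass : R := \int[leb]_t (lor t ^+ 2).

Let mlor2 : measurable_fun [set: R] (fun t => lor t ^+ 2).
Proof. by apply: measurable_funX; exact: measurable_lor. Qed.

Let lor2_le t : `|lor t ^+ 2| <= 1 * lor t.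
Proof. by rewrite mul1r ger0_norm ?sqr_ge0//; have := lor_gt0 t; have := lor_le1 t; nra. Qed.

Let Ilor2 : leb.-integrable setT (EFin \o (fun t => lor t ^+ 2)).
Proof. exact: integrable_le_lor mlor2 lor2_le. Qed.

Lemma lor2_mass_gt0 : 0 < lor2_mass.
Proof.
have mI : measurable (`[0, 1]%classic : set (measurableTypeR R)) by exact: measurable_itv.
have l1 : (@lebesgue_measure R `[0%R, 1%R]%classic = 1)%E.
  by rewrite lebesgue_measure_itv /= lte_fin ltr01 -EFinB subr0.
(* The Lorentzian is at least 1/2 on [0, 1], which contributes at least 1/4 to the integral of its
   square. *)
apply: (@lt_le_trans _ _ (1 / 4)); first by lra.
have -> : 1 / 4 = \int[leb]_t (1 / 4 * \1_(`[0, 1]%classic : set R) t).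
  rewrite RintegralZl//; last exact: integrable_indic_itv.
  rewrite [X in _ = _ * X](_ : _ = \int[leb]_(t in `[0, 1]) 1); last first.
    by rewrite (Rintegral_indic leb `[0, 1]%classic (fun=> 1)); apply: eq_Rintegral => t _; rewrite mulr1.
  by rewrite Rintegral_cst// mul1r [fine _](_ : _ = fine 1%:E) ?mulr1//; congr fine; exact: l1.
apply: le_Rintegral => //; first by apply: rintZl => //; exact: integrable_indic_itv.
move=> t _; rewrite indicE; case: (boolP (t \in _)) => [|_]; last by rewrite mulr0 sqr_ge0.
rewrite inE /= in_itv /= => /andP[t0 t1]; rewrite mulr1.
have t2 : t ^+ 2 <= 1 by nra.
have : 1 / 2 <= lor t by have := lorE t; have := lor_gt0 t; nra.
nra.
Qed.

Definition amp : R := (Num.sqrt (3 * lor2_mass))^-1.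
Definition prof t : R := amp * lor t.
Definition dprof t : R := amp * dlor t.

Lemma amp_gt0 : 0 < amp.
Proof. by rewrite invr_gt0 sqrtr_gt0 mulr_gt0// lor2_mass_gt0. Qed.

Lemma prof_gt0 t : 0 < prof t.
Proof. by rewrite mulr_gt0 ?amp_gt0 ?lor_gt0. Qed.

Lemma is_derive_prof t : is_derive t 1 prof (dprof t).
Proof. exact: is_deriveZ (is_derive_lor t). Qed.

Lemma dprof_lip x y : `|dprof x - dprof y| <= amp * 8 * `|x - y|.
Proof.
rewrite /dprof -mulrBr normrM (gtr0_norm amp_gt0) -mulrA ler_wpM2l ?dlor_lip//.
by rewrite ltW// amp_gt0.
Qed.

Lemma prof_shift t d : prof (t + d) <= (1 + `|d| + d ^+ 2) * prof t.
Proof. by rewrite /prof mulrCA ler_wpM2l ?lor_shift// ltW// amp_gt0. Qed.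

Lemma prof2_le t : prof t ^+ 2 <= amp ^+ 2 * lor t.
Proof. by rewrite exprMn ler_wpM2l ?sqr_ge0//; have := lor2_le t; rewrite mul1r; apply: le_trans; exact: ler_norm. Qed.

Lemma sqr_prof2_le t : t ^+ 2 * prof t ^+ 2 <= amp ^+ 2 * lor t.
Proof.
rewrite exprMn mulrCA ler_wpM2l ?sqr_ge0//.
by have := sqr_lor_le1 t; have := lor_gt0 t; nra.
Qed.

Lemma dprof2_le t : dprof t ^+ 2 <= amp ^+ 2 * lor t.
Proof. by rewrite exprMn ler_wpM2l ?sqr_ge0// dlor2_le. Qed.

Lemma measurable_prof : measurable_fun [set: R] prof.
Proof. by apply: measurable_funM => //; exact: measurable_lor. Qed.

Lemma measurable_dprof : measurable_fun [set: R] dprof.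
Proof. by apply: measurable_funM => //; apply: measurable_funM; [exact: measurable_funM|exact: mlor2]. Qed.

Let mprof2 : measurable_fun [set: R] (fun t => prof t ^+ 2).
Proof. by apply: measurable_funX; exact: measurable_prof. Qed.

Lemma integrable_prof2 m : leb.-integrable setT (EFin \o (fun t => prof (t - m) ^+ 2)).
Proof.
apply: (@integrable_translate (fun t => prof t ^+ 2)); apply: (@integrable_le_lor _ (amp ^+ 2)) => // t.
by rewrite ger0_norm ?sqr_ge0// prof2_le.
Qed.

Lemma Rintegral_prof2 m : \int[leb]_t (prof (t - m) ^+ 2) = 1 / 3.
Proof.
rewrite (@Rintegral_translate (fun t => prof t ^+ 2))//.
under eq_Rintegral do rewrite exprMn.
rewrite RintegralZl// -/lor2_mass exprVn sqr_sqrtr; last by rewrite mulr_ge0// ltW// lor2_mass_gt0.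
by have := lor2_mass_gt0 => ?; field; lra.
Qed.

Lemma integrable_moment m : leb.-integrable setT (EFin \o (fun t => t * prof (t - m) ^+ 2)).
Proof.
have I0 : leb.-integrable setT (EFin \o (fun t => t * prof t ^+ 2)).
  apply: (@integrable_le_lor _ (amp ^+ 2)); first exact: measurable_funM.
  move=> t; rewrite normrM [`|prof t ^+ 2|]ger0_norm ?sqr_ge0//.
  have := sqr_prof2_le t; have := prof2_le t; have := sqr_ge0 (prof t).
  have -> : t ^+ 2 = `|t| ^+ 2 by rewrite real_normK ?num_real.
  have := sqr_ge0 (`|t| - 1); have := sqr_ge0 ((`|t| - 1) * prof t).
  by move: `|t| => x; move: (prof t) => p; have := lor_gt0 t; have := sqr_ge0 amp; nra.
have I1 := rintD measurableT (integrable_translate m I0) (rintZl measurableT m (integrable_prof2 m)).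
by move: I1; congr integrable; apply/funext => t /=; congr EFin; ring.
Qed.

(** The moment about the centre vanishes by parity, which leaves [m] times the squared mass 1/3. *)
Lemma Rintegral_moment m : \int[leb]_t (t * prof (t - m) ^+ 2) = m / 3.
Proof.
pose k t := t * prof t ^+ 2.
have Ik : leb.-integrable setT (EFin \o k).
  by have := integrable_moment 0; congr integrable; apply/funext => t; rewrite /k /= subr0.
have mk : measurable_fun setT k by exact: rint_measurable Ik.
have k0 : \int[leb]_t k t = 0.
  have := Rintegral_preserves (preserves_lebesgue_opp R) mk.
  rewrite (_ : \int[leb]_x k (- x) = - \int[leb]_x k x); first by move: (\int[leb]_t k t) => I h; lra.
  rewrite -mulN1r -RintegralZl//; apply: eq_Rintegral => x _.
  by rewrite /k /prof /lor sqrrN mulN1r mulNr.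
transitivity (\int[leb]_t (k (t - m) + m * prof (t - m) ^+ 2)).
  by apply: eq_Rintegral => t _; rewrite /k; ring.
have I2 := integrable_prof2 m.
rewrite RintegralD//; [|exact: integrable_translate|exact: rintZl].
by rewrite Rintegral_translate// k0 RintegralZl// Rintegral_prof2; field.
Qed.

Lemma integrable_overlap (k : R -> R) m m' : measurable_fun setT k -> (forall t, `|k t| <= 1) ->
  leb.-integrable setT (EFin \o (fun t => k t * (prof (t - m) * prof (t - m')))).
Proof.
move=> mk k1; have mp c : measurable_fun setT (fun t : R => prof (t - c)).
  by apply: (measurableT_comp measurable_prof); apply: measurable_funB.
have mw : measurable_fun [set: R] (fun t : R => k t * (prof (t - m) * prof (t - m'))).
  by apply: measurable_funM => //; exact: measurable_funM.
apply: rint_le (rintD measurableT (integrable_prof2 m) (integrable_prof2 m')) => //.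
move=> t _; rewrite normrM [leRHS]ger0_norm ?addr_ge0 ?sqr_ge0//.
rewrite (gtr0_norm (mulr_gt0 (prof_gt0 _) (prof_gt0 _))).
have := k1 t; have := prof_gt0 (t - m); have := prof_gt0 (t - m'); have := normr_ge0 (k t).
move: (prof _) (prof _) `|k t| => a b c c0 a0 b0 c1.
have := sqr_ge0 (a - b); have : 0 < a * b by exact: mulr_gt0.
nra.
Qed.

(* Translating by half a period [d] of [k] turns the integral into half of one of
   [k] against an increment of the slowly varying factor. *)
Lemma oscillatory_bound (k : R -> R) m m' d : measurable_fun setT k -> (forall t, `|k t| <= 1) ->
  (forall t, k (t + d) = - k t) ->
  `|\int[leb]_t (k t * (prof (t - m) * prof (t - m')))| <= ((1 + `|d| + d ^+ 2) ^+ 2 - 1) / 6.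
Proof.
move=> mk k1 kd; set q := 1 + `|d| + d ^+ 2.
have q1 : 1 <= q by have := normr_ge0 d; have := sqr_ge0 d; rewrite /q; lra.
pose w t := prof (t - m) * prof (t - m').
have w0 t : 0 < w t by rewrite mulr_gt0// prof_gt0.
have I1 : leb.-integrable setT (EFin \o (fun t => k t * w t)) by exact: integrable_overlap.
have I2 : leb.-integrable setT (EFin \o (fun t => k (t + d) * w (t + d))).
  exact: integrable_preserves (preserves_lebesgue_add d) I1.
have E2 : \int[leb]_t (k (t + d) * w (t + d)) = \int[leb]_t (k t * w t).
  exact: Rintegral_preserves (preserves_lebesgue_add d) (rint_measurable I1).
have Iw : leb.-integrable setT (EFin \o w).
  have n1 (t : R) : `|1 : R| <= 1 by rewrite normr1.
  have := integrable_overlap m m' (measurable_cst (1 : R)) n1.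
  by congr integrable; apply/funext => t; rewrite /= mul1r.
(* AM-GM bounds the overlap by the common squared mass 1/3; with the 1/2 from averaging over half a
   period this produces the denominator 6. *)
have Ew : \int[leb]_t w t <= 1 / 3.
  have J := rintZl measurableT (1 / 2) (rintD measurableT (integrable_prof2 m) (integrable_prof2 m')).
  apply: (@le_trans _ _ (\int[leb]_t (1 / 2 * (prof (t - m) ^+ 2 + prof (t - m') ^+ 2)))).
    by apply: le_Rintegral => // t _; rewrite /w; have := sqr_ge0 (prof (t - m) - prof (t - m')); nra.
  rewrite RintegralZl//; last by apply: rintD => //; exact: integrable_prof2.
  rewrite RintegralD// ?Rintegral_prof2; [lra|exact: integrable_prof2..].
have E : 2 * \int[leb]_t (k t * w t) = \int[leb]_t (k t * w t + k (t + d) * w (t + d)).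
  by rewrite RintegralD// E2; ring.
have : `|2 * \int[leb]_t (k t * w t)| <= \int[leb]_t ((q ^+ 2 - 1) * w t).
  rewrite E; apply: le_Rintegral_norm => //; [exact: rintD|exact: rintZl|].
  move=> t _; rewrite kd mulNr -mulrBr normrM.
  (* The shift estimates for d and for -d bound w(t + d) and w(t) by q^2 times each other, so they
     differ by at most (q^2 - 1) w(t). *)
  have up s : prof (s + d) <= q * prof s by exact: prof_shift.
  have dn s : prof s <= q * prof (s + d).
    by have := prof_shift (s + d) (- d); rewrite addrK normrN sqrrN.
  have h1 : w (t + d) <= q ^+ 2 * w t.
    have := up (t - m); have := up (t - m'); rewrite ![_ - _ + d]addrAC /w.
    have := prof_gt0 (t - m); have := prof_gt0 (t - m'); have := prof_gt0 (t + d - m); have := prof_gt0 (t + d - m').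
    move: (prof _) (prof _) (prof _) (prof _) => x y z v *.
    rewrite (_ : q ^+ 2 * (x * y) = (q * x) * (q * y)); last by ring.
    by apply: ler_pM => //; exact: ltW.
  have h2 : w t <= q ^+ 2 * w (t + d).
    have := dn (t - m); have := dn (t - m'); rewrite ![_ - _ + d]addrAC /w.
    have := prof_gt0 (t - m); have := prof_gt0 (t - m'); have := prof_gt0 (t + d - m); have := prof_gt0 (t + d - m').
    move: (prof (t - m)) (prof (t - m')) (prof (t + d - m)) (prof (t + d - m')) => x y z v *.
    rewrite (_ : q ^+ 2 * (z * v) = (q * z) * (q * v)); last by ring.
    by apply: ler_pM => //; exact: ltW.
  have := k1 t; have := w0 t; have := w0 (t + d); have q2 : 1 <= q ^+ 2 by nra.
  move: (w (t + d)) (w t) (q ^+ 2) `|k t| h1 h2 q2 (normr_ge0 (k t)) => x y z c h1 h2 z1 c0 x0 y0 c1.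
  rewrite -[leRHS]mul1r ler_pM// ler_norml; apply/andP; split; nra.
rewrite RintegralZl// normrM (ger0_norm (_ : 0 <= 2)) ?ler0n//.
have : 0 <= q ^+ 2 - 1 by nra.
rewrite -/w; nra.
Qed.

End Lorentzian.

(** * The factor of the density matrix *)

Section Cells.
Local Open Scope complex_scope.
Variable R : realType.
Local Notation R3 := (R3 R).
Local Notation R6 := (R6 R).
Local Notation mu2 := (mu2 R).
Local Notation mu3 := (mu3 R).
Local Notation mu6 := (mu6 R).
Local Notation leb := (@lebesgue_measure R).

Let I (c : R) : set R := `[c, c + 1[%classic.

(* The three unit cells partition [0 <= u2 < 3], [0 <= u3 < 1]; the variable u1 stays free. *)
Definition cell (b : 'I_3) (u : R3) : R := \1_(I b%:R) u.1.2 * \1_(I 0) u.2.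

Lemma cellP u : (forall b, cell b u = 0) \/ exists b0, forall b, cell b u = (b == b0)%:R.
Proof.
have [b0 /= h|h] := pickP (fun b => cell b u != 0); last first.
  by left => b; apply/eqP; have := h b => /= /negbFE.
right; exists b0; have : \1_(I b0%:R) u.1.2 != 0 :> R /\ \1_(I 0) u.2 != 0 :> R.
  by move: h; rewrite /cell mulf_eq0 negb_or => /andP[].
rewrite !indicE; case: (boolP (_ \in I b0%:R)); last by rewrite eqxx => _ [].
case: (boolP (u.2 \in I 0)); last by rewrite eqxx => _ _ [].
move=> h0 /[!inE]; rewrite /I /= in_itv /= => /andP[l1 l2] _ b.
rewrite /cell [\1_(I 0) _]indicE h0 mulr1 indicE; congr (_%:R); congr nat_of_bool.
have [->|bb0] := eqVneq b b0; first by rewrite mem_set// /I /= in_itv /= l1 l2.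
apply/negbTE; rewrite notin_setE /I /= in_itv /= => /andP[k1 k2].
have : (b < b0)%N || (b0 < b)%N by rewrite -neq_ltn.
have le n m : (n < m)%N -> n%:R + 1 <= m%:R :> R by move=> nm; rewrite natr1 ler_nat.
by case/orP => /le; lra.
Qed.

Lemma cell_ge0 b u : 0 <= cell b u.
Proof. by rewrite mulr_ge0// indicE. Qed.

Lemma cell_le1 b u : cell b u <= 1.
Proof. by case: (cellP u) => [->//|[b0 ->]]; case: (_ == _). Qed.

Lemma measurable_cell b : measurable_fun [set: R3] (cell b).
Proof.
have mI c : measurable_fun [set: measurableTypeR R] (\1_(I c) : measurableTypeR R -> R).
  by apply: measurable_indic; exact: measurable_itv.
apply: measurable_funM.
  exact: (measurableT_comp (mI _) (measurableT_comp measurable_snd measurable_fst)).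
exact: (measurableT_comp (mI _) measurable_snd).
Qed.

Let I1 c : leb.-integrable setT (EFin \o (\1_(I c) : R -> R)).
Proof. exact: integrable_indic_itv. Qed.

Let E1 c : \int[leb]_t (\1_(I c) t : R) = 1.
Proof.
have l1 : (@lebesgue_measure R `[c, (c + 1)%R[%classic = 1)%E.
  by rewrite lebesgue_measure_itv /= lte_fin ltrDl ltr01 -EFinB addrAC subrr add0r.
rewrite [LHS](_ : _ = \int[leb]_(t in I c) 1); last first.
  by rewrite (Rintegral_indic leb (I c) (fun=> 1)); apply: eq_Rintegral => t _; rewrite mulr1.
rewrite Rintegral_cst; last exact: measurable_itv.
by rewrite mul1r -[RHS]/(fine 1%:E); congr fine; exact: l1.
Qed.

Lemma cell_integrable b (k : R -> R) : leb.-integrable setT (EFin \o k) ->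
  mu3.-integrable setT (EFin \o (fun u : R3 => cell b u * k u.1.1)).
Proof.
move=> Ik; have J : mu2.-integrable setT (EFin \o _) := rint_tensor Ik (I1 b%:R).
have := rint_tensor J (I1 0).
by congr integrable; apply/funext => u /=; rewrite /cell; congr EFin; ring.
Qed.

Lemma cell_integral b (k : R -> R) : leb.-integrable setT (EFin \o k) ->
  \int[mu3]_u (cell b u * k u.1.1) = \int[leb]_t k t.
Proof.
move=> Ik; have J : mu2.-integrable setT (EFin \o _) := rint_tensor Ik (I1 b%:R).
have J3 := rint_tensor J (I1 0).
transitivity (\int[mu3]_u (k u.1.1 * \1_(I b%:R) u.1.2 * \1_(I 0) u.2)).
  by apply: eq_Rintegral => u _; rewrite /cell; ring.
rewrite [LHS](Rfubini1 J3) /=.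
under eq_Rintegral do rewrite RintegralZl ?E1 ?mulr1//.
rewrite [LHS](Rfubini1 J) /=.
by under eq_Rintegral do rewrite RintegralZl ?E1 ?mulr1//.
Qed.

Section Dominated.
Variables (A : R6 -> R[i]) (alpha m : 'I_3 -> R3 -> R).
Hypotheses (mA : cmeasurable A) (mm : forall b, measurable_fun setT (m b)).
Hypothesis alpha0 : forall b r, 0 <= alpha b r.
Hypothesis Ialpha : forall b, mu3.-integrable setT (EFin \o alpha b).
Hypothesis Ale : forall u r,
  sqr_modulus (A (u, r)) <= \sum_b cell b u * (alpha b r * lor (u.1.1 - m b r)).

Let Z b (p : R6) : R := cell b p.1 * (alpha b p.2 * lor (p.1.1.1 - m b p.2)).

Let mZ b : measurable_fun setT (Z b).
Proof.
apply: measurable_funM; first exact: (measurableT_comp (measurable_cell b) measurable_fst).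
apply: measurable_funM; first exact: (measurableT_comp (rint_measurable (Ialpha b)) measurable_snd).
apply: (measurableT_comp (@measurable_lor R)); apply: measurable_funB.
  exact: (measurableT_comp measurable_fst (measurableT_comp measurable_fst measurable_fst)).
exact: (measurableT_comp (mm b) measurable_snd).
Qed.

Let Z0 b p : 0 <= Z b p.
Proof. by rewrite mulr_ge0 ?cell_ge0// mulr_ge0// ltW// lor_gt0. Qed.

Let Ilor (c : R) : leb.-integrable setT (EFin \o (fun t => lor (t - c))).
Proof. exact: (integrable_translate c (@integrable_lor R)). Qed.

Let Zcol b r : mu3.-integrable setT (EFin \o (fun u => Z b (u, r))) /\
  \int[mu3]_u Z b (u, r) = alpha b r * \int[leb]_t lor t.
Proof.
have J := rintZl measurableT (alpha b r) (Ilor (m b r)).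
split; first exact: (cell_integrable b J).
rewrite /Z /= (cell_integral b J) RintegralZl//; congr (_ * _).
exact: (Rintegral_translate (m b r) (@measurable_lor R)).
Qed.

Let IZ b : mu6.-integrable setT (EFin \o Z b).
Proof.
have mS : measurable_fun [set: R6] (fun q : R6 => Z b (q.2, q.1)).
  exact: (measurableT_comp (mZ b) (@measurable_swap _ _ R3 R3)).
have IS : mu6.-integrable setT (EFin \o (fun q : R6 => Z b (q.2, q.1))).
  apply: (@rint_ge0_tonelli _ _ R3 R3 R mu3 mu3) => //.
  have J := rintZr measurableT (\int[leb]_t lor t) (Ialpha b).
  have [_] := integrableP _ _ _ J; apply: le_lt_trans.
  rewrite le_eqVlt; apply/orP; left; apply/eqP; apply: eq_integral => r _.
  have [IZr EZr] := Zcol b r; rewrite /= -EZr ger0_norm; last by apply: Rintegral_ge0 => u _; exact: Z0.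
  by rewrite /Rintegral fineK//; exact: (integrable_fin_num measurableT IZr).
by have := @rint_swap _ _ R3 R3 R mu3 mu3 _ IS; congr integrable; apply/funext => -[u r].
Qed.

(** A translated Lorentzian has the same mass for every centre, so integration over u first controls
    the columns by [alpha b r] whatever [m] is. For the rows, the cell and the Lorentzian are
    bounded by 1. *)
Lemma sliceL2_dominated : sliceL2 A.
Proof.
have dom d (T : measurableType d) (mu : {measure set T -> \bar R}) (F : T -> R[i]) (X : 'I_3 -> T -> R) :
    cmeasurable F -> (forall b, mu.-integrable setT (EFin \o X b)) ->
    (forall x, sqr_modulus (F x) <= \sum_b X b x) -> memL2 mu setT F.
  by move=> mF IX; apply: memL2_le => //; apply: rint_sum.
split => //.
- move=> u; apply: (dom _ _ _ _ (fun b r => Z b (u, r))) => [|b|r]; last exact: Ale.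
    exact: cmeasurable_slice2.
  apply: rint_le (Ialpha b) => //; first exact: (measurable_fun_pair2 u (mZ b)).
  move=> r _; rewrite !ger0_norm ?Z0// /Z /=.
  have := cell_ge0 b u; have := cell_le1 b u; have := alpha0 b r.
  have := lor_gt0 (u.1.1 - m b r); have := lor_le1 (u.1.1 - m b r).
  move: (cell b u) (alpha b r) (lor _) => c x l l1 l0 x0 c1 c0.
  have : x * l <= x by nra.
  have : 0 <= x * l by rewrite mulr_ge0// ltW.
  nra.
- move=> r; apply: (dom _ _ _ _ (fun b u => Z b (u, r))) => [|b|u]; last exact: Ale.
    exact: cmeasurable_slice1.
  by have [] := Zcol b r.
by apply: (dom _ _ _ _ Z) => [//|b|[u r]]; [exact: IZ|exact: Ale].
Qed.

End Dominated.

Lemma measurable_coord3 b : measurable_fun [set: R3] (fun r => coord3 r b).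
Proof.
case: b => -[|[|[|//]]] i; rewrite /coord3 /=.
- exact: (measurableT_comp measurable_fst measurable_fst).
- exact: (measurableT_comp measurable_snd measurable_fst).
exact: measurable_snd.
Qed.

Lemma null_slab b (c : R) : mu3 [set s | coord3 s b = c] = 0%E.
Proof.
have m1 (x : measurableTypeR R) : measurable [set x] by exact: measurable_set1.
have l1 (x : R) : leb [set x] = 0%E by exact: lebesgue_measure_set1.
have mT : measurable [set: measurableTypeR R] by exact: measurableT.
case: b => -[|[|[|//]]] i; rewrite /coord3 /=.
- rewrite (_ : [set s | _] = ([set c] `*` setT) `*` setT); last by apply/seteqP; split => [[[x y] z]|[[x y] z]] //= [[]].
  rewrite [LHS](product_measure1E mu2 leb)//; last exact: measurableX.
  rewrite [X in (X * _)%E](_ : _ = leb [set c] * leb [set: R])%E; last exact: product_measure1E.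
  by rewrite l1 !mul0e.
- rewrite (_ : [set s | _] = (setT `*` [set c]) `*` setT); last by apply/seteqP; split => [[[x y] z]|[[x y] z]] //= [[]].
  rewrite [LHS](product_measure1E mu2 leb)//; last exact: measurableX.
  rewrite [X in (X * _)%E](_ : _ = leb [set: R] * leb [set c])%E; last exact: product_measure1E.
  by rewrite l1 mule0 mul0e.
rewrite (_ : [set s | _] = setT `*` [set c]); last by apply/seteqP; split => [[[x y] z]|[[x y] z]] //= [].
transitivity (mu2 setT * leb [set c])%E; first exact: product_measure1E.
by rewrite l1 mule0.
Qed.

(** The sections of each exceptional set are planes, hence null. For the remaining pairs (r, s) the
    phase difference varies with u1 in every cell. *)
Lemma ae_coord_neq : {ae mu6, forall p, forall b, coord3 p.1 b != coord3 p.2 b}.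
Proof.
have H b : {ae mu6, forall p, coord3 p.1 b != coord3 p.2 b}.
  pose N : set R6 := [set p | coord3 p.1 b = coord3 p.2 b].
  have mN : measurable N.
    have md : measurable_fun [set: R6] (fun p : R6 => coord3 p.1 b - coord3 p.2 b).
      apply: measurable_funB; first exact: (measurableT_comp (measurable_coord3 b) measurable_fst).
      exact: (measurableT_comp (measurable_coord3 b) measurable_snd).
    rewrite (_ : N = setT `&` (fun p : R6 => coord3 p.1 b - coord3 p.2 b) @^-1` [set 0]).
      by apply: md => //; exact: measurable_set1.
    rewrite setTI; apply/seteqP; split => p /=; first by move=> ->; rewrite subrr.
    by move=> /eqP; rewrite subr_eq0 => /eqP.
  exists N; split => //; last by move=> p /= /negP; rewrite negbK => /eqP.
  transitivity (\int[mu3]_r mu3 (xsection N r))%E; first by [].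
  apply: integral0_eq => r _; rewrite (_ : xsection N r = [set s | coord3 s b = coord3 r b]).
    exact: null_slab.
  by apply/seteqP; split => s; rewrite /xsection /= inE.
apply: (ae_imp3 _ (H (inord 0)) (H (inord 1)) (H (inord 2))) => p h0 h1 h2 b.
have : b \in [:: inord 0; inord 1; inord 2].
  by rewrite !inE -!val_eqE /= !inordK//; case: b => -[|[|[|//]]].
by rewrite !inE => /or3P[] /eqP ->.
Qed.

End Cells.

Section Factor.
Local Open Scope complex_scope.
Variable R : realType.
Local Notation R3 := (R3 R).
Local Notation R6 := (R6 R).
Local Notation mu3 := (mu3 R).
Local Notation mu6 := (mu6 R).
Local Notation leb := (@lebesgue_measure R).

(** This is exp(-i x). As the current is built from -i times the gradient of the conjugate of G, the
    phase exp(-i L t r_b) contributes +L t. *)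
Definition cis (x : R) : R[i] := cos x +i* (- sin x).

Lemma sqr_modulus_cis x : sqr_modulus (cis x) = 1.
Proof. by rewrite /sqr_modulus /= sqrrN cos2Dsin2. Qed.

Lemma conj_cisM x y : (cis x)^*%C * cis y = cis (y - x).
Proof. by apply: complex_eq; rewrite ?ReM ?ImM /= ?cosB ?sinB; ring. Qed.

Lemma measurable_cos : measurable_fun [set: R] (@cos R).
Proof. by apply: continuous_measurable_fun; exact: continuous_cos. Qed.

Lemma measurable_sin : measurable_fun [set: R] (@sin R).
Proof. by apply: continuous_measurable_fun; exact: continuous_sin. Qed.

Section Mix.
Implicit Types F : 'I_3 -> R -> R3 -> R[i].

(** The cells are disjoint, so at most one summand is present at each u and products of mixtures
    have no cross terms between directions. *)
Definition mix F (p : R6) : R[i] := \sum_b (cell b p.1)%:C * F b p.1.1.1 p.2.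

Lemma mix_cell0 F u r : (forall b, cell b u = 0) -> mix F (u, r) = 0.
Proof. by move=> c0; rewrite /mix big1// => b _; rewrite c0 mul0r. Qed.

Lemma mix_cell1 F u r b0 : (forall b, cell b u = (b == b0)%:R) -> mix F (u, r) = F b0 u.1.1 r.
Proof.
move=> c1; rewrite /mix (bigD1 b0)//= c1 eqxx mul1r big1 ?addr0// => b /negbTE bb0.
by rewrite c1 bb0 mul0r.
Qed.

Lemma sum_cell1 (u : R3) (b0 : 'I_3) (X : 'I_3 -> R) : (forall b, cell b u = (b == b0)%:R) ->
  \sum_b cell b u * X b = X b0.
Proof.
move=> c1; rewrite (bigD1 b0)//= c1 eqxx mul1r big1 ?addr0// => b /negbTE bb0.
by rewrite c1 bb0 mul0r.
Qed.

Lemma sum_cell0 (u : R3) (X : 'I_3 -> R) : (forall b, cell b u = 0) -> \sum_b cell b u * X b = 0.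
Proof. by move=> c0; rewrite big1// => b _; rewrite c0 mul0r. Qed.

Lemma sqr_modulus_mix F u r :
  sqr_modulus (mix F (u, r)) = \sum_b cell b u * sqr_modulus (F b u.1.1 r).
Proof.
have [c0|[b0 c1]] := cellP u; first by rewrite sum_cell0// mix_cell0// sqr_modulus_real expr0n.
by rewrite (mix_cell1 _ _ c1) (sum_cell1 _ c1).
Qed.

Lemma mix_conjM F F' u r s : (mix F (u, r))^*%C * mix F' (u, s) =
  (\sum_b cell b u * complex.Re ((F b u.1.1 r)^*%C * F' b u.1.1 s)) +i*
  (\sum_b cell b u * complex.Im ((F b u.1.1 r)^*%C * F' b u.1.1 s)).
Proof.
have [c0|[b0 c1]] := cellP u; last first.
  by rewrite !(mix_cell1 _ _ c1) !(sum_cell1 _ c1); exact: complex_eq.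
by rewrite !mix_cell0// !sum_cell0// mulr0.
Qed.

Lemma mix_cmeasurable F :
  (forall b, @cmeasurable R _ (measurableTypeR R * R3)%type (fun q => F b q.1 q.2)) ->
  cmeasurable (mix F).
Proof.
move=> mF; apply: cmeasurable_sum => b; apply: cmeasurableM.
  by apply: cmeasurable_real; exact: (measurableT_comp (measurable_cell b) measurable_fst).
have mt : measurable_fun [set: R6] (fun p : R6 => (p.1.1.1 : measurableTypeR R, p.2)).
  apply: measurable_fun_pair; last exact: measurable_snd.
  exact: (measurableT_comp measurable_fst (measurableT_comp measurable_fst measurable_fst)).
by have [F1 F2] := mF b; split; [exact: (measurableT_comp F1 mt)|exact: (measurableT_comp F2 mt)].
Qed.

End Mix.

Variables (f : R3 -> R) (df : 'I_3 -> R3 -> R).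
Variables (kappa : 'I_3 -> R3 -> R) (dk : 'I_3 -> 'I_3 -> R3 -> R) (L : R).
Hypothesis (fdf : forall a, is_wpartial a f (df a)).
Hypothesis (kdk : forall a b, is_wpartial a (kappa b) (dk a b)).
Hypothesis If : mu3.-integrable setT (EFin \o (fun r => f r ^+ 2)).
Hypothesis Idf : forall a, mu3.-integrable setT (EFin \o (fun r => df a r ^+ 2)).
Hypothesis Ik : forall b, mu3.-integrable setT (EFin \o (fun r => f r ^+ 2 * kappa b r ^+ 2)).
Hypothesis Idk : forall a b, mu3.-integrable setT (EFin \o (fun r => f r ^+ 2 * dk a b r ^+ 2)).
Hypothesis L0 : 0 < L.

(* Centering the profile at [shift b] makes the mean of [L * u1] in cell [b] equal
   to [3 / 2 * kappa b]; each cell carries a third of the mass. *)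
Definition shift b r : R := 3 / (2 * L) * kappa b r.

Definition piece b t r : R[i] := cis (L * t * coord3 r b) * (f r * prof (t - shift b r))%:C.

(** The phase is kept as a factor. In the other factor the real part comes from differentiating the
    amplitude and the imaginary part from differentiating the phase. *)
Definition dpiece a b t r : R[i] := cis (L * t * coord3 r b) *
  ((df a r * prof (t - shift b r) - f r * dprof (t - shift b r) * (3 / (2 * L)) * dk a b r) +i*
   (- (L * t * (a == b)%:R * f r * prof (t - shift b r)))).

Definition factor : R6 -> R[i] := mix piece.
Definition dfactor (a : 'I_3) : R6 -> R[i] := mix (dpiece a).

Let mf : measurable_fun [set: R3] f.
Proof. by case: (fdf ord0) => /L1loc3_measurable. Qed.
Let mdf a : measurable_fun [set: R3] (df a).
Proof. by case: (fdf a) => _ /L1loc3_measurable. Qed.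
Let mk b : measurable_fun [set: R3] (kappa b).
Proof. by case: (kdk ord0 b) => /L1loc3_measurable. Qed.
Let mdk a b : measurable_fun [set: R3] (dk a b).
Proof. by case: (kdk a b) => _ /L1loc3_measurable. Qed.

Lemma measurable_shift b : measurable_fun [set: R3] (shift b).
Proof. exact: measurable_funM. Qed.

Local Notation TR := (measurableTypeR R * R3)%type.
Let m2 (h : R3 -> R) : measurable_fun [set: R3] h -> measurable_fun [set: TR] (fun q : TR => h q.2).
Proof. by move=> mh; exact: (measurableT_comp mh measurable_snd). Qed.
Let mt : measurable_fun [set: TR] (fun q : TR => q.1 : R).
Proof. exact: measurable_fst. Qed.
Let mcis b : @cmeasurable R _ TR (fun q => cis (L * q.1 * coord3 q.2 b)).
Proof.
have mth : measurable_fun [set: TR] (fun q : TR => L * (q.1 : R) * coord3 q.2 b).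
  by apply: measurable_funM; [exact: measurable_funM|exact: (m2 (measurable_coord3 b))].
split; first exact: (measurableT_comp measurable_cos mth).
by apply: (measurableT_comp (@oppr_measurable R setT)); exact: (measurableT_comp measurable_sin mth).
Qed.
Let mdiff b : measurable_fun [set: TR] (fun q : TR => (q.1 : R) - shift b q.2).
Proof. by apply: measurable_funB => //; exact: (m2 (measurable_shift b)). Qed.
Let mprofs b : measurable_fun [set: TR] (fun q : TR => prof ((q.1 : R) - shift b q.2)).
Proof. exact: (measurableT_comp (@measurable_prof R) (mdiff b)). Qed.
Let mdprofs b : measurable_fun [set: TR] (fun q : TR => dprof ((q.1 : R) - shift b q.2)).
Proof. exact: (measurableT_comp (@measurable_dprof R) (mdiff b)). Qed.

Lemma factor_cmeasurable : cmeasurable factor.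
Proof.
apply: mix_cmeasurable => b; apply: cmeasurableM; first exact: mcis.
by apply: cmeasurable_real; apply: measurable_funM; [exact: m2|exact: mprofs].
Qed.

Lemma dfactor_cmeasurable a : cmeasurable (dfactor a).
Proof.
apply: mix_cmeasurable => b; apply: cmeasurableM; first exact: mcis.
split => /=.
  apply: measurable_funB; first by apply: measurable_funM; [exact: (m2 (mdf a))|exact: mprofs].
  apply: measurable_funM; last exact: (m2 (mdk a b)).
  apply: measurable_funM => //.
  by apply: measurable_funM; [exact: m2|exact: mdprofs].
apply: (measurableT_comp (@oppr_measurable R setT)).
apply: measurable_funM; last exact: mprofs.
apply: measurable_funM; last exact: m2.
by apply: measurable_funM => //; exact: measurable_funM.
Qed.

Lemma sqr_modulus_piece b t r :
  sqr_modulus (piece b t r) = f r ^+ 2 * prof (t - shift b r) ^+ 2.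
Proof. by rewrite sqr_modulusM sqr_modulus_cis mul1r sqr_modulus_real exprMn. Qed.

Lemma factor_sliceL2 : sliceL2 factor.
Proof.
apply: (@sliceL2_dominated R _ (fun _ r => amp R ^+ 2 * f r ^+ 2) shift).
- exact: factor_cmeasurable.
- exact: measurable_shift.
- by move=> b r; rewrite mulr_ge0 ?sqr_ge0.
- by move=> b; exact: rintZl.
move=> u r; rewrite sqr_modulus_mix; apply: ler_sum => b _.
rewrite ler_wpM2l ?cell_ge0// sqr_modulus_piece.
by apply: le_trans (ler_wpM2l (sqr_ge0 (f r)) (prof2_le _)) _; rewrite mulrCA mulrA.
Qed.

(** Write u1 = s + c kappa_b, with s measured from the centre of the profile. The phase gradient
    then splits into a part with s^2 prof^2, bounded by the Lorentzian, and a part weighted by f^2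
    kappa_b^2; the square of a sum is at most twice the sum of the squares. *)
Lemma dfactor_sliceL2 a : sliceL2 (dfactor a).
Proof.
pose c := 3 / (2 * L).
apply: (@sliceL2_dominated R _ (fun b r => amp R ^+ 2 * (2 * df a r ^+ 2 +
   (2 * c ^+ 2 * (f r ^+ 2 * dk a b r ^+ 2) +
   (2 * L ^+ 2 * f r ^+ 2 + 2 * L ^+ 2 * c ^+ 2 * (f r ^+ 2 * kappa b r ^+ 2))))) shift).
- exact: dfactor_cmeasurable.
- exact: measurable_shift.
- by move=> b r; do ![exact: sqr_ge0|exact: ler0n|apply: mulr_ge0|apply: addr_ge0].
- by move=> b; do ![apply: rintZl => //|apply: rintD => //].
move=> u r; rewrite sqr_modulus_mix; apply: ler_sum => b _.
rewrite ler_wpM2l ?cell_ge0// sqr_modulusM sqr_modulus_cis mul1r /sqr_modulus /=.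
set t := u.1.1; set s := t - shift b r; rewrite -/c.
have ts : t = s + c * kappa b r by rewrite /s /shift -/c subrK.
have d0 : 0 <= ((a == b)%:R : R) /\ ((a == b)%:R : R) <= 1.
  by case: (a == b); split; rewrite ?ler01 ?lexx.
have p1 := prof2_le s; have p2 := sqr_prof2_le s; have p3 := dprof2_le s.
rewrite ts; move: ((a == b)%:R : R) d0 => e [e0 e1].
move: (df a r) (f r) (dk a b r) (kappa b r) (prof s) (dprof s) (lor s) (amp R) p1 p2 p3 (lor_gt0 s) =>
  x y z k p q l A p1 p2 p3 l0.
have h1 : (x * p - y * q * c * z) ^+ 2 <= 2 * x ^+ 2 * (A ^+ 2 * l) + 2 * c ^+ 2 * (y ^+ 2 * z ^+ 2) * (A ^+ 2 * l).
  apply: (@le_trans _ _ (2 * x ^+ 2 * p ^+ 2 + 2 * c ^+ 2 * (y ^+ 2 * z ^+ 2) * q ^+ 2)).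
    by rewrite -subr_ge0 (_ : _ - _ = (x * p + y * q * c * z) ^+ 2) ?sqr_ge0//; ring.
  by apply: lerD; apply: ler_wpM2l => //; do ![exact: sqr_ge0|exact: ler0n|apply: mulr_ge0].
have h2 : (- (L * (s + c * k) * e * y * p)) ^+ 2 <=
    2 * L ^+ 2 * y ^+ 2 * (A ^+ 2 * l) + 2 * L ^+ 2 * c ^+ 2 * (y ^+ 2 * k ^+ 2) * (A ^+ 2 * l).
  apply: (@le_trans _ _ (2 * L ^+ 2 * y ^+ 2 * (s ^+ 2 * p ^+ 2) + 2 * L ^+ 2 * c ^+ 2 * (y ^+ 2 * k ^+ 2) * p ^+ 2)).
    apply: (@le_trans _ _ ((L * (s + c * k) * y * p) ^+ 2)).
      rewrite sqrrN (_ : L * (s + c * k) * e * y * p = e * (L * (s + c * k) * y * p)); last by ring.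
      by rewrite exprMn ler_piMl ?sqr_ge0// exprn_ile1.
    by rewrite -subr_ge0 (_ : _ - _ = (L * y * p * (s - c * k)) ^+ 2) ?sqr_ge0//; ring.
  by apply: lerD; apply: ler_wpM2l => //; do ![exact: sqr_ge0|exact: ler0n|apply: mulr_ge0].
apply: le_trans (lerD h1 h2) _; rewrite le_eqVlt; apply/orP; left; apply/eqP; ring.
Qed.

Lemma col2_factor r : col2 factor r = f r ^+ 2.
Proof.
rewrite /col2 /norm2; under eq_Rintegral do rewrite sqr_modulus_mix.
have J b := rintZl measurableT (f r ^+ 2) (integrable_prof2 (shift b r)).
rewrite (Rintegral_sum measurableT) => [|b _]; last first.
  have := cell_integrable b (J b); congr integrable; apply/funext => u /=.
  by rewrite sqr_modulus_piece.
rewrite (eq_bigr (fun=> f r ^+ 2 * (1 / 3))) => [|b _].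
  by rewrite big_const !iter_addr_0 card_ord -mulr_natr; field.
under eq_Rintegral do rewrite sqr_modulus_piece.
by rewrite (cell_integral b (J b)) RintegralZl ?Rintegral_prof2//; exact: integrable_prof2.
Qed.

Lemma gram_factor_diag r : gram factor factor (r, r) = (f r ^+ 2)%:C.
Proof.
rewrite -col2_factor /col2 /norm2 -cint_real gramE /inner; apply: eq_cint => u _ /=.
by rewrite mulConj.
Qed.

(** The phases cancel, and the amplitude gradient enters the imaginary part only. Cell [a] alone
    contributes: L f^2 times the first moment [shift] / 3, which is f^2 kappa_a / 2. *)
Lemma current_factor a r : complex.Re (cint mu3 setT (fun u : R3 =>
    - 'i%C * (dfactor a (u, r))^*%C * factor (u, r))) = 1 / 2 * f r ^+ 2 * kappa a r.
Proof.
pose k b t := L * (a == b)%:R * f r ^+ 2 * (t * prof (t - shift b r) ^+ 2).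
have J b : leb.-integrable setT (EFin \o k b) by apply: rintZl => //; exact: integrable_moment.
have E u : complex.Re (- 'i%C * (dfactor a (u, r))^*%C * factor (u, r)) = \sum_b cell b u * k b u.1.1.
  have [c0|[b0 c1]] := cellP u; first by rewrite sum_cell0// /dfactor /factor !mix_cell0// mulr0.
  rewrite (sum_cell1 _ c1) /dfactor /factor !(mix_cell1 _ _ c1) /dpiece /piece conjM.
  set z := cis _; have zz : z^*%C * z = 1 by rewrite mulConj sqr_modulus_cis.
  have rg (i z1 w1 z2 v : R[i]) : i * (z1 * w1) * (z2 * v) = (z1 * z2) * (i * w1 * v) by ring.
  by rewrite rg zz mul1r !ReM !ImM /= /k; ring.
rewrite /=; under eq_Rintegral do rewrite E.
rewrite (Rintegral_sum measurableT) => [|b _]; last exact: cell_integrable.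
rewrite (bigD1 a)//= big1 ?addr0 => [|b ba]; rewrite (cell_integral _ (J _)) /k.
  rewrite RintegralZl ?Rintegral_moment ?eqxx ?mulr1; [|by []|exact: integrable_moment].
  by rewrite /shift; field; rewrite gt_eqF.
rewrite eq_sym (negbTE ba) mulr0 mul0r; under eq_Rintegral do rewrite mul0r.
by rewrite Rintegral_cst// mul0r.
Qed.

Lemma lipschitz_of_derive (F dF : R -> R) (C : R) : (forall x : R, is_derive x 1 F (dF x)) ->
  (forall x, `|dF x| <= C) -> forall x y, `|F x - F y| <= C * `|x - y|.
Proof.
move=> dFF dC x y; wlog xy : x y / x <= y.
  by move=> W; have [xy|/ltW yx] := leP x y; [exact: W|rewrite distrC [`|x - y|]distrC; exact: W].
have cF : {within `[x, y], continuous F}.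
  apply: continuous_subspaceT => z; apply/differentiable_continuous/derivable1_diffP.
  by have [] := dFF z.
have [c _ E] := MVT_segment xy (fun z _ => dFF z) cF.
by rewrite distrC E normrM [`|x - y|]distrC ler_wpM2r.
Qed.

Lemma coord_ac_lines (a b : 'I_3) :
  ac_lines (unit_vec R a) (fun r : R3 => coord3 r b) (fun=> (a == b)%:R).
Proof.
have CL (h : R) (v x : R3) : coord3 (h *: v + x) b = h *: coord3 v b + coord3 x b.
  by case: b => -[|[|[|//]]].
have cc : continuous (fun r : R3 => coord3 r b).
  case: b {CL} => -[|[|[|//]]] i r; rewrite /coord3 /=.
  - by apply: (@cvg_comp _ _ _ fst fst (nbhs r) (nbhs r.1)); exact: cvg_fst.
  - by apply: (@cvg_comp _ _ _ fst snd (nbhs r) (nbhs r.1)); [exact: cvg_fst|exact: cvg_snd].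
  - exact: cvg_snd.
have D x : 'D_(unit_vec R a) (fun r : R3 => coord3 r b) x = (a == b)%:R.
  have [-> _] := @derive_affine R R3 R (fun r : R3 => coord3 r b) (fun r => coord3 r b) CL id (unit_vec R a) x.
  rewrite derive_id; case: a b {CL cc} => [i ilt] [j jlt].
  by rewrite -val_eqE /=; case: j jlt => [|[|[|//]]].
have dc x : derivable (fun r : R3 => coord3 r b) x (unit_vec R a).
  have [_ [_ h]] := @derive_affine R R3 R (fun r : R3 => coord3 r b) (fun r => coord3 r b) CL id (unit_vec R a) x.
  by apply: h; exact: derivable_id.
rewrite -[X in ac_lines _ _ X](_ : 'D_(unit_vec R a) (fun r : R3 => coord3 r b) = _); last exact/funext.
apply: ac_lines_C1 => //.
by rewrite (funext D) => x; exact: cvg_cst.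
Qed.

Let scaled_derive (Phi dPhi : R -> R) (k c : R) : (forall x : R, is_derive x 1 Phi (dPhi x)) ->
  forall x : R, is_derive x 1 (fun x => Phi (c + k * x)) (k * dPhi (c + k * x)).
Proof.
move=> dP x.
have d1 : is_derive x 1 (fun x : R => c + k * x) k.
  have d0 := is_deriveD (is_derive_cst c x (1 : R)) (is_deriveZ k (is_derive_id x (1 : R))).
  by apply: (is_derive_eq d0); rewrite add0r [_ *: _]mulr1.
by apply: (is_derive_eq (@is_derive1_comp R Phi (fun x => c + k * x) x _ _ (dP _) d1)); rewrite mulrC.
Qed.

Lemma ac_lines_scaled (e : R3) (g dg : R3 -> R) (Phi dPhi : R -> R) (k c M : R) :
  ac_lines e g dg -> (forall x : R, is_derive x 1 Phi (dPhi x)) -> 0 <= M ->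
  (forall x y, `|dPhi x - dPhi y| <= M * `|x - y|) ->
  ac_lines e (fun r => Phi (c + k * g r)) (fun r => k * dPhi (c + k * g r) * dg r).
Proof.
move=> ag dP M0 lP.
apply: (@ac_lines_chain R e g dg (fun x => Phi (c + k * x)) (fun x => k * dPhi (c + k * x)) (k ^+ 2 * M) ag).
- exact: scaled_derive dP.
- by rewrite mulr_ge0// sqr_ge0.
move=> x y; rewrite -mulrBr normrM -(real_normK (num_real k)) expr2 -!mulrA ler_wpM2l//.
apply: le_trans (lP _ _) _; rewrite (_ : c + k * x - (c + k * y) = k * (x - y)); last by ring.
by rewrite normrM mulrCA.
Qed.

Lemma L1loc3_sqr (h : R3 -> R) : measurable_fun setT h ->
  mu3.-integrable setT (EFin \o (fun r => h r ^+ 2)) -> L1loc3 h.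
Proof.
move=> mh Ih K cK; have [n Kn] := compact_sub_cbox cK; set B := cbox _ _ in Kn.
have IB := @integrable_indic_cbox R ((- n%:R, - n%:R), - n%:R) ((n%:R, n%:R), n%:R).
have mK := compact_measurable3 cK.
apply/(rint_indic mu3 mK); apply: (rint_le measurableT _ _ (rintD measurableT Ih IB)).
  by apply: measurable_funM => //; exact: measurable_indic.
move=> r _; rewrite [leRHS]ger0_norm ?addr_ge0 ?sqr_ge0 ?indicE//.
rewrite normrM; case: (boolP (r \in K)) => Kr; last by rewrite normr0 mul0r addr_ge0 ?sqr_ge0.
have Br : B r by apply: Kn; rewrite inE in Kr.
rewrite normr1 mul1r mem_set//; have -> : (true%:R : R) = 1 by [].
rewrite -(real_normK (num_real (h r))); move: `|h r| => x.
by have := sqr_ge0 (x - 1); have := sqr_ge0 x; nra.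
Qed.

Lemma L1loc3_memL2 F : memL2 mu3 setT F ->
  L1loc3 (fun r => complex.Re (F r)) /\ L1loc3 (fun r => complex.Im (F r)).
Proof.
move=> /memL2P[[F1 F2] IF]; split.
  apply: (L1loc3_sqr F1); apply: (rint_le measurableT _ _ IF); first exact: measurable_funX.
  by move=> r _; rewrite !ger0_norm ?sqr_ge0 ?sqr_modulus_ge0// lerDl sqr_ge0.
apply: (L1loc3_sqr F2); apply: (rint_le measurableT _ _ IF); first exact: measurable_funX.
by move=> r _; rewrite !ger0_norm ?sqr_ge0 ?sqr_modulus_ge0// lerDr sqr_ge0.
Qed.

Lemma is_wpartial0 a : is_wpartial a (fun=> 0 : R) (fun=> 0 : R).
Proof.
have L0' : @L1loc3 R (fun=> 0) by move=> K cK; exact: rint0.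
split => // phi _; under eq_Rintegral do rewrite mul0r.
by under [in RHS]eq_Rintegral do rewrite mul0r; rewrite Rintegral_cst// mul0r oppr0.
Qed.

(** Real and imaginary parts are products of f, the translated profile, and cos or -sin of the
    phase, each absolutely continuous on lines. Local integrability, known from the L^2 bounds,
    leads back to the weak derivative. Off the cells everything is 0. *)
Lemma factor_wpartial a u : cwpartial a (fun r => factor (u, r)) (fun r => dfactor a (u, r)).
Proof.
have [_ Fu _ _] := factor_sliceL2; have [_ dFu _ _] := dfactor_sliceL2 a.
have [F1 F2] := L1loc3_memL2 (Fu u); have [D1 D2] := L1loc3_memL2 (dFu u).
have [c0|[b c1]] := cellP u.
  have E1 (F : 'I_3 -> R -> R3 -> R[i]) : (fun r => complex.Re (mix F (u, r))) = fun=> 0.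
    by apply/funext => r; rewrite mix_cell0.
  have E2 (F : 'I_3 -> R -> R3 -> R[i]) : (fun r => complex.Im (mix F (u, r))) = fun=> 0.
    by apply/funext => r; rewrite mix_cell0.
  by split; rewrite /factor /dfactor ?E1 ?E2; exact: is_wpartial0.
set t := u.1.1; set c := 3 / (2 * L).
have lip1 (F dF : R -> R) : (forall x : R, is_derive x 1 F (dF x)) -> (forall x, `|dF x| <= 1) ->
    forall x y, `|F x - F y| <= 1 * `|x - y| by exact: lipschitz_of_derive.
have ncos (x : R) : `|cos x| <= 1 by rewrite ler_norml cos_geN1 cos_le1.
have nsin (x : R) : `|sin x| <= 1 by rewrite ler_norml sin_geN1 sin_le1.
have nNsin (x : R) : `|- sin x| <= 1 by rewrite normrN.
have dNsin (x : R) : is_derive x 1 (fun x => - sin x) (- cos x) by exact: is_deriveN.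
have aP : ac_lines (unit_vec R a) (fun r => prof (t + - c * kappa b r))
    (fun r => - c * dprof (t + - c * kappa b r) * dk a b r).
  apply: (ac_lines_scaled _ _ (is_wpartial_ac_lines (kdk a b)) (@is_derive_prof R) _ (@dprof_lip R)).
  by rewrite mulr_ge0// ltW// amp_gt0.
have afP := ac_lines_mul (is_wpartial_ac_lines (fdf a)) aP.
have acos : ac_lines (unit_vec R a) (fun r => cos (0 + L * t * coord3 r b))
    (fun r => L * t * - sin (0 + L * t * coord3 r b) * (a == b)%:R).
  apply: (ac_lines_scaled _ _ (coord_ac_lines a b) (@is_derive_cos R) ler01).
  apply: (lip1 _ (fun x => - cos x)) => // x; by rewrite normrN.
have asin : ac_lines (unit_vec R a) (fun r => - sin (0 + L * t * coord3 r b))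
    (fun r => L * t * - cos (0 + L * t * coord3 r b) * (a == b)%:R).
  apply: (ac_lines_scaled _ _ (coord_ac_lines a b) dNsin ler01).
  by apply: (lip1 _ (fun x => - - sin x)) => // x; rewrite ?normrN.
have G1 r : factor (u, r) = piece b t r by exact: mix_cell1.
have G2 r : dfactor a (u, r) = dpiece a b t r by exact: mix_cell1.
have sE r : t + - c * kappa b r = t - shift b r by rewrite mulNr.
split; apply: ac_lines_is_wpartial => //.
  have := ac_lines_mul afP acos; congr ac_lines; apply/funext => r.
    by rewrite G1 /piece ReM /= sE add0r; ring.
  by rewrite G2 /dpiece ReM /= sE add0r -/c; ring.
have := ac_lines_mul afP asin; congr ac_lines; apply/funext => r.
  by rewrite G1 /piece ImM /= sE add0r; ring.
by rewrite G2 /dpiece ImM /= sE add0r -/c; ring.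
Qed.

End Factor.

(** * Hilbert-Schmidt norm and the upper bound on the density matrix *)

Section OperatorBound.
Local Open Scope complex_scope.
Variable R : realType.
Local Notation R3 := (R3 R).
Local Notation R6 := (R6 R).
Local Notation mu3 := (mu3 R).
Local Notation mu6 := (mu6 R).
Local Notation leb := (@lebesgue_measure R).

Lemma scaled_am_gm (c x y z : R) : 0 < c ->
  x * y * z <= 1 / 2 * c * y ^+ 2 + 1 / 2 * c^-1 * (x ^+ 2 * z ^+ 2).
Proof.
move=> c0; have c1 : 0 < c^-1 by rewrite invr_gt0.
have ce : c * c^-1 = 1 by rewrite mulfV ?gt_eqF.
have h := mulr_ge0 (ltW c1) (sqr_ge0 (c * y - x * z)); move: c^-1 ce h => e ce.
have -> : e * (c * y - x * z) ^+ 2 = (c * e) * c * y ^+ 2 - 2 * (c * e) * (x * y * z) + e * (x ^+ 2 * z ^+ 2) by ring.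
rewrite ce; lra.
Qed.

(** The optimal choice is c = F. For F = 0 a positive K would contradict the inequality at c = K. *)
Lemma le_of_scaled_am_gm (K F : R) : 0 <= F ->
  (forall c : R, 0 < c -> K <= 1 / 2 * c + 1 / 2 * c^-1 * F ^+ 2) -> K <= F.
Proof.
rewrite le_eqVlt => /orP[/eqP <-|F0] key.
  by rewrite leNgt; apply/negP => h; have := key _ h; rewrite expr0n mulr0; lra.
have := key _ F0; rewrite (_ : 1 / 2 / F * F ^+ 2 = 1 / 2 * F); first by lra.
by field; rewrite gt_eqF.
Qed.

(** The operator norm is at most the Hilbert-Schmidt norm: weighted AM-GM between |D(r, s)| and
    |f(r) f(s)|, then optimisation over the weight. *)
Lemma kform_le_norm2 (D : R6 -> R[i]) (f : R3 -> R[i]) : memL2 mu6 setT D ->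
  \int[mu6]_p sqr_modulus (D p) <= 1 -> memL2 mu3 setT f ->
  complex.Re (kform setT D f) <= norm2 f.
Proof.
move=> LD D1 Lf; have [_ If] := (memL2P _ _).1 Lf; have [_ ID] := (memL2P _ _).1 LD.
have IT : mu6.-integrable setT (EFin \o (fun p => sqr_modulus (f p.1) * sqr_modulus (f p.2))).
  exact: (rint_tensor If If).
have ET : \int[mu6]_p (sqr_modulus (f p.1) * sqr_modulus (f p.2)) = norm2 f ^+ 2.
  rewrite [LHS](Rfubini1 IT) /=; under eq_Rintegral do rewrite RintegralZl//.
  by rewrite RintegralZr.
have [IK _] := cintegrable_kform LD Lf.
apply: le_of_scaled_am_gm => [|c c0]; first exact: norm2_ge0.
have c1 : 0 < c^-1 by rewrite invr_gt0.
have J1 := rintZl measurableT (1 / 2 * c) ID; have J2 := rintZl measurableT (1 / 2 * c^-1) IT.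
rewrite /kform setXTT /=.
apply: (@le_trans _ _ (\int[mu6]_p (1 / 2 * c * sqr_modulus (D p) +
   1 / 2 * c^-1 * (sqr_modulus (f p.1) * sqr_modulus (f p.2))))).
  apply: le_Rintegral => //; first exact: rintD.
  move=> p _; apply: le_trans (ler_norm _) _; apply: le_trans (Re_le_modulus _) _.
  rewrite !modulusM modulus_conj -!sqr_modulusE.
  exact: scaled_am_gm.
rewrite RintegralD// RintegralZl// RintegralZl// ET lerD2r.
by rewrite -[leRHS]mulr1 ler_wpM2l// mulr_ge0// ltW.
Qed.

Section HilbertSchmidt.
Variables (f : R3 -> R) (kappa : 'I_3 -> R3 -> R).

(** The right-hand side of [oscillatory_bound] as a function of the half period. *)
Let qq (d : R) : R := ((1 + `|d| + d ^+ 2) ^+ 2 - 1) / 6.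

(** In cell b the integrand is f(r) f(s) exp(-i L (s_b - r_b) t) times two translated profiles, with
    half period pi / (L (s_b - r_b)). Real and imaginary part each obey the oscillatory bound, which
    accounts for the factor 2. *)
Lemma gram_factor_le (L : R) r s : 0 < L -> (forall b, coord3 r b != coord3 s b) ->
  sqr_modulus (gram (factor f kappa L) (factor f kappa L) (r, s)) <=
  2 * (f r ^+ 2 * f s ^+ 2) * (\sum_b qq (pi / (L * (coord3 s b - coord3 r b)))) ^+ 2.
Proof.
move=> L0 rs; pose w b t := prof (t - shift kappa L b r) * prof (t - shift kappa L b s).
have lam0 b : L * (coord3 s b - coord3 r b) != 0.
  by apply: mulf_neq0; [rewrite gt_eqF|rewrite subr_eq0 eq_sym].
set S := \sum_b _.
have bound (k : 'I_3 -> R -> R) : (forall b, measurable_fun setT (k b)) -> (forall b t, `|k b t| <= 1) ->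
    (forall b t, k b (t + pi / (L * (coord3 s b - coord3 r b))) = - k b t) ->
    `|\int[mu3]_u \sum_b cell b u * (f r * f s * (k b u.1.1 * w b u.1.1))| <= `|f r * f s| * S.
  move=> mk k1 kd.
  have J b := rintZl measurableT (f r * f s) (integrable_overlap (shift kappa L b r) (shift kappa L b s) (mk b) (k1 b)).
  rewrite (Rintegral_sum measurableT) => [|b _]; last exact: (cell_integrable b (J b)).
  apply: le_trans (ler_norm_sum _ _ _) _; rewrite mulr_sumr; apply: ler_sum => b _.
  rewrite (cell_integral b (J b)) RintegralZl//; last exact: integrable_overlap.
  by rewrite normrM ler_wpM2l//; apply: oscillatory_bound.
pose X b t := (piece f kappa L b t r)^*%C * piece f kappa L b t s.
have XE b t : X b t = cis (L * (coord3 s b - coord3 r b) * t) * (f r * f s * w b t)%:C.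
  rewrite /X /piece conjM conj_real.
  have rg (x y z v : R[i]) : (x * y) * (z * v) = (x * z) * (y * v) by ring.
  rewrite rg conj_cisM -rmorphM/=; congr (cis _ * _); first by ring.
  by apply: complex_eq; rewrite //= /w; ring.
have -> : gram (factor f kappa L) (factor f kappa L) (r, s) =
    (\int[mu3]_u \sum_b cell b u * complex.Re (X b u.1.1)) +i*
    (\int[mu3]_u \sum_b cell b u * complex.Im (X b u.1.1)).
  by rewrite gramE /inner /=; apply: complex_eq => /=; apply: eq_Rintegral => u _; rewrite mix_conjM.
have mlin (c : R) : measurable_fun [set: R] (fun t : R => c * t) by exact: measurable_funM.
have dE b t : L * (coord3 s b - coord3 r b) * (t + pi / (L * (coord3 s b - coord3 r b))) =
    L * (coord3 s b - coord3 r b) * t + pi.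
  by rewrite mulrDr; congr (_ + _); rewrite mulrC divfK.
have b1 := bound (fun b t => cos (L * (coord3 s b - coord3 r b) * t)).
have b2 := bound (fun b t => - sin (L * (coord3 s b - coord3 r b) * t)).
have {}b1 : `|\int[mu3]_u \sum_b cell b u * complex.Re (X b u.1.1)| <= `|f r * f s| * S.
  rewrite (_ : \int[mu3]_u _ = \int[mu3]_u \sum_b cell b u * (f r * f s * (cos (L * (coord3 s b - coord3 r b) * u.1.1) * w b u.1.1))).
    apply: b1 => b; first exact: (measurableT_comp (@measurable_cos R) (mlin _)).
      by move=> t; rewrite ler_norml cos_geN1 cos_le1.
    by move=> t; rewrite dE cosDpi.
  apply: eq_Rintegral => u _; apply: eq_bigr => b _; rewrite XE ReM /=; ring.
have {}b2 : `|\int[mu3]_u \sum_b cell b u * complex.Im (X b u.1.1)| <= `|f r * f s| * S.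
  rewrite (_ : \int[mu3]_u _ = \int[mu3]_u \sum_b cell b u * (f r * f s * (- sin (L * (coord3 s b - coord3 r b) * u.1.1) * w b u.1.1))).
    apply: b2 => b.
    - apply: (measurableT_comp (@oppr_measurable R setT)).
      exact: (measurableT_comp (@measurable_sin R) (mlin _)).
    - by move=> t; rewrite normrN ler_norml sin_geN1 sin_le1.
    - by move=> t; rewrite dE sinDpi opprK.
  apply: eq_Rintegral => u _; apply: eq_bigr => b _; rewrite XE ImM /=; ring.
have sq (A B C : R) : `|A| <= C -> `|B| <= C -> sqr_modulus (A +i* B) <= C ^+ 2 + C ^+ 2.
  move=> AC BC; have C0 := le_trans (normr_ge0 _) AC.
  rewrite /sqr_modulus /= -(real_normK (num_real A)) -(real_normK (num_real B)).
  by apply: lerD; rewrite lerXn2r// nnegrE.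
apply: le_trans (sq _ _ _ b1 b2) _; rewrite le_eqVlt; apply/orP; left; apply/eqP.
by rewrite exprMn real_normK ?num_real// exprMn; ring.
Qed.

Variables (df : 'I_3 -> R3 -> R) (dk : 'I_3 -> 'I_3 -> R3 -> R).
Hypothesis (fdf : forall a, is_wpartial a f (df a)).
Hypothesis (kdk : forall a b, is_wpartial a (kappa b) (dk a b)).
Hypothesis If : mu3.-integrable setT (EFin \o (fun r => f r ^+ 2)).

(* By the Riemann-Lebesgue lemma the kernels tend to 0 off the null set where some
   coordinates agree. *)
Lemma gram_factor_HS : exists2 L : R, 0 < L &
  \int[mu6]_p sqr_modulus (gram (factor f kappa L) (factor f kappa L) p) <= 1.
Proof.
pose Dn (n : nat) := gram (factor f kappa n.+1%:R) (factor f kappa n.+1%:R).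
have Sn n : sliceL2 (factor f kappa n.+1%:R) by exact: (factor_sliceL2 _ fdf kdk If).
have LDn n : memL2 mu6 setT (Dn n) by exact: gram_memL2.
have IT : mu6.-integrable setT (EFin \o (fun p => f p.1 ^+ 2 * f p.2 ^+ 2)).
  exact: (rint_tensor If If).
have qq0 (c : R) : (fun n : nat => qq (c / n.+1%:R)) @ \oo --> (0 : R).
  have h : (fun n : nat => c / n.+1%:R) @ \oo --> (0 : R).
    by rewrite -[X in _ --> X](mulr0 c); apply: cvgM; [exact: cvg_cst|exact: cvg_harmonic].
  have -> : (0 : R) = ((1 + `|0 : R| + 0 ^+ 2) ^+ 2 - 1) / 6 by rewrite normr0 expr0n !addr0 expr1n subrr mul0r.
  apply: cvgM; last exact: cvg_cst.
  apply: cvgB; last exact: cvg_cst.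
  have h2 : (fun n : nat => 1 + `|c / n.+1%:R| + (c / n.+1%:R) ^+ 2) @ \oo --> 1 + `|0 : R| + 0 ^+ 2.
    apply: cvgD; last by rewrite !expr2; exact: cvgM.
    by apply: cvgD; [exact: cvg_cst|exact: cvg_norm].
  by rewrite !expr2; exact: cvgM.
have cv : {ae mu6, forall p, setT p -> (fun n => (sqr_modulus (Dn n p))%:E) @ \oo --> 0%E}.
  apply: ae_imp (@ae_coord_neq R) => -[r s] rs _; apply: cvg_EFin; first exact: nearW.
  pose c b : R := pi / (coord3 s b - coord3 r b).
  have up : (fun n : nat => 2 * (f r ^+ 2 * f s ^+ 2) * (\sum_b qq (c b / n.+1%:R)) ^+ 2) @ \oo --> (0 : R).
    have h : (fun n : nat => \sum_b qq (c b / n.+1%:R)) @ \oo --> \sum_(b < 3) (0 : R).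
      by apply: cvg_big => [|b _]; [exact: add_continuous|exact: qq0].
    rewrite big1// in h; rewrite -[X in _ --> X](mulr0 (2 * (f r ^+ 2 * f s ^+ 2))).
    apply: cvgM; first exact: cvg_cst.
    by rewrite -[X in _ --> X](mulr0 (0 : R)); under eq_fun do rewrite expr2; exact: cvgM.
  apply: (squeeze_cvgr _ (cvg_cst 0) up); apply: nearW => n; rewrite sqr_modulus_ge0 /=.
  have := gram_factor_le (ltr0Sn R n) rs; congr (_ <= _ * _ ^+ 2).
  by apply: eq_bigr => b _; congr qq; rewrite /c invfM mulrCA mulrC.
(* Cauchy-Schwarz gives a majorant independent of n, because the column norms of the factor do not
   involve L. *)
have dom : {ae mu6, forall p, forall n, setT p -> (`|(sqr_modulus (Dn n p))%:E| <= (f p.1 ^+ 2 * f p.2 ^+ 2)%:E)%E}.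
  apply: aeW => p n _; rewrite /= lee_fin ger0_norm ?sqr_modulus_ge0//.
  by apply: le_trans (gram_le p (Sn n) (Sn n)) _; rewrite !col2_factor.
have mDn n : measurable_fun setT (fun p => (sqr_modulus (Dn n p))%:E).
  by apply/measurable_EFinP; apply: measurable_sqr_modulus; exact: memL2_cmeasurable.
have [_ _] := @dominated_convergence _ R6 R mu6 setT measurableT (fun n p => (sqr_modulus (Dn n p))%:E)
  (cst 0%E) (fun p => (f p.1 ^+ 2 * f p.2 ^+ 2)%:E) mDn (measurable_cst 0%E) cv IT dom.
rewrite integral0 => /fine_cvg /cvgr0_norm_lt /(_ _ ltr01) [n _ /(_ n (leqnn n))] /= h.
exists n.+1%:R => //; apply: le_trans (ler_norm _) _; exact: ltW h.
Qed.

End HilbertSchmidt.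
End OperatorBound.

(** * The density matrix and the choice of the constants *)

Theorem mainTheorem1 (R : realType) (N : nat) (rho : R3 R -> R)
    (kappa : 'I_3 -> R3 R -> R)
    (N_ge1 : (1 <= N)%N)
    (rho_meas : measurable_fun [set: R3 R] rho)
    (rho_ge0 : forall r, 0 <= rho r)
    (rho_int : (\int[mu3 R]_r (rho r)%:E = N%:R%:E)%E)
    (kappa_meas : forall a, measurable_fun [set: R3 R] (kappa a))
    (sqrt_rho_H1 : memH1 (fun r => Num.sqrt (rho r)))
    (rho_kappa2_L1 : forall a,
      (mu3 R).-integrable [set: R3 R] (fun r : R3 R =>
        (rho r * kappa a r ^+ 2)%:E))
    (kappa_wpartial : forall a b, has_wpartial a (kappa b))
    (rho_dkappa2_L1 : forall a b,
      (mu3 R).-integrable [set: R3 R] (fun r : R3 R =>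
        ((1 + sqr_radius r) * rho r * wpartial a (kappa b) r ^+ 2)%:E)) :
  exists (lambda mu : R) (D : R6 R -> R[i]),
    [/\ 0 <= lambda, 0 < mu,
        one_rdm N D,
        has_density D rho /\
        has_current D (fun a r => 1 / 2 * rho r * kappa a r) &
        exists2 T : R, canonical_kinetic_energy D T &
          T <= T_W rho + 4 * T_p rho (fun a r => 1 / 2 * rho r * kappa a r)
               + 1 / 2 * (lambda + mu) * N%:R
               + \int[mu3 R]_r (rho r
                   * (3 / 4 * sqr_radius r + 1 / (32 * mu))
                   * \sum_(a < 3) \sum_(b < 3) wpartial a (kappa b) r ^+ 2)].
Proof.
pose f r := Num.sqrt (rho r).
have f2 r : f r ^+ 2 = rho r by rewrite sqr_sqrtr.
have [[mf If] dfex] := sqrt_rho_H1.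
have dfex' a : exists h, is_wpartial a f h /\ memL2real h.
  by have [h h1 h2] := dfex a; exists h.
have [df Hdf] := choice dfex'.
have fdf a : is_wpartial a f (df a) by case: (Hdf a).
have Idf a : (mu3 R).-integrable setT (EFin \o (fun r => df a r ^+ 2)) by case: (Hdf a) => _ [].
pose dk a b := wpartial a (kappa b).
have kdk a b : is_wpartial a (kappa b) (dk a b).
  exact: (getPex (kappa_wpartial a b)).
have Ik b : (mu3 R).-integrable setT (EFin \o (fun r => f r ^+ 2 * kappa b r ^+ 2)).
  by have := rho_kappa2_L1 b; congr integrable; apply/funext => r /=; rewrite f2.
have Idk a b : (mu3 R).-integrable setT (EFin \o (fun r => f r ^+ 2 * dk a b r ^+ 2)).
  apply: rint_le (rho_dkappa2_L1 a b) => //.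
    apply: measurable_funM; apply: measurable_funX => //.
    by have [_ /L1loc3_measurable] := kdk a b.
  move=> r _; rewrite f2 -/(dk a b) -mulrA.
  have r2 : 0 <= sqr_radius r by apply: sumr_ge0 => a' _; exact: sqr_ge0.
  have y0 : 0 <= rho r * dk a b r ^+ 2 := mulr_ge0 (rho_ge0 r) (sqr_ge0 _).
  by rewrite (ger0_norm y0) (ger0_norm (mulr_ge0 (addr_ge0 ler01 r2) y0)) ler_peMl// lerDl.
have [L L0 HS] := gram_factor_HS fdf kdk If.
pose G := factor f kappa L; pose g a := dfactor f df kappa dk L a.
have SG : sliceL2 G by exact: (factor_sliceL2 L fdf kdk If).
have Sg a : sliceL2 (g a) by exact: (dfactor_sliceL2 L fdf kdk If Idf Ik Idk a).
pose D := gram G G.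
have LD := gram_memL2 SG SG.
(* A sum with one term, so that positivity and trace of [D] are instances of the results for
   families. *)
have D1 : D = (fun p => \sum_(a < 1) gram G G p) by apply/funext => p; rewrite big_ord1.
have SG1 (a : 'I_1) : sliceL2 ((fun=> G) a) by [].
pose M p := \sum_(a < 3) gram (g a) (g a) p.
have DM : is_wgrad1_dot_grad2 D M.
  apply: is_wgrad1_dot_grad2_slices => // a u.
  exact: (factor_wpartial L fdf kdk If Idf Ik Idk a u).
have mK (K : set (R3 R)) : compact K -> measurable K by exact: compact_measurable3.
have fact : factorization D G by split; [case: SG|exact: aeW].
pose t := gsum_trace g setT; pose T := t / 2.
(* The right-hand side of the estimate at mu = 1, without the term in lambda + mu. *)
pose S := T_W rho + 4 * T_p rho (fun a r => 1 / 2 * rho r * kappa a r)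
  + \int[mu3 R]_r (rho r * (3 / 4 * sqr_radius r + 1 / (32 * 1))
                   * \sum_(a < 3) \sum_(b < 3) wpartial a (kappa b) r ^+ 2).
have N0 : 0 < N%:R :> R by rewrite ltr0n.
(* The constant [lambda] absorbs the kinetic energy, which only has to be finite. *)
exists (Num.max 0 (2 * (T - S) / N%:R)), 1, D.
split; [by rewrite le_max lexx|exact: ltr01| | |].
- split.
  + exact: LD.
  + by rewrite D1; exact: (gsum_trace_class SG1 measurableT).
  + apply: aeW => p.
    exact: (esym (congr1 (fun F : R6 R -> R[i] => F (p.1, p.2)) (gram_hermitian SG))).
  + move=> h Lh; apply/andP; split.
      by rewrite D1; exact: (kpositive_gsum SG1 measurableT).
    (* The Hilbert-Schmidt bound yields occupation numbers at most 1, hence at most 2. *)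
    have := kform_le_norm2 LD HS Lh; rewrite -/D (kform_gram SG Lh) /= => h1.
    have -> : (2 : R[i]) * (\int[mu3 R]_r sqr_modulus (h r))%:C%C = (2 * norm2 h)%:C%C.
      by rewrite rmorphM/= rmorph_nat.
    rewrite lecR; apply: le_trans h1 _.
    by have := norm2_ge0 h; lra.
  + have := gsum_has_trace SG1 measurableT; rewrite -D1.
    rewrite (_ : gsum_trace _ _ = N%:R); first by rewrite rmorph_nat.
    (* The trace is the integral of |G|^2 over all pairs; evaluated by columns it is the integral of
       the density. *)
    rewrite /gsum_trace big_ord1 -[LHS]/(\int[mu3 R]_u row2 G u) -total_row2// total_col2//.
    under eq_Rintegral do rewrite col2_factor f2.
    by rewrite /Rintegral rho_int.
- split.
    by exists G => //; apply: aeW => r; rewrite -f2; exact: (esym (gram_factor_diag f kappa L r)).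
  split; first by exists M => // K cK; exact: gsum_trace_class (mK K cK).
  exists G, g; split.
  + exact: fact.
  + move=> a; apply: is_wpartial2_slices; [by case: SG|by case: (Sg a)|move=> u].
    exact: (factor_wpartial L fdf kdk If Idf Ik Idk a u).
  + move=> a K cK; apply: memL2_subset; last by case: (Sg a).
    by apply: measurableX => //; exact: mK.
  + by move=> a; apply: aeW => r; rewrite -f2; exact: (esym (current_factor f df kappa dk L0 a r)).
exists T; first by exists M, t; split => //; [exact: gsum_trace_class measurableT|exact: gsum_has_trace measurableT].
have ST : T <= S + 1 / 2 * (Num.max 0 (2 * (T - S) / N%:R) + 1) * N%:R.
  have h : 2 * (T - S) / N%:R * N%:R <= Num.max 0 (2 * (T - S) / N%:R) * N%:R.
    by rewrite ler_wpM2r ?ler0n// le_max lexx orbT.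
  by rewrite divfK ?gt_eqF// in h; nra.
by move: ST; rewrite {1}/S addrAC.
Qed.
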